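(* Let $d\in\mathbb{N}$, $\mu\in\mathbb{R}^d\setminus\{\mathbf{0}\}$, $\Sigma$ a symmetric non-negative definite $d\times d$ matrix, $B$ a standard $d$-dimensional Brownian motion, and $X(t):=\mu t+\Sigma^{1/2}B(t)$, $t\ge0$. Then almost surely the sequence of functions $(t\mapsto\psi_n(X(nt)))_{t\in[0,1]}$, $n\in\mathbb{N}$, in $\mathcal{C}_d^0$ is relatively compact, and its set of limit points is $W_{d,\mu,\Sigma}$.
   Context: Fix an orthonormal basis $e_1,\ldots,e_d$ of $\mathbb{R}^d$ with $e_1=\mu/\|\mu\|$ and write vectors in coordinates with respect to it. $\Sigma^{1/2}$ is the symmetric non-negative definite square root. $\ell(n):=1$ for $n\in\{0,1,2\}$ and $\ell(n):=\sqrt{2n\log\log n}$ for $n\ge3$. $\psi_n(x_1,\ldots,x_d):=(x_1/n,x_2/\ell(n),\ldots,x_d/\ell(n))$. $\mathcal{C}_d^0$ is the space of continuous $f:[0,1]\to\mathbb{R}^d$ with $f(0)=\mathbf{0}$, with the uniform metric $\rho_\infty(f,g)=\sup_{t}\|f(t)-g(t)\|$. $\Sigma_{\mu^\perp}$ is the $(d-1)\times(d-1)$ matrix with entries $(\Sigma_{\mu^\perp})_{ij}=e_{i+1}^\top\Sigma e_{j+1}$. $U_{d-1}$ is the set of $f:[0,1]\to\mathbb{R}^{d-1}$ with $f(0)=\mathbf{0}$, absolutely continuous components, and $\int_0^1\|f'(s)\|^2ds\le1$. $I_\mu(t):=\|\mu\|t$. For $d\ge2$, $W_{d,\mu,\Sigma}:=\{t\mapsto(I_\mu(t),\Sigma_{\mu^\perp}^{1/2}f(t)):f\in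 U_{d-1}\}$; for $d=1$, $W_{1,\mu,\Sigma}:=\{I_\mu\}$. *)

(* Defs.v *)
From HB Require Import structures.
From mathcomp Require Import all_boot all_order all_algebra.
From mathcomp Require Import all_classical all_reals all_analysis.
Set Implicit Arguments. Unset Strict Implicit. Unset Printing Implicit Defensive.
Import Order.TTheory GRing.Theory Num.Theory.
Import numFieldNormedType.Exports.
Local Open Scope classical_set_scope.
Local Open Scope ring_scope.

Section defs.
Variable R : realType.

Definition eucl (m : nat) (v : 'rV[R]_m) : R := Num.sqrt (\sum_(i < m) v ord0 i ^+ 2).

Definition psd (m : nat) (A : 'M[R]_m) : Prop :=
  A^T = A /\ forall v : 'rV[R]_m, 0 <= (v *m A *m v^T) ord0 ord0.

Definition psd_sqrt (m : nat) (S A : 'M[R]_m) : Prop := psd S /\ S *m S = A.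

Definition unit_interval : set R := [set t | 0 <= t <= 1].

Definition std_BM (dT : measure_display) (T : measurableType dT)
  (P : probability T R) (m : nat) (B : R -> T -> 'rV[R]_m) : Prop :=
  (forall t (j : 'I_m), measurable_fun setT (fun w => B t w ord0 j)) /\
  {ae P, forall w, B 0 w = 0 /\ continuous (fun t : R => B t w)} /\
  (forall (k : nat) (t : nat -> R) (A : nat -> 'I_m -> set R),
     0 <= t 0%N -> (forall i, (i < k)%N -> t i < t i.+1) ->
     (forall i j, measurable (A i j)) ->
     P (\bigcap_(i in [set i | (i < k)%N]) \bigcap_(j in [set: 'I_m])
          [set w | (B (t i.+1) w - B (t i) w) ord0 j \in A i j])
     = (\prod_(i < k) \prod_(j < m)
          normal_prob 0 (Num.sqrt (t i.+1 - t i)) (A i j))%E).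

Definition adapted_onb (m : nat) (E : 'M[R]_m.+1) (mu : 'rV[R]_m.+1) : Prop :=
  E *m E^T = 1%:M /\ row ord0 E = (eucl mu)^-1 *: mu.

Definition coords (m : nat) (E : 'M[R]_m) (x : 'rV[R]_m) : 'rV[R]_m := x *m E^T.

Definition ell (n : nat) : R :=
  if (n <= 2)%N then 1 else Num.sqrt (2 * n%:R * ln (ln n%:R)).

Definition psi (m : nat) (n : nat) (x : 'rV[R]_m.+1) : 'rV[R]_m.+1 :=
  \row_i (if i == ord0 then x ord0 i / n%:R else x ord0 i / ell n).

(** X(t) = mu t + Sigma^{1/2} B(t) (row-vector convention, S symmetric) *)
Definition Xproc (dT : measure_display) (T : measurableType dT) (m : nat)
  (mu : 'rV[R]_m) (S : 'M[R]_m) (B : R -> T -> 'rV[R]_m) (t : R) (w : T)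
  : 'rV[R]_m := t *: mu + B t w *m S.

Definition Fseq (dT : measure_display) (T : measurableType dT) (m : nat)
  (mu : 'rV[R]_m.+1) (S E : 'M[R]_m.+1) (B : R -> T -> 'rV[R]_m.+1) (w : T)
  (n : nat) (t : R) : 'rV[R]_m.+1 :=
  psi n (coords E (Xproc mu S B (n%:R * t) w)).

Definition Sigma_perp (m : nat) (E Sigma : 'M[R]_m.+1) : 'M[R]_m :=
  \matrix_(i, j) (E *m Sigma *m E^T) (lift ord0 i) (lift ord0 j).

Definition inC0 (m : nat) (g : R -> 'rV[R]_m) : Prop :=
  {within unit_interval, continuous g} /\ g 0 = 0.

Definition ucvg01 (m : nat) (F : nat -> R -> 'rV[R]_m) (g : R -> 'rV[R]_m) : Prop :=
  forall e : R, 0 < e -> exists N : nat, forall n, (N <= n)%N ->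
    forall t, unit_interval t -> eucl (F n t - g t) < e.

Definition strict_incr (phi : nat -> nat) : Prop := forall n, (phi n < phi n.+1)%N.

Definition rel_compact_seq (m : nat) (F : nat -> R -> 'rV[R]_m) : Prop :=
  forall phi, strict_incr phi -> exists psi', strict_incr psi' /\
    exists g, inC0 g /\ ucvg01 (fun n => F (phi (psi' n))) g.

Definition seq_limit_point (m : nat) (F : nat -> R -> 'rV[R]_m) (g : R -> 'rV[R]_m) : Prop :=
  inC0 g /\ exists phi, strict_incr phi /\ ucvg01 (fun n => F (phi n)) g.

Definition abs_cont01 (h : R -> R) : Prop :=
  forall e : R, 0 < e -> exists2 delta : R, 0 < delta &
    forall (n : nat) (a b : nat -> R),
      (forall i, (i < n)%N -> 0 <= a i /\ a i <= b i /\ b i <= 1) ->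
      (forall i, (i.+1 < n)%N -> b i <= a i.+1) ->
      \sum_(i < n) (b i - a i) < delta ->
      \sum_(i < n) `|h (b i) - h (a i)| < e.

Definition inU (m : nat) (f : R -> 'rV[R]_m) : Prop :=
  f 0 = 0 /\ (forall i : 'I_m, abs_cont01 (fun s => f s ord0 i)) /\
  (\int[lebesgue_measure]_(s in unit_interval)
      (\sum_(i < m) (derive1 (fun u => f u ord0 i) s) ^+ 2)%:E <= 1)%E.

(** the element t |-> (I_mu(t), Sigma_perp^{1/2} f(t)) of W *)
Definition Wfun (m : nat) (mu : 'rV[R]_m.+1) (Sp : 'M[R]_m) (f : R -> 'rV[R]_m)
  (t : R) : 'rV[R]_m.+1 :=
  \row_i (if unlift ord0 i is Some j then (f t *m Sp) ord0 j else eucl mu * t).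

End defs.

(* Main.v *)
(** By Brownian scaling and the Gaussian tail, the increments of
    [Z_n t = B (n t) / ell n] along [n = 2^j] are controlled almost surely by the
    first Borel-Cantelli lemma in two ways: those of level [r] are eventually at
    most [2 (9/10)^r], and their energy at each fixed level is eventually at most
    [1 + d]. Chaining turns the first bound into a modulus of continuity shared by
    all large [n], hence relative compactness; the second bounds the dyadic
    energies of a limit point by 1. The unit ball [U] is exactly the set of paths
    vanishing at 0 all of whose partitions have energy
    [sum |f (t_i+1) - f (t_i)|^2 / (t_i+1 - t_i)] at most 1. Conversely, along
    [n = 2^(r j)] the increments of [Z_n] over the dyadic intervals of level [r]
    other than the first are independent in [j], and the second Borel-Cantelli
    lemma makes them approach any target of energy below 1 infinitely often; the
    first interval contributes little by the modulus of continuity.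

    The drift direction only keeps the law of large numbers, as [ell n / n]
    tends to 0. On its orthogonal complement [Z_n] is multiplied by a
    rectangular matrix [L] with [L^T L = Sigma_perp = Sp^T Sp], and equality of the
    Gram matrices makes [L] and [Sp] factor through each other by contractions,
    which preserve the energy bound. *)

Require Import Defs.
From HB Require Import structures.
From mathcomp Require Import all_boot all_order all_algebra.
From mathcomp Require Import all_classical all_reals all_analysis.
From mathcomp Require Import measurable_realfun.
From mathcomp Require Import ring lra zify.
Import Order.TTheory GRing.Theory Num.Theory.
Import numFieldNormedType.Exports.
Set Implicit Arguments. Unset Strict Implicit. Unset Printing Implicit Defensive.
Local Open Scope classical_set_scope.
Local Open Scope ring_scope.

(** * Absolute continuity and energy *)

Section chains.
Variable R : realType.
Implicit Types (s t : seq (R * R)) (h : R -> R).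

(** Along powers of two the Borel-Cantelli lemmas are sharp. An increment of [Z_n] of level [r]
    exceeds [y] with probability about [(ln n)^(- y^2 2^r)], independence adds these exponents up to
    the energy, and [ln (2^j) = j ln 2]; so energy 1 is exactly the border between convergence and
    divergence of [sum_j j^(- energy)].

    The ratio 9/10 lies strictly between [1 / sqrt 2] and 1. Since [2 (9/10)^2 > 1], the Gaussian
    exponents outgrow the [2^r] intervals of level [r], and one event controls all levels; since
    [9/10 < 1], chaining sums converge; and paths of energy at most 1, being Hoelder of exponent
    1/2, obey the same kind of modulus.

    Membership in [U] is stated with the pointwise [derive1], which is a default value where [f] is
    not differentiable and is not assumed measurable. The energy of partitions avoids both defects,
    and it passes to limits of paths and through contractions. *)

Definition before (p q : R * R) := p.2 <= q.1.

Definition in01 (p : R * R) := [&& 0 <= p.1, p.1 <= p.2 & p.2 <= 1].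

(** Families of non-overlapping intervals are kept as ordered lists, so that one interval can be
    replaced in place by a partition of it. Degenerate intervals are allowed. *)
Definition chain s := all in01 s && pairwise before s.

Lemma abs_cont01_chain h : abs_cont01 h -> forall e, 0 < e ->
  exists2 delta, 0 < delta & forall s, chain s ->
    \sum_(p <- s) (p.2 - p.1) < delta ->
    \sum_(p <- s) `|h p.2 - h p.1| < e.
Proof.
move=> ach e /ach[delta delta0 H]; exists delta => // s /andP[/allP s01 pws] sd.
rewrite (big_nth (0, 0)) big_mkord.
apply: (H (size s) (fun i => (nth (0, 0) s i).1) (fun i => (nth (0, 0) s i).2)).
- by move=> i si; have /and3P[] := s01 _ (mem_nth (0, 0) si).
- move=> i si; move/(pairwiseP (0, 0)) : pws; apply; rewrite ?inE//.
  exact: ltnW.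
- by rewrite (big_nth (0, 0)) big_mkord in sd.
Qed.

(** Sort by left endpoint: an interval [q] lying before [p] with [p.1 <= q.1] would have
    [q.2 <= q.1], which nondegeneracy excludes. *)
Lemma disjoint_sort s : uniq s -> all in01 s -> all (fun p => p.1 < p.2) s ->
  {in s &, forall p q, p != q -> before p q || before q p} ->
  exists2 t, perm_eq t s & chain t.
Proof.
move=> us s01 snd sd; pose leT (p q : R * R) := p.1 <= q.1.
have leTtot : total leT by move=> p q; exact: le_total.
have leTtr : transitive leT by move=> p q r; exact: le_trans.
exists (sort leT s); first by rewrite perm_sort.
rewrite /chain all_sort s01/=.
have : pairwise leT (sort leT s).
  by rewrite -sorted_pairwise//; exact: sort_sorted.
have : uniq (sort leT s) by rewrite sort_uniq.
rewrite uniq_pairwise => pu pl.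
have {pu pl} := conj pu pl => /andP; rewrite -pairwise_relI.
apply: (@sub_in_pairwise _ (mem s)); last first.
  by rewrite all_sort; apply/allP.
move=> p q ps qs /= /andP[pq lpq].
have /orP[//|qp] := sd p q ps qs pq.
have := allP snd _ qs; rewrite /before /leT in qp lpq *.
by rewrite ltNge (le_trans qp lpq).
Qed.

Fixpoint pairs (a : R) (l : seq R) : seq (R * R) :=
  if l is b :: l' then (a, b) :: pairs b l' else [::].

Lemma pairs_variation (h : R -> R) a b l :
  variation a b h l = \sum_(p <- pairs a l) `|h p.2 - h p.1|.
Proof.
elim: l a => [|c l ih] a; first by rewrite /variation !big_nil.
rewrite /= big_cons -ih /variation /= big_nat_recl//=.
Qed.

Lemma pairs_sum a l : \sum_(p <- pairs a l) (p.2 - p.1) = last a l - a.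
Proof.
elim: l a => [|c l ih] a /=; first by rewrite big_nil subrr.
by rewrite big_cons ih/= addrC addrA subrK.
Qed.

Lemma pairs_bounds a b l : itv_partition a b l ->
  all (fun p => [&& a <= p.1, p.1 <= p.2 & p.2 <= b]) (pairs a l) &&
  pairwise before (pairs a l).
Proof.
elim: l a => //= c l ih a abl; have cbl := itv_partition_cons abl.
have ac : a <= c by case: abl => /= /andP[/ltW].
have /andP[al pl] := ih _ cbl.
rewrite lexx ac (itv_partition_le cbl) pl /= andbT; apply/andP; split.
  by apply: sub_all al => p /and3P[cp -> ->]; rewrite (le_trans ac).
by apply: sub_all al => p /and3P[cp _ _].
Qed.

Lemma chain_refine s t p l : chain (t ++ p :: s) -> itv_partition p.1 p.2 l ->
  chain ((t ++ pairs p.1 l) ++ s).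
Proof.
rewrite /chain !all_cat/= !pairwise_cat/= => /andP[/and3P[t01 p01 s01]].
move=> /and4P[tps pwt ps pws] /pairs_bounds/andP[bl pwl].
rewrite t01 s01 pwt pws pwl /= !andbT.
have /and3P[p0 p12 p1] := p01.
move: tps; rewrite allrel_consr => /andP[tp ts].
apply/and3P; split.
- apply: sub_all bl => q /and3P[pq q12 qp].
  by rewrite /in01 (le_trans p0 pq) q12 (le_trans qp p1).
- rewrite allrel_catl ts /=; apply/allrelP => q r ql rs.
  have /and3P[_ _ qp] := allP bl _ ql.
  exact/(le_trans qp)/(allP ps).
- apply/allrelP => q r qt rl.
  have /and3P[pr _ _] := allP bl _ rl.
  exact: (le_trans (allP tp _ qt) pr).
Qed.

(** The suprema are taken one interval at a time. In the induction [t] collects the intervals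
    already cut up; cutting the next one along a partition keeps the total length, so the bound
    holds for every partition and passes to the supremum. *)
Lemma chain_total_variation h (e delta : R) :
  (forall s, chain s -> \sum_(p <- s) (p.2 - p.1) < delta ->
     \sum_(p <- s) `|h p.2 - h p.1| <= e) ->
  forall s t, chain (t ++ s) -> \sum_(p <- t ++ s) (p.2 - p.1) < delta ->
  ((\sum_(p <- t) `|h p.2 - h p.1|)%:E +
   \sum_(p <- s) total_variation p.1 p.2 h <= e%:E)%E.
Proof.
move=> H; elim => [|p s ih] t.
  by rewrite cats0 => ct td; rewrite big_nil adde0 lee_fin H.
move=> cts d; rewrite big_cons.
have p01 : p.1 <= p.2.
  by move: cts => /andP[]; rewrite all_cat/= => /and3P[_ /and3P[]].
set S := (\sum_(j <- s) _)%E; set A := (\sum_(j <- t) _).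
have S0 : (0 <= S)%E.
  rewrite /S big_seq; apply: sume_ge0 => q qs; apply: total_variation_ge0.
  move: cts => /andP[]; rewrite all_cat/= => /and3P[_ _ /allP/(_ q qs)].
  by case/and3P.
have key l : itv_partition p.1 p.2 l ->
    (A%:E + ((variation p.1 p.2 h l)%:E + S) <= e%:E)%E.
  move=> pl; have := ih _ (chain_refine cts pl).
  rewrite -catA !big_cat/= pairs_sum.
  move: (pl) => [_ /eqP ->] /=.
  rewrite big_cat/= big_cons/= in d => /(_ d).
  by rewrite (pairs_variation h _ p.2) EFinD addeA.
(* One partition of [p] already bounds [S]; being finite, it can be moved across the inequality
   before the supremum is taken. *)
have Sfin : S \is a fin_num.
  have [l pl] : exists l, itv_partition p.1 p.2 l.
    move: p01; rewrite le_eqVlt => /predU1P[->|p12].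
      by exists [::]; split.
    by exists [:: p.2]; exact: itv_partition1.
  rewrite ge0_fin_numE// ltNge leye_eq; apply/negP => /eqP Soo.
  by have := key _ pl; rewrite Soo !addey.
rewrite [(total_variation _ _ _ + S)%E]addeC addeA -leeBrDl ?fin_numD ?Sfin//.
apply: ge_ereal_sup => _ [_ [l pl <-] <-].
rewrite leeBrDl ?fin_numD ?Sfin// -addeA [(S + _)%E]addeC; exact: key.
Qed.

End chains.

(** * Densities of absolutely continuous functions *)

Section lebesgue_stieltjes_density.
Variable R : realType.

(** Precomposition with this retraction extends a function on [[0, 1]] to the line, constant
    outside, keeping monotonicity and any modulus of continuity. *)
Definition clamp01 (x : R) : R := Num.max 0 (Num.min x 1).

Lemma clamp01P x : [\/ x <= 0 /\ clamp01 x = 0, 0 <= x <= 1 /\ clamp01 x = x |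
  1 <= x /\ clamp01 x = 1].
Proof.
rewrite /clamp01; have [x1|/ltW x1] := leP x 1.
  have [x0|/ltW x0] := leP 0 x; first by constructor 2; split => //; apply/andP.
  by constructor 1.
by constructor 3; rewrite max_r.
Qed.

Lemma clamp01_ge0 x : 0 <= clamp01 x.
Proof. by case: (clamp01P x) => -[? ->]; lra. Qed.

Lemma clamp01_le1 x : clamp01 x <= 1.
Proof. by case: (clamp01P x) => -[? ->]; lra. Qed.

Lemma clamp01_id x : 0 <= x <= 1 -> clamp01 x = x.
Proof. by case: (clamp01P x) => -[? ->]; lra. Qed.

Lemma clamp01_homo x y : x <= y -> clamp01 x <= clamp01 y.
Proof.
by case: (clamp01P x) => -[? ->]; case: (clamp01P y) => -[? ->]; lra.
Qed.

Lemma clamp01_lip x y : x <= y -> clamp01 y - clamp01 x <= y - x.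
Proof.
by case: (clamp01P x) => -[? ->]; case: (clamp01P y) => -[? ->]; lra.
Qed.

Lemma interval_endpoints (I : set R) : is_interval I ->
  (lebesgue_measure I < +oo)%E ->
  exists p : R * R, [/\ p.1 <= p.2, `]p.1, p.2[ `<=` I, I `<=` `[p.1, p.2] &
    lebesgue_measure I = (p.2 - p.1)%:E].
Proof.
move=> /is_intervalP ->; set i := Rhull I; move: i => i.
have [->|/set0P[x0 /= x0i]] := eqVneq [set x | x \in i] set0.
  move=> _; exists (0, 0) => /=; split => //; first by rewrite set_itvoo0.
  by rewrite subrr measure0.
rewrite [lebesgue_measure _]lebesgue_measure_itv.
move: i x0i => [[ba a|[|]] [bb b|[|]]]; rewrite in_itv/= ?andbF//.
- move=> x0i; have /itvP ab : x0 \in Interval (BSide ba a) (BSide bb b).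
    by rewrite in_itv.
  exists (a, b) => /=.
  have leab : a <= b.
    by clear x0i; move: ab; case: ba; case: bb => ab;
      rewrite (@le_trans _ _ x0) ?ab// ltW ?ab.
  clear ab x0i; split => //.
  + move=> x; rewrite /= !in_itv/= => /andP[ax xb].
    by apply/andP; split; [case: ba => /=|case: bb => /=]; rewrite // ltW.
  + move=> x; rewrite /= !in_itv/= => /andP[ax xb].
    by apply/andP; split; [case: ba ax => /=|case: bb xb => /=] => // /ltW.
  + rewrite lte_fin; case: ltP => // ba'.
    have -> : a = b by apply/le_anti; rewrite leab ba'.
    by rewrite subrr.
- by rewrite ltry.
- by rewrite ltNyr.
Qed.

Definition ac_increments (F : R -> R) := forall e, 0 < e ->
  exists2 delta, 0 < delta & forall s, chain s ->
    \sum_(p <- s) (p.2 - p.1) < delta ->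
    \sum_(p <- s) (F p.2 - F p.1) <= e.

(** Clamp the intervals to [[0, 1]], drop those that collapse, on which [F] does not grow, and sort
    the others into a chain. Two clamped intervals that overlap come from intervals sharing a
    midpoint [(u + v) / 2]. *)
Lemma ac_increments_disjoint (F : R -> R) :
  (forall x, F x = F (clamp01 x)) -> ac_increments F -> forall e, 0 < e ->
  exists2 delta, 0 < delta & forall (p : nat -> R * R) n,
    (forall k, (p k).1 <= (p k).2) ->
    (forall k l, k != l -> `](p k).1, (p k).2[ `&` `](p l).1, (p l).2[ = set0) ->
    \sum_(k < n) ((p k).2 - (p k).1) < delta ->
    \sum_(k < n) (F (p k).2 - F (p k).1) <= e.
Proof.
move=> Fc acF e /acF[delta delta0 H]; exists delta => // p n p12 pdisj pd.
pose q k := (clamp01 (p k).1, clamp01 (p k).2).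
pose J := [seq k <- iota 0 n | (q k).1 < (q k).2].
have qdisj k l : k != l -> (q k).1 < (q k).2 -> (q l).1 < (q l).2 ->
    before (q k) (q l) || before (q l) (q k).
  move=> kl qk ql; rewrite /before /=; apply/negP => /negP.
  rewrite negb_or -!ltNge => /andP[lk kll].
  have pk : (p k).1 < (p k).2.
    by rewrite ltNge; apply/negP => /clamp01_homo; rewrite leNgt => /negP; apply.
  have pl : (p l).1 < (p l).2.
    by rewrite ltNge; apply/negP => /clamp01_homo; rewrite leNgt => /negP; apply.
  have plk : (p l).1 < (p k).2.
    by rewrite ltNge; apply/negP => /clamp01_homo; rewrite leNgt => /negP; apply.
  have pkl : (p k).1 < (p l).2.
    by rewrite ltNge; apply/negP => /clamp01_homo; rewrite leNgt => /negP; apply.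
  pose u := Num.max (p k).1 (p l).1; pose v := Num.min (p k).2 (p l).2.
  have uv : u < v by rewrite /u /v gt_max !lt_min pk pl plk pkl.
  have [u1 u2] : (p k).1 <= u /\ (p l).1 <= u by rewrite /u !le_max !lexx orbT.
  have [v1 v2] : v <= (p k).2 /\ v <= (p l).2 by rewrite /v !ge_min !lexx orbT.
  have := pdisj k l kl; rewrite -subset0 => /(_ ((u + v) / 2)); apply.
  by split; rewrite /= in_itv/=; apply/andP; split; lra.
have qinj : {in J &, injective q}.
  move=> k l; rewrite !mem_filter => /andP[qk _] /andP[ql _] qkl.
  apply/eqP/negPn/negP => kl; have := qdisj k l kl qk ql.
  by rewrite -qkl /before orbb leNgt qk.
have [t ts ct] : exists2 t, perm_eq t (map q J) & chain t.
  apply: disjoint_sort.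
  - by rewrite map_inj_in_uniq// filter_uniq// iota_uniq.
  - rewrite all_map; apply/allP => k _.
    by rewrite /in01/= clamp01_ge0 clamp01_le1 clamp01_homo.
  - by rewrite all_map; apply/allP => k; rewrite mem_filter => /andP[].
  - move=> _ _ /mapP[k kJ ->] /mapP[l lJ ->] qkl; apply: qdisj.
    + by apply: contraNN qkl => /eqP ->.
    + by move: kJ; rewrite mem_filter => /andP[].
    + by move: lJ; rewrite mem_filter => /andP[].
have sumJ (G : R * R -> R) : \sum_(r <- t) G r =
    \sum_(k < n | (q k).1 < (q k).2) G (q k).
  rewrite (perm_big _ ts)/= big_map big_filter.
  by rewrite -(big_mkord (fun k => (q k).1 < (q k).2) (fun k => G (q k))) /index_iota subn0.
apply: (@le_trans _ _ (\sum_(r <- t) (F r.2 - F r.1))).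
  rewrite sumJ/= [leRHS]big_mkcond/=; apply: ler_sum => k _.
  rewrite Fc (Fc (p k).1); case: ltP => // c21.
  have -> : clamp01 (p k).1 = clamp01 (p k).2.
    by apply/le_anti; rewrite c21 clamp01_homo.
  by rewrite subrr.
apply: H => //; apply: le_lt_trans pd; rewrite sumJ/= big_mkcond/=.
apply: ler_sum => k _; case: ifP => _; first exact: clamp01_lip.
by rewrite subr_ge0.
Qed.

(** The Lebesgue-Stieltjes measure of [F] vanishes on Lebesgue null sets: such a set lies in an open
    set of small measure, whose components are disjoint intervals of small total length, so [F]
    grows little over them. Radon-Nikodym then gives the density. *)
Lemma ac_increments_density (F : R -> R) : {homo F : x y / x <= y} ->
  (forall x, F x = F (clamp01 x)) -> ac_increments F ->
  exists g : R -> R, lebesgue_measure.-integrable setT (EFin \o g) /\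
   forall a b, 0 <= a -> a <= b -> b <= 1 ->
     (F b - F a)%:E = (\int[lebesgue_measure]_(x in `]a, b]) (g x)%:E)%E.
Proof.
move=> ndF Fc acF.
have small (e : R) : 0 < e -> exists2 d, 0 < d & forall x y,
    x <= y -> y - x < d -> F y - F x <= e.
  move=> /acF[d d0 H]; exists d => // x y xy yxd.
  rewrite Fc (Fc x); have := H [:: (clamp01 x, clamp01 y)].
  rewrite !big_seq1; apply; last by apply: le_lt_trans yxd; exact: clamp01_lip.
  by rewrite /chain /= /in01 /= clamp01_ge0 clamp01_le1 clamp01_homo.
have rcF : forall x, F y @[y --> x^'+] --> F x.
  move=> x; apply/cvgrPdist_le => e e0; have [d d0 H] := small e e0.
  near=> y; have xy : x <= y by apply/ltW; near: y; exact: nbhs_right_gt.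
  rewrite distrC ger0_norm ?subr_ge0 ?ndF//; apply: H => //.
  by rewrite ltrBlDl; near: y; apply: nbhs_right_lt; rewrite ltrDl.
pose G : cumulative R R := HB.pack F (isCumulative.Build R _ R F ndF rcF).
pose nu0 := lebesgue_stieltjes_measure G.
have nuoc a b : a <= b -> nu0 `]a, b]%classic = (F b - F a)%:E.
  move=> ab; rewrite /nu0 /lebesgue_stieltjes_measure.
  rewrite /measure_extension measurable_mu_extE/=; last exact: is_ocitv.
  by rewrite wlength_itv_bnd.
(* The total mass is finite because [F] is constant outside [[0, 1]]. *)
have nuT : (nu0 [set: R] <= (F 1 - F 0)%:E)%E.
  rewrite -(bigcup_itvT false false).
  pose I n : set R := `]- (n%:R), n%:R]%classic.
  have cvgI : (nu0 \o I) n @[n --> \oo] --> nu0 (\bigcup_n I n).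
    apply: nondecreasing_cvg_mu; rewrite /I//; first exact: bigcup_measurable.
    by move=> *; apply/subsetPset/subset_itv; rewrite leBSide/= ?lerN2 ler_nat.
  rewrite -(cvg_lim _ cvgI)//; apply: lime_le; first by apply/cvg_ex; exists (nu0 (\bigcup_n I n)).
  apply: nearW => n /=; rewrite /I nuoc ?ge0_cp// lee_fin.
  rewrite Fc (Fc (- n%:R)); by apply: lerB; rewrite ndF ?clamp01_le1 ?clamp01_ge0.
have finnu : fin_num_fun nu0.
  by apply: lty_fin_num_fun; exact: (le_lt_trans nuT (ltry _)).
pose nu : {finite_measure set (measurableTypeR R) -> \bar R} :=
  HB.pack nu0 (isFinite.Build _ (measurableTypeR R) R nu0 finnu).
(* Continuity of [F] excludes atoms, so that components of an open set can be enclosed in closed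
   intervals at no cost. *)
have nucc a b : a <= b -> (nu0 `[a, b]%classic <= (F b - F a)%:E)%E.
  move=> ab; apply/lee_addgt0Pr => e e0; have [d d0 H] := small e e0.
  apply: (@le_trans _ _ (nu0 `]a - d / 2, b]%classic)).
    apply: le_measure; rewrite ?inE//.
    by apply: subset_itv => //; rewrite bnd_simp; lra.
  rewrite nuoc; last by lra.
  by rewrite -EFinD lee_fin; have := H (a - d / 2) a; lra.
have nudom : nu `<< lebesgue_measure.
  apply/null_content_dominatesP => N mN N0.
  apply/eqP; rewrite eq_le measure_ge0 andbT.
  apply/lee_addgt0Pr => e e0; rewrite add0e.
  have [delta delta0 H] := ac_increments_disjoint Fc acF e0.
  have [] := @lebesgue_regularity_outer R N delta mN _ delta0.
    by rewrite [X in (X < _)%E]N0 ltry.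
  move=> U [oU NU UNd].
  have Ud : (lebesgue_measure U < delta%:E)%E.
    apply: le_lt_trans UNd; rewrite -[X in (_ <= X)%E]adde0 -[in X in (_ <= X)%E]N0.
    apply: (@le_trans _ _ (lebesgue_measure ((U `\` N) `|` N))).
      apply: le_measure; rewrite ?inE//; first exact: open_measurable.
      - apply: measurableU => //; apply: measurableD => //; exact: open_measurable.
      - by move=> x Ux; have [Nx|Nx] := pselect (N x); [right|left].
    apply: measureU2 => //; apply: measurableD => //; exact: open_measurable.
  pose I := open_disjoint_itv oU.
  have mI k : measurable (I k) by apply: open_measurable; exact: open_disjoint_itv_open.
  have tI : trivIset setT I by exact: open_disjoint_itv_trivIset.
  have UI : U = \bigcup_k I k by exact: open_disjoint_itv_bigcup.
  have IU k : I k `<=` U by rewrite UI; exact: bigcup_sup.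
  have /choice[p Hp] k : exists q : R * R, [/\ q.1 <= q.2,
      `]q.1, q.2[ `<=` I k, I k `<=` `[q.1, q.2] &
      lebesgue_measure (I k) = (q.2 - q.1)%:E].
    apply: interval_endpoints.
      exact: open_disjoint_itv_is_interval.
    apply: le_lt_trans (lt_trans Ud (ltry _)); apply: le_measure; rewrite ?inE//.
      exact: mI.
    exact: open_measurable.
  apply: (@le_trans _ _ (nu0 U)).
    by apply: le_measure; rewrite ?inE//; exact: open_measurable.
  rewrite UI [leLHS](measure_bigcup nu)//; last by move=> *; exact: mI.
  apply: lime_le; first by apply: is_cvg_nneseries.
  apply: nearW => n; rewrite big_mkord.
  apply: (@le_trans _ _ (\sum_(k < n) (F (p k).2 - F (p k).1)%:E)%E).
    rewrite big_mkcond/=; apply: lee_sum => k _; rewrite in_setT.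
    have [p12 _ Ip _] := Hp k; apply: le_trans (nucc _ _ p12).
    by apply: le_measure; rewrite ?inE//; exact: mI.
  rewrite sumEFin lee_fin; apply: H.
  - by move=> k; case: (Hp k).
  - move=> k l kl; rewrite -subset0 => x [xk xl].
    have [_ Ik _ _] := Hp k; have [_ Il _ _] := Hp l.
    have := tI k l Logic.I Logic.I (ex_intro _ x (conj (Ik _ xk) (Il _ xl))).
    by move/eqP; rewrite (negbTE kl).
  - rewrite -lte_fin; apply: le_lt_trans Ud.
    rewrite -sumEFin UI; apply: (@le_trans _ _ (\sum_(k < n) lebesgue_measure (I k))%E).
      by apply: lee_sum => k _; have [_ _ _ ->] := Hp k.
    rewrite -(big_mkord xpredT (fun k => lebesgue_measure (I k))).
    rewrite measure_bigcup//; last by move=> *; exact: mI.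
    apply: le_trans (nneseries_lim_ge n _) => //.
    by rewrite [leRHS]big_mkcond/=; apply: lee_sum => k _; rewrite in_setT.
have [f [f0 ffin fint fE]] := radon_nikodym_sigma_finite nudom.
exists (fine \o f); split.
  by apply: eq_integrable fint => // x _ /=; rewrite fineK.
move=> a b a0 ab b1; rewrite -nuoc// -/nu [LHS](fE `]a, b]%classic)//.
by apply: eq_integral => x _ /=; rewrite fineK.
Unshelve. all: by end_near. Qed.

End lebesgue_stieltjes_density.

Section ac_density.
Variable R : realType.
Implicit Types f h : R -> R.

Notation TV := total_variation.

Lemma abs_cont01_total_variation f : abs_cont01 f -> forall e, 0 < e ->
  exists2 delta, 0 < delta & forall s, chain s ->
    \sum_(p <- s) (p.2 - p.1) < delta ->
    (\sum_(p <- s) TV p.1 p.2 f <= e%:E)%E.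
Proof.
move=> acf e /(abs_cont01_chain acf)[delta delta0 H]; exists delta => // s cs sd.
have := @chain_total_variation _ f e delta (fun s cs sd => ltW (H s cs sd)) s [::] cs sd.
by rewrite big_nil add0e.
Qed.

(** Cut [[0, 1]] into equal intervals shorter than the [delta] of precision 1; the variation is at
    most 1 on each. *)
Lemma abs_cont01_total_variation_fin f a b : abs_cont01 f ->
  0 <= a -> a <= b -> b <= 1 -> TV a b f \is a fin_num.
Proof.
move=> acf a0 ab b1.
suff : TV 0 1 f \is a fin_num.
  have b0 : 0 <= b := le_trans a0 ab.
  rewrite (total_variationD f b0 b1) (total_variationD f a0 ab).
  by rewrite !fin_numD => /andP[/andP[]].
have [delta delta0 H] := abs_cont01_total_variation acf ltr01.
pose N := Num.trunc delta^-1.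
have N0 : 0 < N.+1%:R :> R by rewrite ltr0n.
have Nd : N.+1%:R^-1 < delta.
  by rewrite invf_plt ?posrE// truncnS_gt.
have tvN i : (i <= N.+1)%N -> TV 0 (i%:R / N.+1%:R) f \is a fin_num.
  elim: i => [|i ih] iN; first by rewrite mul0r total_variationxx.
  have i0 : 0 <= i%:R / N.+1%:R :> R by rewrite divr_ge0.
  have ii : i%:R / N.+1%:R <= i.+1%:R / N.+1%:R :> R.
    by rewrite ler_pM2r ?invr_gt0// ler_nat.
  rewrite (total_variationD f i0 ii) fin_numD ih ?(ltnW iN)//=.
  rewrite ge0_fin_numE ?total_variation_ge0//.
  have := H [:: (i%:R / N.+1%:R, i.+1%:R / N.+1%:R)].
  rewrite !big_seq1/= => /(_ _ _)/le_lt_trans; apply; rewrite ?ltry//.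
    by rewrite /chain /= /in01 /= i0 ii ler_pdivrMr// mul1r ler_nat iN.
  by rewrite -mulrBl -natrB// subSnn mul1r.
by have := tvN N.+1 (leqnn _); rewrite divff// gt_eqF.
Qed.

(** Jordan decomposition [f = V - W], with [V] the variation function: both parts are nondecreasing
    and inherit absolute continuity, so each has a density. *)
Lemma abs_cont01_density f : abs_cont01 f ->
  exists g : R -> R, lebesgue_measure.-integrable setT (EFin \o g) /\
   forall a b, 0 <= a -> a <= b -> b <= 1 ->
     (f b - f a)%:E = (\int[lebesgue_measure]_(x in `]a, b]) (g x)%:E)%E.
Proof.
move=> acf.
pose V x := fine (TV 0 (clamp01 x) f).
have VB x y : 0 <= x -> x <= y -> y <= 1 -> V y - V x = fine (TV x y f).
  move=> x0 xy y1; rewrite /V !clamp01_id; try lra.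
  have x1 := le_trans xy y1.
  rewrite (total_variationD f x0 xy) fineD.
  - by rewrite addrAC subrr add0r.
  - exact: abs_cont01_total_variation_fin.
  - exact: abs_cont01_total_variation_fin.
have Vc x : V x = V (clamp01 x).
  by rewrite /V [clamp01 (clamp01 _)]clamp01_id// clamp01_ge0 clamp01_le1.
have Vge x y : 0 <= x -> x <= y -> y <= 1 -> `|f y - f x| <= V y - V x.
  move=> x0 xy y1; rewrite VB// -lee_fin fineK ?total_variation_ge//.
  exact: abs_cont01_total_variation_fin.
have acV : ac_increments V.
  move=> e /(abs_cont01_total_variation acf)[d d0 H]; exists d => // s cs sd.
  rewrite -lee_fin -sumEFin; apply: le_trans (H s cs sd).
  rewrite big_seq [leRHS]big_seq; apply: lee_sum => p ps.
  have /andP[/allP/(_ _ ps)/and3P[p0 p12 p1] _] := cs.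
  by rewrite VB// fineK//; exact: abs_cont01_total_variation_fin.
pose W x := V x - f (clamp01 x).
have Wc x : W x = W (clamp01 x).
  by rewrite /W -Vc [clamp01 (clamp01 _)]clamp01_id// clamp01_ge0 clamp01_le1.
have acW : ac_increments W.
  move=> e e0; have e20 : 0 < e / 2 by lra.
  have [d d0 H] := acV _ e20.
  have [d' d'0 H'] := abs_cont01_chain acf e20.
  exists (Num.min d d'); first by rewrite lt_min d0.
  move=> s cs; rewrite lt_min => /andP[sd sd'].
  have := H s cs sd; have := ltW (H' s cs sd').
  suff : \sum_(p <- s) (W p.2 - W p.1) <= \sum_(p <- s) (V p.2 - V p.1) +
      \sum_(p <- s) `|f p.2 - f p.1| by lra.
  rewrite -big_split/= big_seq [leRHS]big_seq; apply: ler_sum => p ps.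
  have /andP[/allP/(_ _ ps)/and3P[p0 p12 p1] _] := cs.
  rewrite /W !clamp01_id ?p0 ?p1 ?(le_trans p12) ?(le_trans p0)//.
  by have := ler_norm (f p.1 - f p.2); rewrite distrC; lra.
have ndV : {homo V : x y / x <= y}.
  move=> x y xy; rewrite -subr_ge0 Vc (Vc x) VB ?clamp01_ge0 ?clamp01_le1 ?clamp01_homo//.
  by rewrite fine_ge0// total_variation_ge0// clamp01_homo.
have ndW : {homo W : x y / x <= y}.
  move=> x y xy; rewrite -subr_ge0 Wc (Wc x) /W.
  have := Vge _ _ (clamp01_ge0 x) (clamp01_homo xy) (clamp01_le1 y).
  rewrite ![clamp01 (clamp01 _)]clamp01_id ?clamp01_ge0 ?clamp01_le1//.
  by have := ler_norm (f (clamp01 y) - f (clamp01 x)); lra.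
have [gV [iV HV]] := ac_increments_density ndV Vc acV.
have [gW [iW HW]] := ac_increments_density ndW Wc acW.
exists (fun x => gV x - gW x); split.
  by have := integrableB measurableT iV iW; apply: eq_integrable.
move=> a b a0 ab b1.
under eq_integral do rewrite EFinB.
have sub g : lebesgue_measure.-integrable setT (EFin \o g) ->
    lebesgue_measure.-integrable `]a, b] (EFin \o g).
  by apply: integrableS.
rewrite integralB_EFin ?sub//.
have a01 : 0 <= a <= 1 by lra.
have b01 : 0 <= b <= 1 by lra.
by rewrite -HV// -HW// -EFinB /W !clamp01_id//; congr (_%:E); lra.
Qed.

(** Every Lebesgue point of [g] inside [(0, 1)] is a point where the integral of [g] has derivative
    [g]. The endpoints are left out because [derive1] is two-sided and [f] is arbitrary outside
    [[0, 1]]. *)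
Lemma abs_cont01_derive f : abs_cont01 f ->
  exists g : R -> R, [/\ lebesgue_measure.-integrable setT (EFin \o g),
   (forall a b, 0 <= a -> a <= b -> b <= 1 ->
     (f b - f a)%:E = (\int[lebesgue_measure]_(x in `]a, b]) (g x)%:E)%E) &
   {ae lebesgue_measure, forall x, 0 < x < 1 -> derive1 f x = g x}].
Proof.
move=> /abs_cont01_density[g [ig Hg]]; exists g; split => //.
have locg : locally_integrable [set: R] g.
  by have := integrable_locally (@measurableT _ _) ig; rewrite patch_setT.
have := lebesgue_differentiation locg.
apply: filterS; first exact: (ae_filter_ringOfSetsType lebesgue_measure).
move=> x gx /andP[x0 x1].
pose F y := (\int[lebesgue_measure]_(t in `]0%R, y]) g t)%R.
have FE y : 0 <= y -> y <= 1 -> F y = f y - f 0.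
  by move=> y0 y1; rewrite /F /Rintegral -Hg.
have [||dF F'] := @FTC1_lebesgue_pt R g (BRight 0) x 1 x1 _ _ gx.
- by apply: integrableS ig.
- by rewrite lte_fin.
rewrite -F'.
apply/cvg_lim; first exact: Rhausdorff.
have : h^-1 *: (F (h + x) - F x) @[h --> 0^'] --> derive1 F x.
  have := dF; rewrite /derivable /derive1.
  suff -> : (fun h : R => h^-1 *: ((F \o shift x) (h *: 1) - F x)) =
    (fun h : R => h^-1 *: (F (h + x) - F x)) by [].
  by apply/funext => h; rewrite /= [h *: 1]mulr1.
apply: cvg_trans; apply: near_eq_cvg; near=> h.
have h1 : `|h| < x /\ `|h| < 1 - x.
  by split; near: h; apply: dnbhs0_lt; rewrite ?subr_gt0.
have hx0 : - x < h by move: h1 => -[+ _]; rewrite ltr_norml => /andP[].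
have hx1 : h < 1 - x by move: h1 => -[_]; rewrite ltr_norml => /andP[].
rewrite !FE; [|lra..].
by congr (_ *: _); lra.
Unshelve. all: by end_near. Qed.

End ac_density.

(** * The unit ball as the set of paths of energy at most 1 *)

Section energy.
Variable R : realType.

Import HBNNSimple.

(* The integrand is not assumed measurable, so [f2] may be a derivative that
   is only known almost everywhere. *)
Lemma ge0_le_integralW d (T : measurableType d)
    (mu : {measure set T -> \bar R}) (D : set T) (f1 f2 : T -> \bar R) :
  (forall x, D x -> (0 <= f1 x)%E) -> (forall x, D x -> (f1 x <= f2 x)%E) ->
  (\int[mu]_(x in D) f1 x <= \int[mu]_(x in D) f2 x)%E.
Proof.
move=> f10 f12; have f20 x : D x -> (0 <= f2 x)%E.
  by move=> Dx; rewrite (le_trans (f10 x Dx)) ?f12.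
rewrite (ge0_integralE _ f10) (ge0_integralE _ f20).
apply: ereal_sup_le => _ [h hf <-].
exists h => // x; apply: le_trans (hf x) _.
rewrite !patchE; case: ifPn => // /set_mem; exact: f12.
Qed.

(** A degenerate interval contributes 0, since the inverse of 0 is 0. *)
Definition energy_le m (f : R -> 'rV[R]_m) (E : R) := forall s, chain s ->
  \sum_(p <- s) \sum_(c < m)
    (f p.2 ord0 c - f p.1 ord0 c) ^+ 2 / (p.2 - p.1) <= E.

Lemma chain_telescope (e : R -> R) s :
  (forall x y, 0 <= x -> x <= y -> y <= 1 -> e x <= e y) -> chain s ->
  \sum_(p <- s) (e p.2 - e p.1) <= e 1 - e 0.
Proof.
move=> nd; suff H x : 0 <= x <= 1 -> all (fun p => x <= p.1) s -> chain s ->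
    \sum_(p <- s) (e p.2 - e p.1) <= e 1 - e x.
  move=> cs; apply: H => //; first by rewrite lexx ler01.
  by case/andP: cs => + _; apply: sub_all => p /and3P[].
elim: s x => [|p s ih] x /andP[x0 x1] /=.
  by rewrite big_nil subr_ge0 nd.
move=> /andP[xp xs] /andP[/= /andP[/and3P[p0 p12 p1] s01] /andP[ps pws]].
rewrite big_cons; have := ih p.2 _ ps _.
rewrite p1 (le_trans p0 p12) /chain s01 pws => /(_ erefl erefl) ihs.
by have := nd x p.1 x0 xp (le_trans p12 p1); lra.
Qed.

(** On each interval Jensen's inequality bounds the squared increment over the length by the
    integral of [G], the squared norm of the density; the cumulated integral [e] then telescopes
    along the chain. *)
Lemma inU_energy m (f : R -> 'rV[R]_m) : inU f -> energy_le f 1.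
Proof.
move=> [_ [acf intf]].
have /choice[g Hg] (c : 'I_m) := abs_cont01_derive (acf c).
have ig c : lebesgue_measure.-integrable setT (EFin \o g c) by case: (Hg c).
have fg c a b : 0 <= a -> a <= b -> b <= 1 -> (f b ord0 c - f a ord0 c)%:E =
    (\int[lebesgue_measure]_(x in `]a, b]) (g c x)%:E)%E.
  by have [_ H _] := Hg c; exact: H.
have mg c : measurable_fun setT (g c).
  by have /integrableP[/measurable_EFinP] := ig c.
pose G x := \sum_(c < m) g c x ^+ 2.
have G0 x : 0 <= G x by apply: sumr_ge0 => c _; exact: sqr_ge0.
have mG : measurable_fun setT G.
  by apply: measurable_sum => c; exact: measurable_funX.
have mGE D : measurable D -> measurable_fun D (EFin \o G).
  by move=> mD; apply/measurable_EFinP; exact: measurable_funTS.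
pose I01 : set R := `[0, 1]%classic.
have mI01 : measurable I01 by exact: measurable_itv.
have G1 : (\int[lebesgue_measure]_(x in I01) (G x)%:E <= 1)%E.
  have [N [mN N0 HN]] : {ae lebesgue_measure, forall x, forall c, 0 < x < 1 ->
      derive1 (fun u => f u ord0 c) x = g c x}.
    by apply: filter_forall => c; case: (Hg c).
  (* The endpoints join the null set, as nothing relates [derive1] to the density there. *)
  pose N' := N `|` [set 0; 1].
  have mN' : measurable N'.
    by apply: measurableU => //; exact: measurableU.
  have N'0 : lebesgue_measure N' = 0%E.
    have m01 : measurable ([set 0; 1] : set R) by exact: measurableU.
    rewrite /N' [LHS]measureU0 ?N0//.
    by rewrite [LHS]measureU0//; exact: lebesgue_measure_set1.
  (* [H] is measurable and lies below the sum of squared derivatives at every point of [[0, 1]], so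
     the comparison asks no measurability of the latter. *)
  pose H x := G x * \1_(~` N') x.
  have mH : measurable_fun setT H.
    by apply: measurable_funM => //; apply: measurable_indic; exact: measurableC.
  have -> : (\int[lebesgue_measure]_(x in I01) (G x)%:E =
      \int[lebesgue_measure]_(x in I01) (H x)%:E)%E.
    apply: ge0_ae_eq_integral => //.
    - exact: mGE.
    - by apply/measurable_EFinP; exact: measurable_funTS.
    - by move=> x _; rewrite lee_fin.
    - by move=> x _; rewrite lee_fin mulr_ge0.
    - exists N'; split => // x /= /not_implyP[_]; apply: contra_notP => N'x.
      by rewrite /H indicE mem_set// mulr1.
  apply: le_trans intf.
  have -> : unit_interval (R:=R) = I01.
    by apply/seteqP; split => x; rewrite /unit_interval /I01 /= in_itv.
  apply: ge0_le_integralW => x; rewrite /I01 /= in_itv/= => /andP[x0 x1].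
    by rewrite lee_fin mulr_ge0.
  rewrite lee_fin /H indicE; have [N'x|N'x] := pselect (N' x).
    rewrite memNset ?mulr0; last by move=> /(_ N'x).
    by apply: sumr_ge0 => c _; exact: sqr_ge0.
  rewrite mem_set// mulr1; apply: ler_sum => c _.
  have x01 : 0 < x < 1.
    by rewrite !lt_neqAle x0 x1 !andbT; apply/andP; split; apply/eqP => xE;
      apply: N'x; right; [left|right]; rewrite -xE.
  have -> // : derive1 (fun u => f u ord0 c) x = g c x.
  have [//|fx] := pselect (derive1 (fun u => f u ord0 c) x = g c x).
  by exfalso; apply: N'x; left; apply: HN => /= /(_ c x01).
have iG D : measurable D -> D `<=` I01 -> lebesgue_measure.-integrable D (EFin \o G).
  move=> mD DI; apply: (@integrableS _ _ _ lebesgue_measure I01 D) => //.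
  apply/integrableP; split; first exact: mGE.
  under eq_integral do rewrite /= ger0_norm//.
  exact: le_lt_trans G1 (ltry _).
pose e t := fine (\int[lebesgue_measure]_(x in `]0%R, t]) (G x)%:E)%E.
have sub0 t : t <= 1 -> `]0, t]%classic `<=` I01.
  move=> t1 x; rewrite /I01 /= !in_itv/= => /andP[x0 xt].
  by rewrite (ltW x0) (le_trans xt).
have eB a b : 0 <= a -> a <= b -> b <= 1 ->
    (e b - e a)%:E = (\int[lebesgue_measure]_(x in `]a, b]) (G x)%:E)%E.
  move=> a0 ab b1; have a1 := le_trans ab b1.
  have fin D : measurable D -> D `<=` I01 ->
      (\int[lebesgue_measure]_(x in D) (G x)%:E)%E \is a fin_num.
    by move=> mD DI; apply: integrable_fin_num => //; exact: iG.
  rewrite EFinB !fineK; try (apply: fin => //; exact: sub0).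
  have -> : (`]0%R, b] = `]0%R, a] `|` `]a, b])%classic.
    by rewrite -itv_bndbnd_setU// bnd_simp.
  rewrite ge0_integral_setU//=; last 3 first.
  - by apply: mGE; exact: measurableU.
  - by move=> x _; rewrite lee_fin.
  - by apply/disj_set2P; rewrite -subset0 => x [] /=; rewrite !in_itv/= => /andP[_ ?] /andP[?]; lra.
  rewrite addeAC subee ?add0e//; apply: fin => //; exact: sub0.
move=> s cs; apply: (@le_trans _ _ (\sum_(p <- s) (e p.2 - e p.1))); last first.
  apply: (@le_trans _ _ (e 1 - e 0)).
    apply: chain_telescope cs => x y x0 xy y1.
    rewrite -subr_ge0 -lee_fin eB//; apply: integral_ge0 => z _.
    by rewrite lee_fin.
  rewrite -lee_fin eB//; apply: le_trans G1.
  apply: ge0_subset_integral => //; first exact: mGE.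
  - by move=> x _; rewrite lee_fin.
  - exact: sub0.
rewrite big_seq [leRHS]big_seq; apply: ler_sum => p ps.
have /andP[/allP/(_ _ ps)/and3P[p0 p12 p1] _] := cs.
have [p21|p21] := eqVneq p.2 p.1.
  rewrite p21 !subrr; under eq_bigr do rewrite invr0 mulr0.
  by rewrite big1.
have lt12 : 0 < p.2 - p.1 by rewrite subr_gt0 lt_neqAle eq_sym p21.
set a := p.1 in p0 p12 p21 lt12 *; set b := p.2 in p12 p1 p21 lt12 *.
(* [k c] is the mean slope; integrating the tangent inequality [2 k g - k^2 <= g^2] gives Jensen's
   inequality. *)
pose k c := (f b ord0 c - f a ord0 c) / (b - a).
have subab : `]a, b]%classic `<=` I01.
  move=> x; rewrite /I01 /= !in_itv/= => /andP[ax xb].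
  by rewrite (le_trans p0 (ltW ax)) (le_trans xb).
have igab c : lebesgue_measure.-integrable `]a, b] (EFin \o g c).
  by apply: integrableS (ig c).
have muab : lebesgue_measure (`]a, b]%classic : set R) = (b - a)%:E.
  by rewrite lebesgue_measure_itv /= lte_fin -subr_gt0 lt12 EFinB.
have icst (r : R) : lebesgue_measure.-integrable `]a, b] (fun=> r%:E).
  apply/integrableP; split => //=; rewrite integral_cst//.
  by rewrite [X in (_ * X)%E]muab ltry.
have ilin c : lebesgue_measure.-integrable `]a, b]
    (fun x => (2 * k c)%:E * (g c x)%:E - (k c ^+ 2)%:E)%E.
  apply: integrableB => //; first exact: integrableZl (igab c).
rewrite -lee_fin eB// -sumEFin.
apply: (@le_trans _ _ (\int[lebesgue_measure]_(x in `]a, b])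
   (\sum_(c < m) ((2 * k c)%:E * (g c x)%:E - (k c ^+ 2)%:E)))%E).
  rewrite integral_sum//; apply: lee_sum => c _.
  rewrite integralB//; last exact: integrableZl (igab c).
  rewrite integralZl//; last exact: igab.
  rewrite [X in (_ * X - _)%E](_ : _ = (f b ord0 c - f a ord0 c)%:E); last first.
    by rewrite fg.
  rewrite integral_cst//.
  rewrite [X in (_ - _ * X)%E]muab -!EFinM -EFinB lee_fin /k le_eqVlt; apply/orP; left; apply/eqP.
  by field; rewrite gt_eqF.
apply: le_integral => //.
- have mab : measurable (`]a, b]%classic : set (measurableTypeR R)) by exact: measurable_itv.
  by apply: (integrable_sum mab) => c _; exact: ilin.
- exact: iG.
move=> x _; rewrite /G -sumEFin; apply: lee_sum => c _.
by rewrite -EFinM -EFinB lee_fin; have := sqr_ge0 (g c x - k c); nra.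
Qed.

End energy.

Section energy_converse.
Variable R : realType.
Local Notation mu := (@lebesgue_measure R).

Lemma limn_einf_ge (u : (\bar R)^nat) (l : R) :
  (forall e, 0 < e -> \forall n \near \oo, ((l - e)%:E <= u n)%E) ->
  (l%:E <= limn_einf u)%E.
Proof.
move=> H; apply/lee_subgt0Pr => e e0; rewrite -EFinB limn_einf_lim.
apply: lime_ge; first exact: is_cvg_einfs.
have [N _ HN] := H e e0; exists N => // n /= Nn.
by apply: le_ereal_inf_tmp => _ [k /= nk <-]; apply: HN; exact: leq_trans nk.
Qed.

Lemma limn_einf_le (u : (\bar R)^nat) (l : \bar R) :
  (forall n, (u n <= l)%E) -> (limn_einf u <= l)%E.
Proof.
move=> H; rewrite limn_einf_lim; apply: lime_le; first exact: is_cvg_einfs.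
apply: nearW => n; apply: le_trans (H n); apply: ereal_inf_lbound.
by exists n => //=; exact: leqnn.
Qed.

(** Dyadic intervals contain [x] without starting there. The first-order errors at [u] and [v] are
    at most [e (x - u)] and [e (v - x)], and these add up to [e (v - u)]. *)
Lemma derivable_straddle (h : R -> R) x : derivable h x 1 -> forall e, 0 < e ->
  exists2 d, 0 < d & forall u v, u <= x -> x <= v -> u < v -> v - u < d ->
    `|(h v - h u) / (v - u) - derive1 h x| <= e.
Proof.
move=> dh e e0.
have : t^-1 *: (h (t + x) - h x) @[t --> 0^'] --> derive1 h x.
  have := dh; rewrite /derivable /derive1.
  suff -> : (fun t : R => t^-1 *: ((h \o shift x) (t *: 1) - h x)) =
    (fun t : R => t^-1 *: (h (t + x) - h x)) by [].
  by apply/funext => t; rewrite /= [t *: 1]mulr1.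
move=> /cvgrPdist_le /(_ _ e0)[d /= d0 Hd]; exists d => //.
have key y : `|y - x| < d -> `|h y - h x - derive1 h x * (y - x)| <= e * `|y - x|.
  have [->|yx] := eqVneq y x; first by rewrite !subrr mulr0 subr0 normr0 mulr0.
  have yx0 : y - x != 0 by rewrite subr_eq0.
  move=> yxd; have := Hd (y - x); rewrite /ball_ /= sub0r normrN subrK.
  move=> /(_ yxd yx0) Hy.
  have -> : h y - h x - derive1 h x * (y - x) =
      - (derive1 h x - (y - x)^-1 *: (h y - h x)) * (y - x).
    by rewrite [_ *: _]mulrC opprB mulrBl divfK.
  by rewrite normrM normrN ler_wpM2r.
move=> u v ux xv uv vud.
have uv0 : 0 < v - u by lra.
have Hu : `|u - x| < d by rewrite distrC ger0_norm; lra.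
have Hv : `|v - x| < d by rewrite ger0_norm; lra.
have := key _ Hu; have := key _ Hv.
rewrite (ger0_norm (_ : 0 <= v - x)) ?subr_ge0// (distrC u) (ger0_norm (_ : 0 <= x - u)) ?subr_ge0//.
rewrite !ler_norml => /andP[v1 v2] /andP[u1 u2].
have -> : (h v - h u) / (v - u) - derive1 h x =
    (h v - h u - derive1 h x * (v - u)) / (v - u).
  by rewrite [RHS]mulrBl mulfK// gt_eqF.
by rewrite ler_pdivlMr// ler_pdivrMr//; apply/andP; split; nra.
Qed.

(* [lim] of a divergent filter is the default point, which is [0] in [R]. *)
Lemma derive1_not_derivable (h : R -> R) x : ~ derivable h x 1 -> derive1 h x = 0.
Proof.
move=> ndh; rewrite /derive1 /lim /lim_in.
case: xgetP => [l lh hl|]; last by [].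
exfalso; apply: ndh; apply/cvg_ex; exists l.
suff -> : (fun t : R => t^-1 *: ((h \o shift x) (t *: 1) - h x)) =
    (fun t : R => t^-1 *: (h (t + x) - h x)) by [].
by apply/funext => t; rewrite /= [t *: 1]mulr1.
Qed.

(** Young's inequality [2 |D| <= d / e + e D^2 / d] for an increment [D] over a length [d], summed
    over the chain. The free [e] makes this as good as Cauchy-Schwarz. *)
Lemma energy_le_variation m (f : R -> 'rV[R]_m) c s e : energy_le f 1 -> chain s ->
  0 < e -> \sum_(p <- s) `|f p.2 ord0 c - f p.1 ord0 c| <=
    (\sum_(p <- s) (p.2 - p.1) / e + e) / 2.
Proof.
move=> Ef cs e0.
have := Ef s cs; set S := \sum_(p <- s) _ => S1.
apply: (@le_trans _ _ ((\sum_(p <- s) (p.2 - p.1) / e + e * S) / 2)); last first.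
  by rewrite ler_pM2r// lerD2l ler_piMr// ltW.
rewrite /S mulr_sumr -big_split/= mulr_suml big_seq [leRHS]big_seq.
apply: ler_sum => p ps.
have /andP[/allP/(_ _ ps)/and3P[p0 p12 p1] _] := cs.
have [p21|p21] := eqVneq p.2 p.1.
  rewrite p21 !subrr normr0 mul0r add0r divr_ge0// mulr_ge0//; first exact: ltW.
  by apply: sumr_ge0 => *; rewrite subrr invr0 mulr0.
have d0 : 0 < p.2 - p.1 by rewrite subr_gt0 lt_neqAle eq_sym p21.
set d := p.2 - p.1 in d0 *; set D := f _ _ _ - f _ _ _.
have : D ^+ 2 / d <= \sum_(c0 < m) (f p.2 ord0 c0 - f p.1 ord0 c0) ^+ 2 / d.
  rewrite (bigD1 c)//= lerDl; apply: sumr_ge0 => i _.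
  by rewrite divr_ge0 ?sqr_ge0// ltW.
move=> H; rewrite ler_pdivlMr//.
have He : e * (D ^+ 2 / d) <= e * \sum_(c0 < m) (f p.2 ord0 c0 - f p.1 ord0 c0) ^+ 2 / d.
  by rewrite ler_pM2l.
apply: le_trans (lerD (lexx _) He).
rewrite -subr_ge0.
have -> : d / e + e * (D ^+ 2 / d) - `|D| * 2 = (d - e * `|D|) ^+ 2 / (d * e).
  by rewrite -(real_normK (num_real D)); field; rewrite ?gt_eqF.
by rewrite divr_ge0 ?sqr_ge0// mulr_ge0// ltW.
Qed.

Lemma chain_of_nat n (a b : nat -> R) :
  (forall i, (i < n)%N -> 0 <= a i /\ a i <= b i /\ b i <= 1) ->
  (forall i, (i.+1 < n)%N -> b i <= a i.+1) ->
  chain [seq (a i, b i) | i <- iota 0 n].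
Proof.
move=> H1 H2.
have ba i j : (i < j)%N -> (j < n)%N -> b i <= a j.
  elim: j => // j ih; rewrite ltnS leq_eqVlt => /predU1P[->|ij] jn; first exact: H2.
  have [_ [ab _]] := H1 _ (ltnW jn).
  by rewrite (le_trans (ih ij (ltnW jn)))// (le_trans ab)// H2.
rewrite /chain all_map; apply/andP; split.
  apply/allP => i; rewrite mem_iota add0n => /andP[_ /H1[? [? ?]]].
  by rewrite /in01 /=; apply/and3P.
apply/(pairwiseP (0, 0)) => i j; rewrite !inE size_map size_iota => il jl ij.
by rewrite /before !(nth_map 0%N) ?size_iota// !nth_iota//= ba.
Qed.

Lemma energy_abs_cont m (f : R -> 'rV[R]_m) c : energy_le f 1 ->
  abs_cont01 (fun s => f s ord0 c).
Proof.
(* With total length below [e^2], the bound [(length / e + e) / 2] is below [e]. *)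
move=> Ef e e0; exists (e ^+ 2); first by rewrite exprn_gt0.
move=> n a b H1 H2; have cs := chain_of_nat H1 H2.
have := energy_le_variation c Ef cs e0.
rewrite -mulr_suml !big_map -[iota 0 n]/(iota 0 n) -{1 2}(subn0 n) !big_mkord => H sd.
apply: le_lt_trans H _; rewrite ltr_pdivrMr// mulr2n mulrDr mulr1 ltrD2r.
by rewrite ltr_pdivrMr// -expr2.
Qed.

End energy_converse.

Section dyadic_grid.
Variable R : realType.

Definition dyadic (r i : nat) : R := i%:R / 2 ^+ r.

Lemma dyadic0 r : dyadic r 0 = 0. Proof. by rewrite /dyadic mul0r. Qed.

Lemma dyadic1 r : dyadic r (2 ^ r) = 1.
Proof. by rewrite /dyadic natrX divff// expf_neq0. Qed.

Lemma dyadicS r i : dyadic r i.+1 - dyadic r i = (2 ^+ r)^-1.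
Proof. by rewrite /dyadic -mulrBl -natrB// subSnn mul1r. Qed.

Lemma dyadic_ge0 r i : 0 <= dyadic r i. Proof. by rewrite divr_ge0// exprn_ge0. Qed.

Lemma dyadic_le r i j : (dyadic r i <= dyadic r j) = (i <= j)%N.
Proof. by rewrite /dyadic ler_pM2r ?ler_nat// invr_gt0 exprn_gt0. Qed.

Lemma dyadic_le1 r i : (dyadic r i <= 1) = (i <= 2 ^ r)%N.
Proof. by rewrite -(dyadic1 r) dyadic_le. Qed.

Lemma chain_dyadic r : chain [seq (dyadic r i, dyadic r i.+1) | i <- iota 0 (2 ^ r)].
Proof.
apply: chain_of_nat => // i ir; rewrite dyadic_ge0 dyadic_le dyadic_le1; split => //.
Qed.

Lemma sum_dyadic r (G : R * R -> R) :
  \sum_(p <- [seq (dyadic r i, dyadic r i.+1) | i <- iota 0 (2 ^ r)]) G p =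
  \sum_(i < 2 ^ r) G (dyadic r i, dyadic r i.+1).
Proof. by rewrite big_map -{1}(subn0 (2 ^ r)%N) big_mkord. Qed.

Definition dyadic_floor (r : nat) (x : R) : nat := Num.trunc (x * 2 ^+ r).

Lemma dyadic_floorP r x : 0 <= x -> dyadic r (dyadic_floor r x) <= x < dyadic r (dyadic_floor r x).+1.
Proof.
move=> x0; have e0 : 0 < 2 ^+ r :> R by rewrite exprn_gt0.
have /truncn_itv/andP[h1 h2] : 0 <= x * 2 ^+ r by rewrite mulr_ge0// ltW.
by rewrite /dyadic ler_pdivrMr// ltr_pdivlMr// h1.
Qed.

Lemma dyadic_floor_lt r x : 0 <= x -> x < 1 -> (dyadic_floor r x < 2 ^ r)%N.
Proof.
move=> x0 x1; have /andP[h1 _] := dyadic_floorP r x0.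
by rewrite ltnNge -(dyadic_le r) dyadic1 -ltNge (le_lt_trans h1).
Qed.

Lemma pow2_inv_small (e : R) : 0 < e -> exists r0 : nat,
  forall r, (r0 <= r)%N -> (2 ^+ r)^-1 < e.
Proof.
move=> e0; exists (Num.trunc e^-1) => r rr.
rewrite invf_plt ?posrE ?exprn_gt0//.
apply: lt_le_trans (truncnS_gt _) _; rewrite -natrX ler_nat.
by apply: leq_ltn_trans rr _; exact: ltn_expl.
Qed.

End dyadic_grid.

Section energy_inU.
Variable R : realType.
Local Notation mu := (@lebesgue_measure R).

(** Fatou's lemma for the step functions of squared dyadic slopes, whose integrals are energies of
    dyadic chains. At a point of [(0, 1)] where a coordinate is differentiable its slopes converge
    to the derivative; elsewhere [derive1] is 0 and nothing has to be shown. Differentiability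
    almost everywhere is thus not invoked. *)
Lemma inU_of_energy m (f : R -> 'rV[R]_m) : f 0 = 0 -> energy_le f 1 -> inU f.
Proof.
move=> f0 Ef; split=> //; split; first by move=> c; exact: energy_abs_cont.
pose fc (c : 'I_m) := fun u => f u ord0 c.
pose DD x := \sum_(c < m) (derive1 (fc c) x) ^+ 2.
have DD0 x : 0 <= DD x by apply: sumr_ge0 => c _; exact: sqr_ge0.
pose H n (k : nat) := \sum_(c < m)
  ((fc c (dyadic R n k.+1) - fc c (dyadic R n k)) * 2 ^+ n) ^+ 2.
have H0 n k : 0 <= H n k by apply: sumr_ge0 => c _; exact: sqr_ge0.
pose I n k : set R := `[dyadic R n k, dyadic R n k.+1[%classic.
(* The last two terms match the sum of squared derivatives at 0 and 1, where [derive1] sees values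
   of [f] outside [[0, 1]]. They do not change the integral and make the final comparison hold at
   every point. *)
pose h n x : \bar R := (\sum_(k < 2 ^ n) (H n k)%:E * (\1_(I n k) x)%:E +
  ((DD 0)%:E * (\1_[set 0] x)%:E + (DD 1)%:E * (\1_[set 1] x)%:E))%E.
pose I01 : set R := `[0, 1]%classic.
have -> : unit_interval (R:=R) = I01.
  by apply/seteqP; split => x; rewrite /unit_interval /I01 /= in_itv.
have mI01 : measurable I01 by exact: measurable_itv.
have mi (A : set R) (r : R) : measurable A ->
    measurable_fun I01 (fun x => r%:E * (\1_A x)%:E)%E.
  move=> mA; apply: measurable_funeM; apply/measurable_EFinP.
  exact: measurable_indic.
have i0 (A : set R) (r : R) x : 0 <= r -> (0 <= r%:E * (\1_A x)%:E)%E.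
  by move=> r0; rewrite -EFinM lee_fin mulr_ge0.
have int_i (A : set R) (r : R) : measurable A -> 0 <= r ->
    (\int[mu]_(x in I01) (r%:E * (\1_A x)%:E) = r%:E * mu (A `&` I01))%E.
  move=> mA r0; rewrite ge0_integralZl_EFin//; last first.
    by apply/measurable_EFinP; exact: measurable_indic.
  by rewrite integral_indic.
have mI n k : measurable (I n k) by exact: measurable_itv.
have m1 n : measurable_fun I01
    (fun x => \sum_(k < 2 ^ n) (H n k)%:E * (\1_(I n k) x)%:E)%E.
  by apply: emeasurable_sum => k; exact: mi.
have m2 : measurable_fun I01
    (fun x => (DD 0)%:E * (\1_[set 0] x)%:E + (DD 1)%:E * (\1_[set 1] x)%:E)%E.
  by apply: emeasurable_funD; exact: mi.
have mh n : measurable_fun I01 (h n) by exact: emeasurable_funD.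
have p1 n x : (0 <= \sum_(k < 2 ^ n) (H n k)%:E * (\1_(I n k) x)%:E)%E.
  by apply: sume_ge0 => k _; exact: i0.
have h0 n x : (0 <= h n x)%E by rewrite !adde_ge0// i0.
have inth n : (\int[mu]_(x in I01) h n x <= 1)%E.
  rewrite ge0_integralD//; last by move=> x _; rewrite adde_ge0// i0.
  rewrite ge0_integralD//; try (by move=> x _; exact: i0); try exact: mi.
  rewrite !int_i//.
  have sing a : mu ([set a] `&` I01) = 0%E.
    apply/eqP; rewrite eq_le measure_ge0 andbT -(lebesgue_measure_set1 a).
    apply: le_measure; rewrite ?inE//.
    by apply: measurableI; [exact: measurable_set1|exact: mI01].
  rewrite [X in (_ + (_ * X + _))%E]sing [X in (_ + (_ + _ * X))%E]sing.
  rewrite !mule0 !adde0 ge0_integral_sum//; last 2 first.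
  - by move=> k; exact: mi.
  - by move=> k x _; exact: i0.
  apply: (@le_trans _ _ (\sum_(k < 2 ^ n) (H n k / 2 ^+ n)%:E)%E).
    apply: lee_sum => k _; rewrite int_i// EFinM lee_pmul ?lee_fin//.
    apply: (@le_trans _ _ (mu (I n k))).
      apply: le_measure; rewrite ?inE//.
      by apply: measurableI; [exact: mI|exact: mI01].
      exact: mI.
    rewrite /I [X in (X <= _)%E]lebesgue_measure_itv /= lte_fin -EFinD dyadicS.
    by case: ifP => // _; rewrite lee_fin invr_ge0 exprn_ge0.
  rewrite sumEFin lee_fin; have := Ef _ (chain_dyadic R n).
  rewrite sum_dyadic; apply: le_trans; rewrite le_eqVlt; apply/orP; left.
  apply/eqP; apply: eq_bigr => k _; rewrite /H mulr_suml; apply: eq_bigr => c _.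
  rewrite /= dyadicS invrK; have : 2 ^+ n != 0 :> R by rewrite expf_neq0.
  by move: (2 ^+ n) => P P0; rewrite /fc; field.
  all: try exact: m1.
apply: (@le_trans _ _ (\int[mu]_(x in I01) limn_einf (h ^~ x))%E); last first.
  have h0' n x : I01 x -> (0 <= h n x)%E by move=> _; exact: h0.
  apply: (le_trans (@fatou _ _ _ mu I01 mI01 h mh h0')).
  by apply: limn_einf_le => n; exact: inth.
apply: ge0_le_integralW => x; rewrite /I01 /= in_itv/= => /andP[x0 x1].
  by rewrite lee_fin DD0.
have [x00|x00] := eqVneq x 0.
  apply: limn_einf_ge => e e0; apply: nearW => n.
  rewrite /h x00 indicE mem_set// mule1.
  apply: (@le_trans _ _ (DD 0)%:E); first by rewrite lee_fin gerBl ltW.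
  rewrite addeA -addeC addeA; apply: leeDr.
  by rewrite adde_ge0// ?i0.
have [x11|x11] := eqVneq x 1.
  apply: limn_einf_ge => e e0; apply: nearW => n.
  rewrite /h x11 [in X in (_ <= _ + (_ + X))%E]indicE mem_set// mule1.
  apply: (@le_trans _ _ (DD 1)%:E); first by rewrite lee_fin gerBl ltW.
  by rewrite addeA; apply: leeDr; rewrite adde_ge0// i0.
have {}x0 : 0 < x by rewrite lt_neqAle eq_sym x00.
have {}x1 : x < 1 by rewrite lt_neqAle x11.
pose q n c := (fc c (dyadic R n (dyadic_floor n x).+1) - fc c (dyadic R n (dyadic_floor n x))) * 2 ^+ n.
have hq n : ((\sum_(c < m) q n c ^+ 2)%:E <= h n x)%E.
  have kn := dyadic_floor_lt n (ltW x0) x1.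
  rewrite /h (bigD1 (Ordinal kn))//= indicE mem_set; last first.
    by rewrite /I /= in_itv/=; exact: dyadic_floorP (ltW x0).
  rewrite mule1 -[in leRHS]addeA; apply: leeDl.
  by rewrite !adde_ge0 ?i0//; apply: sume_ge0 => k _; exact: i0.
apply: limn_einf_ge => e e0.
have qc c : q n c ^+ 2 @[n --> \oo] --> (derive1 (fc c) x) ^+ 2 \/
    derive1 (fc c) x = 0.
  have [dc|/derive1_not_derivable ->] := pselect (derivable (fc c) x 1); last by right.
  left; suff cq : q n c @[n --> \oo] --> derive1 (fc c) x.
    rewrite expr2; have -> : (fun n => q n c ^+ 2) = (fun n => q n c * q n c).
      by apply/funext => n; rewrite expr2.
    exact: cvgM.
  apply/cvgrPdist_le => e' e'0; have [d d0 Hd] := derivable_straddle dc e'0.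
  have [r0 Hr0] := pow2_inv_small d0; exists r0 => // n /= rn.
  have /andP[k1 k2] := dyadic_floorP n (ltW x0).
  rewrite distrC; have := Hd _ _ k1 (ltW k2); rewrite dyadicS invrK; apply.
  - exact: le_lt_trans k1 k2.
  - exact: Hr0.
have [M M0 HM] : exists2 M : R, 0 < M & m%:R < M.
  by exists (m%:R + 1); rewrite ?ltrDl// ltr_wpDl.
have near_c c : \forall n \near \oo, (derive1 (fc c) x) ^+ 2 - e / M <= q n c ^+ 2.
  have eM : 0 < e / M by rewrite divr_gt0.
  case: (qc c) => [/cvgrPdist_le/(_ _ eM)|->].
    by apply: filterS => n; rewrite ler_norml => /andP[_]; lra.
  apply: nearW => n; have := sqr_ge0 (q n c); rewrite expr0n/=; lra.
have : \forall n \near \oo, forall c, (derive1 (fc c) x) ^+ 2 - e / M <= q n c ^+ 2.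
  exact: filter_forall.
apply: filterS => n Hn; apply: le_trans (hq n); rewrite lee_fin.
apply: (@le_trans _ _ (\sum_(c < m) ((derive1 (fc c) x) ^+ 2 - e / M))); last first.
  by apply: ler_sum.
rewrite sumrB sumr_const card_ord lerD2l lerN2 -mulr_natr mulrAC.
by rewrite ler_pdivrMr// ler_pM2l// ltW.
Qed.

Lemma inUP m (f : R -> 'rV[R]_m) : inU f <-> f 0 = 0 /\ energy_le f 1.
Proof.
split; first by move=> fU; split; [case: fU|exact: inU_energy].
by move=> [f0 Ef]; exact: inU_of_energy.
Qed.

End energy_inU.

(** * Gaussian tails and Borel-Cantelli lemmas *)

Section normal_bounds.
Variable R : realType.

(* For [x <= y] one has [y^2 >= x^2 + (y - x)^2], which dominates the centred
   density beyond [x] by the density centred at [x]. *)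
Lemma normal_prob_tail_right (s x : R) : 0 < s -> 0 <= x ->
  (normal_prob 0 s `[x, +oo[%classic <= (expR (- (x ^+ 2 / (s ^+ 2 *+ 2))))%:E)%E.
Proof.
move=> s0 x0; have sn0 : s != 0 by rewrite gt_eqF.
set a := expR _.
have mi : measurable (`[x, +oo[%classic : set R) by exact: measurable_itv.
have mp (y : R) : measurable_fun `[x, +oo[%classic (fun z => (normal_pdf y s z)%:E).
  by apply/measurable_EFinP; apply: measurable_funTS; exact: measurable_normal_pdf.
apply: (@le_trans _ _ (a%:E * normal_prob x s `[x, +oo[%classic)%E); last first.
  rewrite -[leRHS]mule1 lee_pmul2l ?lte_fin ?expR_gt0//.
  exact: probability_le1.
have f0 (y : R) : `[x, +oo[%classic y -> (0 <= (normal_pdf x s y)%:E)%E.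
  by rewrite lee_fin normal_pdf_ge0.
rewrite /normal_prob; apply: (@le_trans _ _
    (\int[lebesgue_measure]_(y in `[x, +oo[) (a%:E * (normal_pdf x s y)%:E))%E); last first.
  by rewrite ge0_integralZl_EFin//; first exact: mp; exact: expR_ge0.
apply: ge0_le_integral => //.
- by move=> y _; rewrite lee_fin normal_pdf_ge0.
- exact: mp.
- by apply: measurable_funeM; exact: mp.
move=> y /=; rewrite in_itv/= andbT => xy.
rewrite -EFinM lee_fin !normal_pdfE// mulrCA ler_wpM2l ?normal_peak_ge0//.
rewrite /normal_fun /a -expRD ler_expR subr0 -!mulNr -mulrDl.
by rewrite ler_pM2r ?invr_gt0 ?mulrn_wgt0 ?exprn_gt0//; nra.
Qed.

Lemma normal_prob_tail_left (s x : R) : 0 < s -> 0 <= x ->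
  (normal_prob 0 s `]-oo, (- x)%R]%classic <= (expR (- (x ^+ 2 / (s ^+ 2 *+ 2))))%:E)%E.
Proof.
move=> s0 x0; have sn0 : s != 0 by rewrite gt_eqF.
set a := expR _.
have mi : measurable (`]-oo, (- x)%R]%classic : set R) by exact: measurable_itv.
have mp (y : R) : measurable_fun `]-oo, (- x)%R]%classic (fun z => (normal_pdf y s z)%:E).
  by apply/measurable_EFinP; apply: measurable_funTS; exact: measurable_normal_pdf.
apply: (@le_trans _ _ (a%:E * normal_prob (- x) s `]-oo, (- x)%R]%classic)%E); last first.
  rewrite -[leRHS]mule1 lee_pmul2l ?lte_fin ?expR_gt0//.
  exact: probability_le1.
have f0 (y : R) : `]-oo, (- x)%R]%classic y -> (0 <= (normal_pdf (- x) s y)%:E)%E.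
  by rewrite lee_fin normal_pdf_ge0.
rewrite /normal_prob; apply: (@le_trans _ _
    (\int[lebesgue_measure]_(y in `]-oo, (- x)%R]) (a%:E * (normal_pdf (- x) s y)%:E))%E); last first.
  by rewrite ge0_integralZl_EFin//; first exact: mp; exact: expR_ge0.
apply: ge0_le_integral => //.
- by move=> y _; rewrite lee_fin normal_pdf_ge0.
- exact: mp.
- by apply: measurable_funeM; exact: mp.
move=> y /=; rewrite in_itv/= => xy.
rewrite -EFinM lee_fin !normal_pdfE// mulrCA ler_wpM2l ?normal_peak_ge0//.
rewrite /normal_fun /a -expRD ler_expR subr0 -!mulNr -mulrDl.
by rewrite ler_pM2r ?invr_gt0 ?mulrn_wgt0 ?exprn_gt0//; nra.
Qed.

Lemma norm_geE (x : R) :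
  [set y : R | x <= `|y|] = `]-oo, (- x)%R]%classic `|` `[x, +oo[%classic.
Proof.
apply/seteqP; split => y /=; rewrite !in_itv/= andbT lerNr.
  by rewrite real_ler_normr ?num_real// => /orP[]; [right|left].
by rewrite real_ler_normr ?num_real// => -[] ->; rewrite ?orbT.
Qed.

Lemma measurable_norm_ge (x : R) : measurable [set y : R | x <= `|y|].
Proof. by rewrite norm_geE; apply: measurableU; exact: measurable_itv. Qed.

Lemma normal_prob_tail (s x : R) : 0 < s -> 0 <= x ->
  (normal_prob 0 s [set y | (x <= `|y|)%R] <=
   (2 * expR (- (x ^+ 2 / (s ^+ 2 *+ 2))))%:E)%E.
Proof.
move=> s0 x0; rewrite mulr_natl mulr2n EFinD.
apply: le_trans (leeD (normal_prob_tail_left s0 x0) (normal_prob_tail_right s0 x0)).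
rewrite norm_geE; apply: measureU2; exact: measurable_itv.
Qed.

(** On an interval of length [2 e] the density is at least its value at distance [|d| + e] from
    0. *)
Lemma normal_prob_itv_ge (s d e : R) : 0 < s -> 0 <= e ->
  ((normal_peak s * expR (- ((`|d| + e) ^+ 2 / (s ^+ 2 *+ 2))) * (e *+ 2))%:E
    <= normal_prob 0 s `[(d - e)%R, (d + e)%R]%classic)%E.
Proof.
move=> s0 e0; have sn0 : s != 0 by rewrite gt_eqF.
set a := normal_peak s * _.
have a0 : 0 <= a by rewrite mulr_ge0 ?normal_peak_ge0 ?expR_ge0.
have mi : measurable (`[d - e, d + e]%classic : set R) by exact: measurable_itv.
have -> : (a * (e *+ 2))%:E = (\int[lebesgue_measure]_(x in `[(d - e)%R, (d + e)%R]) a%:E)%E.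
  rewrite integral_cst//= [X in (_ * X)%E]lebesgue_measure_itv /= lte_fin.
  case: ltP => [_|de]; first by rewrite EFinM; congr (_ * _)%E; rewrite -EFinD; congr (_%:E); rewrite mulr2n; lra.
  have -> : e = 0 by lra.
  by rewrite mul0rn mulr0 mule0.
rewrite /normal_prob; apply: ge0_le_integral => //.
- by apply/measurable_EFinP; apply: measurable_funTS; exact: measurable_normal_pdf.
move=> y /=; rewrite in_itv/= => /andP[dyadic yd].
rewrite lee_fin normal_pdfE// ler_wpM2l ?normal_peak_ge0//.
rewrite /normal_fun ler_expR subr0 [leRHS]mulNr lerN2 ler_pM2r ?invr_gt0 ?mulrn_wgt0 ?exprn_gt0//.
rewrite -(real_normK (num_real y)) ler_sqr ?nnegrE ?addr_ge0//.
rewrite ler_norml; have := ler_norm d; have := ler_norm (- d); rewrite normrN.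
by move=> h1 h2; apply/andP; split; lra.
Qed.

End normal_bounds.

(** * Borel-Cantelli lemmas with explicit rates *)

Section borel_cantelli.
Context (R : realType) (dT : measure_display) (T : measurableType dT)
  (P : probability T R).

Lemma ae_forall_countable (I : countType) (Q : I -> T -> Prop) :
  (forall i, {ae P, forall w, Q i w}) -> {ae P, forall w, forall i, Q i w}.
Proof.
move=> H; pose N n : set T := if unpickle n is Some i then ~` [set w | Q i w] else set0.
suff : P.-negligible (~` [set w | forall i, Q i w]) by [].
apply: (@negligibleS _ _ _ P (\bigcup_n N n)).
  move=> w /= /existsNP[i Qi]; exists (pickle i) => //.
  by rewrite /N pickleK.
apply: negligible_bigcup => n; rewrite /N; case: unpickle => [i|]; last first.
  exact: negligible_set0.
exact: H.
Qed.

Lemma ln_ge1B (x : R) : 0 < x -> 1 - x^-1 <= ln x.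
Proof.
move=> x0; have ix0 : 0 < x^-1 by rewrite invr_gt0.
have := @le_ln1Dx R (x^-1 - 1).
rewrite (_ : 1 + (x^-1 - 1) = x^-1); last by ring.
move=> H.
have : - 1 < x^-1 - 1 by lra.
by move=> /H; rewrite lnV ?posrE//; lra.
Qed.

(** The comparison [d x^(-(1+d)) <= (x-1)^(-d) - x^(-d)] at [x = n + 2], with powers written through
    [expR]. It bounds the series without integrals. *)
Lemma p_series_telescope (d : R) (n : nat) : 0 < d ->
  d * expR (- (1 + d) * ln n.+2%:R) <=
  expR (- d * ln n.+1%:R) - expR (- d * ln n.+2%:R).
Proof.
move=> d0.
have n1 : 0 < n.+1%:R :> R by rewrite ltr0n.
have n2 : 0 < n.+2%:R :> R by rewrite ltr0n.
have H : n.+2%:R^-1 <= ln n.+2%:R - ln n.+1%:R :> R.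
  have := @ln_ge1B (n.+2%:R / n.+1%:R); rewrite divr_gt0// ln_div ?posrE// => /(_ erefl).
  apply: le_trans; rewrite invf_div le_eqVlt; apply/orP; left; apply/eqP.
  apply: (@mulfI _ n.+2%:R); first by rewrite gt_eqF.
  rewrite divff ?gt_eqF// mulrBr mulr1 mulrC divfK ?gt_eqF//.
  by rewrite -[in X in _ = X - _](natr1 n.+1) addrAC subrr add0r.
have -> : - (1 + d) * ln n.+2%:R = - ln n.+2%:R + - d * ln n.+2%:R :> R by lra.
rewrite expRD expRN lnK ?posrE//.
have -> : expR (- d * ln n.+1%:R) =
    expR (d * (ln n.+2%:R - ln n.+1%:R)) * expR (- d * ln n.+2%:R) :> R.
  by rewrite -expRD; congr expR; lra.
set E := expR (- d * ln n.+2%:R).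
have E0 : 0 < E by exact: expR_gt0.
have := @expR_ge1Dx R (d * (ln n.+2%:R - ln n.+1%:R)).
set x := expR _ => hx.
have hd : d * n.+2%:R^-1 <= x - 1.
  by rewrite lerBrDl; apply: le_trans hx; rewrite lerD2l ler_wpM2l// ltW.
rewrite mulrA; apply: le_trans (ler_wpM2r (ltW E0) hd) _.
by rewrite mulrBl mul1r.
Qed.

Lemma p_series_bounded (C d : R) : 0 <= C -> 0 < d ->
  (\sum_(n <oo) (C * expR (- (1 + d) * ln n.+2%:R))%:E < +oo)%E.
Proof.
move=> C0 d0; apply: (@le_lt_trans _ _ (C / d)%:E); last exact: ltry.
apply: lime_le.
  by apply: is_cvg_nneseries => n _ _; rewrite lee_fin mulr_ge0// expR_ge0.
apply: nearW => n; rewrite sumEFin lee_fin -mulr_sumr ler_wpM2l//.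
rewrite -[leRHS]mul1r ler_pdivlMr// mulrC mulr_sumr big_mkord.
have H : \sum_(i < n) d * expR (- (1 + d) * ln i.+2%:R) <=
    expR (- d * ln 1%:R) - expR (- d * ln n.+1%:R).
  elim: n => [|n ih]; first by rewrite big_ord0 subrr.
  by rewrite big_ord_recr/=; have := p_series_telescope n d0; lra.
by apply: le_trans H _; rewrite ln1 mulr0 expR0 gerBl expR_ge0.
Qed.

(** The rate [n^(-(1+d))] is what a Gaussian tail [exp (- (1+d) loglog (2^n))] amounts to, up to the
    constant [C]. *)
Lemma borel_cantelli1 (F : nat -> set T) (C d : R) (n0 : nat) :
  (forall n, measurable (F n)) -> 0 < d -> 0 <= C ->
  (forall n, (n0 <= n)%N -> (P (F n) <= (C * expR (- (1 + d) * ln n%:R))%:E)%E) ->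
  {ae P, forall w, exists N, forall n, (N <= n)%N -> ~ F n w}.
Proof.
move=> mF d0 C0 PF; pose G n := F (n0 + n).+2.
have mG n : measurable (G n) by exact: mF.
have PG n : (P (G n) <= (C * expR (- (1 + d) * ln n.+2%:R))%:E)%E.
  apply: le_trans (PF _ _) _; first by rewrite -addnS -addnS leq_addr.
  rewrite lee_fin ler_wpM2l// ler_expR !mulNr lerN2 ler_wpM2l//; first lra.
  by rewrite ler_ln ?posrE ?ltr0n// ler_nat !ltnS leq_addl.
suff : P.-negligible (~` [set w | exists N, forall n, (N <= n)%N -> ~ F n w]) by [].
apply: (@negligibleS _ _ _ P (lim_sup_set G)).
  move=> w /= /forallNP Hw n _; have /existsNP[k /not_implyP[nk /contrapT Fk]] :=
    Hw (n0 + n).+2.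
  exists (k - n0 - 2)%N; first by rewrite /=; lia.
  by rewrite /G; have -> : (n0 + (k - n0 - 2)).+2 = k by lia.
apply/negligibleP.
  by apply: bigcap_measurable => // n _; apply: bigcup_measurable.
apply: lim_sup_set_cvg0 => //; apply: le_lt_trans (p_series_bounded C0 d0).
by apply: lee_nneseries => //; move=> n _; exact: PG.
Qed.

Section second_borel_cantelli.
Variables (A : nat -> set T) (p : nat -> R).
Hypothesis mA : forall b, measurable (A b).
Hypothesis indA : forall t : seq nat, uniq t ->
  P [set w | forall b, b \in t -> A b w] = (\prod_(b <- t) p b)%:E.

Lemma measurable_all (B : nat -> set T) (t : seq nat) :
  (forall b, measurable (B b)) -> measurable [set w | forall b, b \in t -> B b w].
Proof.
move=> mB; rewrite (_ : [set w | _] = \bigcap_(b in [set` t]) B b); last first.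
  by apply/seteqP; split => w /= H b; exact: H.
by apply: bigcap_measurableType => b _; exact: mB.
Qed.

(** Complements are introduced one at a time through [P (Y \ A) = P Y - P (Y & A)]; the induction on
    [s] moves [b] into [t] for the subtracted term. *)
Lemma independent_compl (s t : seq nat) : uniq (s ++ t) ->
  P [set w | (forall b, b \in s -> (~` A b) w) /\ (forall b, b \in t -> A b w)] =
  (\prod_(b <- s) (1 - p b) * \prod_(b <- t) p b)%:E.
Proof.
elim: s t => [|b s ih] t /=.
  move=> ut; rewrite big_nil mul1r -indA//; congr (P _).
  by apply/seteqP; split => w /= => [[_]|] H.
rewrite mem_cat negb_or => /andP[/andP[bs bt] ust].
set X := [set w | _].
pose Y := [set w | (forall b, b \in s -> (~` A b) w) /\ (forall b, b \in t -> A b w)].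
pose Z := [set w | (forall b, b \in s -> (~` A b) w) /\
                   (forall c, c \in b :: t -> A c w)].
have mY : measurable Y.
  apply: measurableI; apply: measurable_all => // c; exact: measurableC.
have -> : X = Y `\` A b.
  apply/seteqP; split => w /=.
    move=> [H1 H2]; split; last by apply: H1; rewrite inE eqxx.
    by split => // c cs; apply: H1; rewrite inE cs orbT.
  move=> [[H1 H2] Ab]; split => // c; rewrite inE => /predU1P[->//|]; exact: H1.
rewrite measureD//; last by rewrite (le_lt_trans (probability_le1 _ _))// ltry.
have -> : Y `&` A b = Z.
  apply/seteqP; split => w /=.
    by move=> [[H1 H2] Ab]; split => // c; rewrite inE => /predU1P[->//|]; exact: H2.
  move=> [H1 H2]; split; last by apply: H2; rewrite inE eqxx.
  by split => // c ct; apply: H2; rewrite inE ct orbT.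
have usbt : uniq (s ++ b :: t).
  by rewrite -cat1s uniq_catCA /= ust mem_cat negb_or bs bt.
rewrite [X in (X - _)%E](ih t ust) [X in (_ - X)%E](ih (b :: t) usbt).
by rewrite -EFinB !big_cons; congr (_%:E); ring.
Qed.

(** From [1 - c / x <= exp (- c / x)] and [ln (1 + 1 / x) <= 1 / x], the probability that none of
    the [K] events from index [J] on occurs is at most [((J+1) / (J+K+1))^c], which tends to 0. *)
Lemma borel_cantelli2 (c : R) : 0 < c ->
  (forall b, c / b.+1%:R <= p b) ->
  {ae P, forall w, forall J : nat, exists2 b, (J <= b)%N & A b w}.
Proof.
move=> c0 pc; apply: ae_forall_countable => J.
suff : P.-negligible (~` [set w | exists2 b, (J <= b)%N & A b w]) by [].
pose E K := [set w | forall b, b \in iota J K -> (~` A b) w].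
have mE K : measurable (E K).
  by apply: measurable_all => b; exact: measurableC.
have p1 b : p b <= 1.
  have := @indA [:: b]; rewrite big_seq1 => /(_ erefl) H.
  by rewrite -lee_fin -H; apply: probability_le1; exact: measurable_all.
have PE K : (P (E K) <= (expR (- c * (ln (J + K).+1%:R - ln J.+1%:R)))%:E)%E.
  have := @independent_compl (iota J K) [::].
  rewrite cats0 big_nil mulr1 iota_uniq => /(_ erefl) H.
  have -> : E K = [set w | (forall b, b \in iota J K -> (~` A b) w) /\
      (forall b : nat, b \in [::] -> A b w)].
    by apply/seteqP; split => w //= [].
  rewrite H lee_fin; elim: K {H} => [|K ih].
    by rewrite big_nil addn0 subrr mulr0 expR0.
  rewrite -[K.+1]addn1 iotaD big_cat/= big_seq1 addn1 addnS.
  have H1 : 1 - p (J + K)%N <= expR (- c * (ln (J + K).+2%:R - ln (J + K).+1%:R)).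
    have jk : 0 < (J + K).+1%:R :> R by rewrite ltr0n.
    have jk2 : 0 < (J + K).+2%:R :> R by rewrite ltr0n.
    apply: (@le_trans _ _ (1 - c / (J + K).+1%:R)); first by rewrite lerD2l lerN2.
    apply: (@le_trans _ _ (expR (- (c / (J + K).+1%:R)))).
      exact: expR_ge1Dx.
    rewrite ler_expR mulNr lerN2 ler_pM2l//.
    rewrite -ln_div ?posrE// -[(J + K).+2%:R]natr1 mulrDl divff ?gt_eqF// mul1r.
    by apply: le_ln1Dx; rewrite (lt_trans (ltrN10 R))// invr_gt0.
  have -> : expR (- c * (ln (J + K).+2%:R - ln J.+1%:R)) =
      expR (- c * (ln (J + K).+1%:R - ln J.+1%:R)) *
      expR (- c * (ln (J + K).+2%:R - ln (J + K).+1%:R)) :> R.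
    by rewrite -expRD; congr expR; ring.
  apply: ler_pM => //; last by rewrite subr_ge0.
  by apply: prodr_ge0 => b _; rewrite subr_ge0.
apply: (@negligibleS _ _ _ P (\bigcap_K E K)).
  move=> w /= /forall2NP H K _ b; rewrite mem_iota => /andP[Jb _].
  by have [] := H b.
apply/negligibleP; first exact: bigcapT_measurable.
apply/eqP; rewrite eq_le measure_ge0 andbT; apply/lee_addgt0Pr => e e0.
rewrite add0e.
pose K := Num.trunc (expR (ln J.+1%:R - ln e / c)).
apply: (@le_trans _ _ (P (E K))).
  apply: le_measure; rewrite ?inE//; first exact: bigcapT_measurable.
  exact: bigcap_inf.
apply: le_trans (PE K) _; rewrite lee_fin -[leRHS]lnK ?posrE// ler_expR.
have : ln J.+1%:R - ln e / c <= ln (J + K).+1%:R.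
  rewrite -[leLHS]expRK ler_ln ?posrE ?expR_gt0 ?ltr0n//.
  apply/ltW/(lt_le_trans (truncnS_gt _)).
  by rewrite ler_nat ltnS leq_addl.
move=> H; rewrite mulNr lerNl -ler_pdivrMl//.
by rewrite [c^-1 * _]mulrC mulNr; lra.
Qed.

End second_borel_cantelli.

End borel_cantelli.

Section brownian_increments.
Context (R : realType) (dT : measure_display) (T : measurableType dT)
  (P : probability T R) (m : nat) (B : R -> T -> 'rV[R]_m).
Hypothesis BM : std_BM P B.

Lemma measurable_incr s t c :
  measurable_fun setT (fun w => (B t w - B s w) ord0 c).
Proof.
have [mB _] := BM.
under eq_fun do rewrite !mxE.
by apply: measurable_funB; exact: mB.
Qed.

Lemma measurable_incr_in s t c (A : set R) : measurable A ->
  measurable [set w | A ((B t w - B s w) ord0 c)].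
Proof.
by move=> mA; have := @measurable_incr s t c measurableT _ mA; rewrite setTI.
Qed.

Lemma prob_incr_rect k (t : nat -> R) (A : nat -> 'I_m -> set R) : 0 <= t 0%N ->
  (forall i, (i < k)%N -> t i < t i.+1) -> (forall i c, measurable (A i c)) ->
  P [set w | forall i, (i < k)%N -> forall c, A i c ((B (t i.+1) w - B (t i) w) ord0 c)] =
  (\prod_(i < k) \prod_(c < m)
     fine (normal_prob 0 (Num.sqrt (t i.+1 - t i)) (A i c)))%:E.
Proof.
move=> t0 tS mA; have [_ [_ H]] := BM.
transitivity (P (\bigcap_(i in [set i | (i < k)%N]) \bigcap_(j in [set: 'I_m])
          [set w | (B (t i.+1) w - B (t i) w) ord0 j \in A i j])).
  congr (P _); apply/seteqP; split => w /= Hw i ik.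
    by move=> c _; rewrite /= inE; exact: Hw.
  by move=> c; have := Hw i ik c I; rewrite /= inE.
rewrite H// -prodEFin; apply: eq_bigr => i _; rewrite -prodEFin.
apply: eq_bigr => c _; rewrite fineK//.
by apply: fin_num_measure; exact: mA.
Qed.

Lemma prob_incr s t c (A : set R) : 0 <= s -> s < t -> measurable A ->
  P [set w | A ((B t w - B s w) ord0 c)] =
  normal_prob 0 (Num.sqrt (t - s)) A.
Proof.
move=> s0 st mA.
pose tt n : R := if n is 0%N then s else t.
pose AA (i : nat) c' : set R := if c' == c then A else setT.
have := @prob_incr_rect 1 tt AA s0.
rewrite big_ord1 (bigD1 c)//= big1 ?mulr1; last first.
  by move=> c' c'c; rewrite /AA (negbTE c'c) probability_setT.
rewrite {3}/AA eqxx fineK; last exact: fin_num_measure.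
move=> <- //; last 2 first.
- by case.
- by move=> i c'; rewrite /AA; case: ifP.
congr (P _); apply/seteqP; split => w /=.
  by move=> Aw [|//] _ c'; rewrite /AA; case: eqP => [->|].
by move=> /(_ 0%N erefl c); rewrite /AA eqxx.
Qed.

Lemma prob_incr_tail s t c x : 0 <= s -> s < t -> 0 <= x ->
  (P [set w | (x <= `|(B t w - B s w)%R ord0 c|)%R] <=
   (2 * expR (- (x ^+ 2 / (2 * (t - s)))))%:E)%E.
Proof.
move=> s0 st x0; have ts : 0 < t - s by rewrite subr_gt0.
rewrite (@prob_incr s t c [set y | x <= `|y|])//; last exact: measurable_norm_ge.
have := @normal_prob_tail R (Num.sqrt (t - s)) x; rewrite sqrtr_gt0 => /(_ ts x0).
by rewrite sqr_sqrtr ?(ltW ts)// -[(t - s) *+ 2]mulr_natl.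
Qed.

End brownian_increments.

Section finite_union.
Context (R : realType) (dT : measure_display) (T : measurableType dT)
  (P : probability T R).

Lemma measurable_exists_fin (I : finType) (A : I -> set T) :
  (forall x, measurable (A x)) -> measurable [set w | exists x, A x w].
Proof.
move=> mA; rewrite (_ : [set w | _] = \bigcup_(x in [set: I]) A x).
  by apply: fin_bigcup_measurable => // x _; exact: mA.
by apply/seteqP; split => w /= [x]; [exists x|move=> _; exists x].
Qed.

Lemma measurable_forall_fin (I : finType) (A : I -> set T) :
  (forall x, measurable (A x)) -> measurable [set w | forall x, A x w].
Proof.
move=> mA; rewrite (_ : [set w | _] = ~` [set w | exists x, (~` A x) w]).
  by apply: measurableC; apply: measurable_exists_fin => x; exact: measurableC.
apply/seteqP; split => w /=; first by move=> H [x]; apply; exact: H.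
by move=> /forallNP H x; apply: contrapT; exact: H.
Qed.

Lemma prob_exists_fin (I : finType) (A : I -> set T) :
  (forall x, measurable (A x)) ->
  (P [set w | exists x, A x w] <= \sum_x P (A x))%E.
Proof.
move=> mA.
suff H (s : seq I) : measurable [set w | exists2 x, x \in s & A x w] /\
    (P [set w | exists2 x, x \in s & A x w] <= \sum_(x <- s) P (A x))%E.
  have [_] := H (index_enum I); apply: le_trans.
  rewrite le_eqVlt; apply/orP; left; apply/eqP; congr (P _).
  by apply/seteqP; split => w /= [x]; [exists x; rewrite ?mem_index_enum|exists x].
elim: s => [|x s [mS ih]].
  rewrite (_ : [set w | _] = set0); first by rewrite big_nil measure0.
  by apply/seteqP; split => w //= [].
rewrite (_ : [set w | _] = A x `|` [set w | exists2 x, x \in s & A x w]).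
  split; first exact: measurableU.
  rewrite big_cons; apply: le_trans (measureU2 _ _ _) _ => //.
  exact: leeD2l.
apply/seteqP; split => w /=.
  by move=> [y]; rewrite inE => /predU1P[->|ys Ay]; [left|right; exists y].
move=> [Ax|[y ys Ay]]; first by exists x; rewrite ?inE ?eqxx.
by exists y; rewrite // inE ys orbT.
Qed.

End finite_union.

(** * Dyadic increments of the rescaled Brownian path *)

Section scaled_path.
Variables (R : realType) (m : nat).
Implicit Types b : R -> 'rV[R]_m.

Definition Zn b (n : nat) (t : R) : 'rV[R]_m := (@ell R n)^-1 *: b (n%:R * t).

Definition zinc b (n r i : nat) (c : 'I_m) : R :=
  (Zn b n (dyadic R r i.+1) - Zn b n (dyadic R r i)) ord0 c.

Definition loglog (n : nat) : R := ln (ln n%:R).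

Lemma zincE b n r i c :
  zinc b n r i c = (b (n%:R * dyadic R r i.+1) - b (n%:R * dyadic R r i)) ord0 c / @ell R n.
Proof. by rewrite /zinc /Zn -scalerBr mxE mulrC. Qed.

Lemma ell_gt0 n : 0 < loglog n -> 0 < @ell R n.
Proof.
rewrite /ell => L0; case: ifPn => // n2.
by rewrite sqrtr_gt0 !mulr_gt0// ltr0n; lia.
Qed.

(** For [n <= 2] one has [ln n <= 1], hence [loglog n <= 0]. Positivity of [loglog n] is therefore
    the single condition carried along to reach the square-root case of [ell]. *)
Lemma loglog_gt0_ge3 n : 0 < loglog n -> (3 <= n)%N.
Proof.
move=> L0; rewrite leqNgt; apply/negP; rewrite !ltnS => n2.
have : ln n%:R <= 1 :> R.
  have [->|n0] := eqVneq n 0%N; first by rewrite ln0.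
  have n0' : 0 < n%:R :> R by rewrite ltr0n lt0n.
  have := @le_ln1Dx R (n%:R - 1); rewrite (_ : 1 + (n%:R - 1) = n%:R :> R); last by ring.
  have n2' : n%:R <= 2 :> R by rewrite ler_nat.
  by move=> /(_ _); lra.
move=> h; move: L0; rewrite ltNge => /negP; apply.
have [l0|l0] := leP (ln n%:R : R) 0; first by rewrite /loglog ln0.
by rewrite /loglog -ln1 ler_ln ?posrE.
Qed.

Lemma sqr_ell n : 0 < loglog n -> (@ell R n) ^+ 2 = 2 * n%:R * loglog n.
Proof.
move=> L0; have n3 := loglog_gt0_ge3 L0.
rewrite /ell ifF; last by apply/negbTE; rewrite -ltnNge.
by rewrite sqr_sqrtr// mulr_ge0// ltW.
Qed.

Lemma ln_pow2 (j : nat) : ln (2 ^ j)%:R = j%:R * ln 2 :> R.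
Proof. by rewrite natrX lnXn// mulr_natl. Qed.

Lemma ln2_gt0 : 0 < ln 2 :> R.
Proof. by rewrite ln_gt0// ltr1n. Qed.

(** Through this identity [exp (- a loglog (2^j))] is a constant times [j^(-a)]. *)
Lemma loglog_pow2 (j : nat) : (0 < j)%N -> loglog (2 ^ j) = ln j%:R + ln (ln 2).
Proof. by move=> j0; rewrite /loglog ln_pow2 lnM// posrE ?ltr0n// ln2_gt0. Qed.

Lemma loglog_pow2_ge (M : R) : exists j0 : nat, forall j, (j0 <= j)%N ->
  (0 < j)%N /\ M <= loglog (2 ^ j).
Proof.
exists (Num.trunc (expR M / ln 2)).+1 => j jj; split; first by lia.
rewrite /loglog ln_pow2 -[leLHS]expRK ler_ln ?posrE ?expR_gt0//; last first.
  by rewrite mulr_gt0 ?ln2_gt0// ltr0n; lia.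
rewrite -ler_pdivrMr ?ln2_gt0//; apply/ltW/(lt_le_trans (truncnS_gt _)).
by rewrite ler_nat.
Qed.

End scaled_path.

Section brownian_events.
Context (R : realType) (dT : measure_display) (T : measurableType dT)
  (P : probability T R) (m : nat) (B : R -> T -> 'rV[R]_m).
Hypothesis BM : std_BM P B.

Local Notation path w := (fun t => B t w).

Lemma measurable_zinc_ge n r i c (y : R) :
  measurable [set w | y <= `|zinc (path w) n r i c|].
Proof.
pose A := [set v : R | y <= `|v / @ell R n|].
rewrite (_ : [set w | _] = [set w | A ((B (n%:R * dyadic R r i.+1) w - B (n%:R * dyadic R r i) w) ord0 c)]).
  apply: (measurable_incr_in BM); rewrite /A.
  rewrite (_ : [set _ | _] = (fun v => v / @ell R n) @^-1` [set v | y <= `|v|])//.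
  rewrite -[X in measurable X]setTI.
  apply: (measurable_funM (@measurable_id _ _ _) (@measurable_cst _ _ _ _ _ (@ell R n)^-1)) => //.
  exact: measurable_norm_ge.
by apply/seteqP; split => w /=; rewrite /A /= zincE.
Qed.

Lemma grid_step n r i : n%:R * dyadic R r i.+1 - n%:R * dyadic R r i = n%:R / 2 ^+ r.
Proof. by rewrite -mulrBr dyadicS. Qed.

Lemma zinc_ge_rescale w n r i c y : 0 < loglog R n ->
  (y <= `|zinc (path w) n r i c|) =
  (y * @ell R n <= `|(B (n%:R * dyadic R r i.+1) w - B (n%:R * dyadic R r i) w) ord0 c|).
Proof.
move=> L0; have e0 := ell_gt0 L0.
by rewrite zincE normrM normfV (gtr0_norm e0) ler_pdivlMr.
Qed.

(** The increment has variance [n / 2^r] and [ell n ^ 2 = 2 n loglog n], so the Gaussian exponent is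
    the contribution [y^2 2^r] to the energy times [loglog n]. *)
Lemma zinc_exponent n r y : 0 < loglog R n ->
  (y * @ell R n) ^+ 2 / (2 * (n%:R / 2 ^+ r)) = y ^+ 2 * 2 ^+ r * loglog R n.
Proof.
move=> L0; rewrite exprMn sqr_ell//.
have : n%:R != 0 :> R by rewrite pnatr_eq0; have := loglog_gt0_ge3 L0; lia.
have : 2 ^+ r != 0 :> R by rewrite expf_neq0.
by move: (2 ^+ r) => p p0 n0; field; rewrite p0 n0.
Qed.

Lemma grid_step_gt0 n r : 0 < loglog R n -> 0 < n%:R / 2 ^+ r :> R.
Proof.
by move=> /loglog_gt0_ge3 n3; rewrite divr_gt0// ?exprn_gt0// ltr0n; lia.
Qed.

Lemma prob_zinc_tail n r i c y : 0 < loglog R n -> 0 <= y ->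
  (P [set w | (y <= `|zinc (path w) n r i c|)%R] <=
   (2 * expR (- (y ^+ 2 * 2 ^+ r * loglog R n)))%:E)%E.
Proof.
move=> L0 y0; under eq_set do rewrite zinc_ge_rescale//.
have := @prob_incr_tail _ _ _ P _ _ BM (n%:R * dyadic R r i) (n%:R * dyadic R r i.+1) c (y * @ell R n).
rewrite grid_step zinc_exponent//; apply.
- by rewrite mulr_ge0// dyadic_ge0.
- by rewrite -subr_gt0 grid_step grid_step_gt0.
- by rewrite mulr_ge0// ltW// ell_gt0.
Qed.

Lemma prob_zinc_rect n r (y : nat -> 'I_m -> R) : 0 < loglog R n ->
  (forall i c, 0 <= y i c) ->
  (P [set w | forall i, (i < 2 ^ r)%N -> forall c, (y i c <= `|zinc (path w) n r i c|)%R] <=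
   (\prod_(i < 2 ^ r) \prod_(c < m) (2 * expR (- (y i c ^+ 2 * 2 ^+ r * loglog R n))))%:E)%E.
Proof.
move=> L0 y0.
pose A i c := [set v : R | y i c * @ell R n <= `|v|].
have mA i c : measurable (A i c) by exact: measurable_norm_ge.
pose t i := n%:R * dyadic R r i.
have tS i : t i < t i.+1 by rewrite -subr_gt0 grid_step grid_step_gt0.
have t0 : 0 <= t 0%N by rewrite /t dyadic0 mulr0.
rewrite (_ : [set w | _] = [set w | forall i, (i < 2 ^ r)%N -> forall c,
    A i c ((B (t i.+1) w - B (t i) w) ord0 c)]); last first.
  by apply/seteqP; split => w /= Hw i ir c; have := Hw i ir c; rewrite zinc_ge_rescale.
rewrite (prob_incr_rect BM)// lee_fin; apply: ler_prod => i _.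
apply/andP; split.
  by apply: prodr_ge0 => c _; apply: fine_ge0; exact: measure_ge0.
apply: ler_prod => c _; apply/andP; split; first by apply: fine_ge0; exact: measure_ge0.
rewrite -lee_fin fineK; last by apply: fin_num_measure; exact: mA.
have := @normal_prob_tail R (Num.sqrt (t i.+1 - t i)) (y i c * @ell R n).
rewrite sqrtr_gt0 subr_gt0 tS sqr_sqrtr; last by rewrite subr_ge0 ltW.
rewrite grid_step -[(_ / _) *+ 2]mulr_natl zinc_exponent//; apply => //.
by rewrite mulr_ge0// ltW// ell_gt0.
Qed.

End brownian_events.

(** * Almost sure upper bounds along powers of two *)

Section upper_bounds.
Context (R : realType) (dT : measure_display) (T : measurableType dT)
  (P : probability T R) (m : nat) (B : R -> T -> 'rV[R]_m).
Hypothesis BM : std_BM P B.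

Local Notation path w := (fun t => B t w).

(** Here [81/50 = 2 (9/10)^2] is the growth rate in [r] of the tail exponent at threshold
    [2 (9/10)^r]; a linear lower bound is enough. *)
Lemma bernoulli_growth r : 1 + r%:R / 2 <= (81 / 50) ^+ r :> R.
Proof.
elim: r => [|r ih]; first by rewrite mul0r addr0 expr0.
rewrite exprS -[r.+1%:R]natr1.
have r0 : 0 <= r%:R :> R by [].
by move: (_ ^+ r) ih r0 => x; move: (r%:R) => y; lra.
Qed.

Lemma geometric_half_sum (a : R) : 0 <= a ->
  (\sum_(r <oo) (a / 2 ^+ r)%:E <= (2 * a)%:E)%E.
Proof.
move=> a0; apply: lime_le.
  by apply: is_cvg_nneseries => n _ _; rewrite lee_fin divr_ge0// exprn_ge0.
apply: nearW => n; rewrite sumEFin lee_fin big_mkord.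
suff -> : \sum_(i < n) a / 2 ^+ i = 2 * a - 2 * a / 2 ^+ n.
  by rewrite gerBl divr_ge0 ?mulr_ge0// exprn_ge0.
elim: n => [|n ih]; first by rewrite big_ord0 expr0 divr1 subrr.
rewrite big_ord_recr/= ih exprS.
have : 2 ^+ n != 0 :> R by rewrite expf_neq0.
by move: (2 ^+ n) => p p0; field.
Qed.

(** The tail exponent at level [r] is [4 (81/50)^r >= 4 + 2 r] times [loglog (2^j)]. Of this, 2
    gives the summable [j^(-2)], and the remaining [2 + 2 r] outweighs the [2^r] intervals and
    leaves a factor [2^(-r)], summable over all levels. *)
Lemma ae_zinc_decay : {ae P, forall w, exists J : nat, forall j, (J <= j)%N ->
  forall r i c, (i < 2 ^ r)%N ->
    `|zinc (path w) (2 ^ j) r i c| < 2 * (9 / 10) ^+ r}.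
Proof.
pose G j r := [set w | exists x : 'I_(2 ^ r) * 'I_m,
  2 * (9 / 10) ^+ r <= `|zinc (path w) (2 ^ j) r x.1 x.2|].
pose F j := \bigcup_r G j r.
have mG j r : measurable (G j r).
  apply: (@measurable_exists_fin _ _ _ (fun x : 'I_(2 ^ r) * 'I_m =>
    [set w | 2 * (9 / 10) ^+ r <= `|zinc (path w) (2 ^ j) r x.1 x.2|])) => x.
  exact: (measurable_zinc_ge BM).
have mF j : measurable (F j) by apply: bigcup_measurable => r _; exact: mG.
have [j0 Hj0] := @loglog_pow2_ge R 1.
pose C : R := 4 * m%:R * expR (- 2 * ln (ln 2)).
have C0 : 0 <= C by rewrite !mulr_ge0// expR_ge0.
have PF j : (j0 <= j)%N -> (P (F j) <= (C * expR (- (1 + 1) * ln j%:R))%:E)%E.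
  move=> /Hj0[j1 L1]; have L0 : 0 < loglog R (2 ^ j) by rewrite (lt_le_trans ltr01).
  set a := 2 * m%:R * expR (- 2 * loglog R (2 ^ j)).
  have a0 : 0 <= a by rewrite !mulr_ge0// expR_ge0.
  have -> : C * expR (- (1 + 1) * ln j%:R) = 2 * a.
    rewrite /C /a loglog_pow2// mulrDr expRD (_ : - (1 + 1) = - 2 :> R); last by ring.
    by ring.
  apply: le_trans (geometric_half_sum a0).
  apply: (@le_trans _ _ (\sum_(r <oo) P (G j r))%E).
    by apply: measure_sigma_subadditive.
  apply: lee_nneseries => [//|r _].
  apply: (@le_trans _ _ (\sum_(x : 'I_(2 ^ r) * 'I_m) (2 * expR (- (2 + 2 * r%:R) * loglog R (2 ^ j) - 2 * loglog R (2 ^ j)))%:E)%E).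
    apply: le_trans (prob_exists_fin _ _) _ => [x|]; first exact: (measurable_zinc_ge BM).
    apply: lee_sum => x _.
    have y0 : 0 <= 2 * (9 / 10) ^+ r :> R by rewrite mulr_ge0// exprn_ge0//; lra.
    apply: le_trans (prob_zinc_tail BM _ _ _ L0 y0) _.
    rewrite lee_fin ler_pM2l// ler_expR -mulrBl.
    have -> : (2 * (9 / 10) ^+ r) ^+ 2 * 2 ^+ r = 4 * (81 / 50) ^+ r :> R.
      rewrite exprMn -exprM mulnC exprM -mulrA -exprMn.
      by congr (_ * _ ^+ r); lra.
    rewrite -mulNr ler_pM2r// ; have := bernoulli_growth r; lra.
  rewrite sumEFin lee_fin sumr_const card_prod !card_ord -[_ *+ (_ * _)]mulr_natr natrM natrX /a.
  rewrite -mulNr expRD.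
  set e := expR (- 2 * _).
  have e0 : 0 <= e by exact: expR_ge0.
  (* As [loglog (2^j) >= 1], this reduces to [exp (- 2 r) 4^r <= 1], that is to [e >= 2]. *)
  have key : expR (- (2 + 2 * r%:R) * loglog R (2 ^ j)) * 2 ^+ r <= 1 / 2 ^+ r.
    rewrite ler_pdivlMr ?exprn_gt0// -mulrA -exprMn.
    apply: (@le_trans _ _ (expR (- 2 * r%:R) * (2 * 2) ^+ r)).
      rewrite ler_wpM2r ?exprn_ge0// ler_expR.
      have r0 : 0 <= r%:R :> R by [].
      by nra.
    rewrite (_ : - 2 * r%:R = r%:R * - 2 :> R); last by ring.
    rewrite expRM_natl -exprMn; apply: exprn_ile1; first by rewrite mulr_ge0// expR_ge0.
    have := @expR_ge1Dx R 1.
    rewrite (_ : 2 = 1 + 1 :> R); last by ring.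
    rewrite opprD expRD => h1.
    have h2 : expR (- 1) * (1 + 1) <= 1 :> R.
      by rewrite expRN ler_pdivrMl ?expR_gt0// mulr1.
    have h3 : 0 <= expR (- 1) :> R by exact: expR_ge0.
    have -> : expR (- 1) * expR (- 1) * ((1 + 1) * (1 + 1)) =
      (expR (- 1) * (1 + 1)) ^+ 2 :> R by ring.
    by rewrite exprn_ile1// mulr_ge0.
  have m0 : 0 <= m%:R :> R by [].
  have -> : 2 * (expR (- (2 + 2 * r%:R) * loglog R (2 ^ j)) * e) * (2 ^+ r * m%:R) =
    2 * m%:R * e * (expR (- (2 + 2 * r%:R) * loglog R (2 ^ j)) * 2 ^+ r) by ring.
  rewrite -[leRHS]mulrA -[(2 ^+ r)^-1]mul1r !mulrA -mulrA.
  by rewrite -[leRHS]mulrA ler_wpM2l// !mulr_ge0.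
have := borel_cantelli1 mF ltr01 C0 PF.
apply: filterS => w [N HN]; exists N => j Nj r i c ir.
rewrite ltNge; apply/negP => H; apply: (HN j Nj); exists r => //.
by exists (Ordinal ir, c).
Qed.

(* If [sum y^2 > 1 + d], rounding the [y x] down to multiples of [theta],
   truncated at [M theta >= 2], leaves a sum of squares at least [1 + d/2]. *)
Lemma round_down (I : finType) (d theta : R) (M : nat) (y : I -> R) :
  0 < d -> d <= 1 -> 0 < theta -> 2 <= M%:R * theta ->
  #|I|%:R * ((2 * M%:R + 1) * theta ^+ 2) <= d / 2 ->
  (forall x, 0 <= y x) -> 1 + d < \sum_x y x ^+ 2 ->
  exists k : {ffun I -> 'I_M.+1}, (forall x, (k x)%:R * theta <= y x) /\
    1 + d / 2 <= \sum_x ((k x)%:R * theta) ^+ 2.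
Proof.
move=> d0 d1 th0 Mth Ith y0 yd.
pose k : {ffun I -> 'I_M.+1} :=
  [ffun x => inord (minn (Num.trunc (y x / theta)) M)].
have kE x : k x = minn (Num.trunc (y x / theta)) M :> nat.
  by rewrite ffunE inordK// ltnS geq_minr.
have yt x : 0 <= y x / theta by rewrite divr_ge0// ltW.
exists k; split.
  move=> x; rewrite -ler_pdivlMr// kE.
  apply: (@le_trans _ _ (Num.trunc (y x / theta))%:R).
    by rewrite ler_nat geq_minl.
  by rewrite truncn_le.
(* A coordinate that reaches the truncation contributes at least [(M theta)^2 >= 4] alone. *)
have [/existsP[x Mx]|/existsPn H] := boolP [exists x, (M <= Num.trunc (y x / theta))%N].
  apply: (@le_trans _ _ (((k x)%:R * theta) ^+ 2)).
    by rewrite kE (minn_idPr Mx); nra.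
  by rewrite (bigD1 x)//= lerDl; apply: sumr_ge0 => i _; exact: sqr_ge0.
have key x : y x ^+ 2 - (2 * M%:R + 1) * theta ^+ 2 <= ((k x)%:R * theta) ^+ 2.
  have := H x; rewrite -ltnNge => tM.
  rewrite kE (minn_idPl (ltnW tM)).
  have := truncnS_gt (y x / theta); rewrite ltr_pdivrMr// -natr1.
  have : (Num.trunc (y x / theta))%:R <= M%:R :> R by rewrite ler_nat ltnW.
  have : 0 <= (Num.trunc (y x / theta))%:R :> R by [].
  move: (_%:R) => t t0 tM' yt'; have := y0 x; have : 0 <= theta ^+ 2 by rewrite sqr_ge0.
  move=> th2 yx0.
  have : y x ^+ 2 <= ((t + 1) * theta) ^+ 2.
    have tt0 : 0 <= (t + 1) * theta by apply: mulr_ge0; lra.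
    by rewrite ler_sqr ?nnegrE//; exact: ltW.
  by nra.
apply: le_trans (ler_sum _ (fun x _ => key x)).
rewrite sumrB sumr_const -[_ *+ _]mulr_natl cardT -cardT; lra.
Qed.

(** An energy above [1 + d] forces the increments to dominate one of finitely many lattice vectors
    of energy at least [1 + d/2]. By independence each such vector costs at most a constant times
    [exp (- (1 + d/2) loglog (2^j))], which is summable in [j]. *)
Lemma ae_zinc_energy r (d : R) : 0 < d -> d <= 1 ->
  {ae P, forall w, exists J : nat, forall j, (J <= j)%N ->
    \sum_(i < 2 ^ r) \sum_(c < m) zinc (path w) (2 ^ j) r i c ^+ 2 * 2 ^+ r <= 1 + d}.
Proof.
move=> d0 d1; pose I : finType := ('I_(2 ^ r) * 'I_m)%type.
pose V : R := #|I|%:R.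
have V0 : 0 <= V by rewrite /V.
(* From [M theta <= 2 + theta] and [theta <= 1] follows [(2 M + 1) theta^2 <= 7 theta]; the 14 makes
   [V] times this at most [d / 2]. *)
pose theta : R := d / (14 * (V + 1)).
have th0 : 0 < theta by rewrite divr_gt0// mulr_gt0//; lra.
have th1 : theta <= 1 by rewrite ler_pdivrMr ?mulr_gt0//; lra.
pose M := (Num.trunc (2 / theta)).+1.
have Mth : 2 <= M%:R * theta by rewrite -ler_pdivrMr// ltW// truncnS_gt.
have Mth' : M%:R * theta <= 2 + theta.
  rewrite /M -natr1 mulrDl mul1r lerD2r -ler_pdivlMr// truncn_le.
  by rewrite divr_ge0// ltW.
have Ith : V * ((2 * M%:R + 1) * theta ^+ 2) <= d / 2.
  apply: (@le_trans _ _ (V * (7 * theta))).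
    by rewrite ler_wpM2l//; nra.
  have -> : d / 2 = (V + 1) * (7 * theta).
    by rewrite /theta; field; rewrite gt_eqF// ltr_wpDl.
  by rewrite ler_wpM2r ?lerDl// mulr_ge0// ltW.
pose yk (k : {ffun I -> 'I_M.+1}) (i : nat) (c : 'I_m) : R :=
  if insub i is Some i' then (k (i', c))%:R * theta / Num.sqrt (2 ^+ r) else 0.
have yk0 k i c : 0 <= yk k i c.
  rewrite /yk; case: insub => // i'.
  by apply: divr_ge0; [apply: mulr_ge0 => //; exact: ltW|exact: sqrtr_ge0].
pose big (k : {ffun I -> 'I_M.+1}) := 1 + d / 2 <= \sum_x ((k x)%:R * theta) ^+ 2.
pose G j (k : {ffun I -> 'I_M.+1}) : set T :=
  if big k then [set w | forall x : I, yk k x.1 x.2 <= `|zinc (path w) (2 ^ j) r x.1 x.2|]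
  else set0.
have mG j k : measurable (G j k).
  rewrite /G; case: ifP => // _.
  apply: (@measurable_forall_fin _ _ _ (fun x : I =>
    [set w | yk k x.1 x.2 <= `|zinc (path w) (2 ^ j) r x.1 x.2|])) => x.
  exact: (measurable_zinc_ge BM).
pose F j := [set w | exists k, G j k w].
have mF j : measurable (F j) by exact: measurable_exists_fin.
have [j0 Hj0] := @loglog_pow2_ge R 1.
pose K : R := #|{ffun I -> 'I_M.+1}|%:R * 2 ^+ #|I|.
have K0 : 0 <= K by rewrite mulr_ge0// exprn_ge0.
pose C : R := K * expR (- (1 + d / 2) * ln (ln 2)).
have C0 : 0 <= C by rewrite mulr_ge0// expR_ge0.
have PF j : (j0 <= j)%N -> (P (F j) <= (C * expR (- (1 + d / 2) * ln j%:R))%:E)%E.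
  move=> /Hj0[j1 L1]; have L0 : 0 < loglog R (2 ^ j) by rewrite (lt_le_trans ltr01).
  have -> : C * expR (- (1 + d / 2) * ln j%:R) = K * expR (- (1 + d / 2) * loglog R (2 ^ j)).
    by rewrite /C loglog_pow2// mulrDr expRD; ring.
  apply: le_trans (prob_exists_fin _ _) _ => //.
  apply: (@le_trans _ _ (\sum_(k : {ffun I -> 'I_M.+1})
      (2 ^+ #|I| * expR (- (1 + d / 2) * loglog R (2 ^ j)))%:E)%E); last first.
    rewrite sumEFin lee_fin sumr_const -[_ *+ _]mulr_natl mulrA.
    by rewrite cardT -cardT.
  apply: lee_sum => k _; rewrite /G; case: ifPn => [bk|_]; last first.
    by rewrite measure0 lee_fin mulr_ge0 ?expR_ge0 ?exprn_ge0.
  rewrite (_ : [set w | _] = [set w | forall i, (i < 2 ^ r)%N -> forall c,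
      (yk k i c <= `|zinc (path w) (2 ^ j) r i c|)%R]); last first.
    apply/seteqP; split => w /= Hw; last by move=> [i c]; exact: Hw.
    by move=> i ir c; exact: (Hw (Ordinal ir, c)).
  apply: le_trans (prob_zinc_rect BM _ L0 (yk0 k)) _.
  rewrite lee_fin pair_big/= big_split/= prodr_const -expR_sum cardT -cardT.
  rewrite ler_wpM2l ?exprn_ge0// ler_expR sumrN mulNr lerN2 -mulr_suml ler_pM2r//.
  apply: le_trans bk _; rewrite le_eqVlt; apply/orP; left; apply/eqP.
  apply: eq_bigr => -[i c] _ /=; rewrite /yk valK expr_div_n sqr_sqrtr ?exprn_ge0//.
  by rewrite divfK// expf_neq0.
have d20 : 0 < d / 2 by lra.
have := borel_cantelli1 mF d20 C0 PF.
apply: filterS => w [N HN]; exists N => j Nj.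
rewrite leNgt; apply/negP => H; apply: (HN j Nj).
pose y (x : I) := `|zinc (path w) (2 ^ j) r x.1 x.2| * Num.sqrt (2 ^+ r).
have y0 x : 0 <= y x by rewrite mulr_ge0 ?sqrtr_ge0.
have s0 : 0 < Num.sqrt (2 ^+ r) :> R by rewrite sqrtr_gt0 exprn_gt0.
have [|k [ky kd]] := round_down d0 d1 th0 Mth Ith y0.
  apply: lt_le_trans H _; rewrite pair_big/= le_eqVlt; apply/orP; left; apply/eqP.
  apply: eq_bigr => -[i c] _ /=.
  by rewrite /y exprMn sqr_sqrtr ?exprn_ge0//= real_normK ?num_real.
exists k; rewrite /G /big kd => -[i c] /=.
by rewrite /yk valK ler_pdivrMr// (ky (i, c)).
Qed.

End upper_bounds.

Section block_products.
Variable R : comPzRingType.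

Lemma prod_blocks (F : nat -> R) (K M : nat) :
  \prod_(q < K * M) F q = \prod_(b < K) \prod_(a < M) F (b * M + a)%N.
Proof.
elim: K => [|K ih]; first by rewrite mul0n !big_ord0.
by rewrite mulSnr big_split_ord/= ih big_ord_recr.
Qed.

Lemma prod_mem (p : nat -> R) (t : seq nat) (K : nat) : uniq t ->
  (forall b, b \in t -> (b < K)%N) ->
  \prod_(b < K) (if (b : nat) \in t then p b else 1) = \prod_(b <- t) p b.
Proof.
move=> ut tK; rewrite -big_mkcond/= -(big_mkord (fun b => b \in t) p) -big_filter.
apply: perm_big; apply: uniq_perm => // [|b]; first by rewrite filter_uniq// iota_uniq.
by rewrite mem_filter mem_index_iota /=; apply: andb_idr => /tK.
Qed.

End block_products.

(** * Approximation of given increments infinitely often *)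

Section lower_bound.
Context (R : realType) (dT : measure_display) (T : measurableType dT)
  (P : probability T R) (m : nat) (B : R -> T -> 'rV[R]_m).
Hypothesis BM : std_BM P B.
Variables (r : nat) (d : nat -> 'I_m -> R) (eta : R).
Hypotheses (r0 : (0 < r)%N) (eta0 : 0 < eta).
Hypothesis d_energy : \sum_(a < (2 ^ r).-1) \sum_(c < m)
  (`|d a.+1 c| + eta) ^+ 2 * 2 ^+ r <= 1.

Local Notation path w := (fun t => B t w).
Local Notation N := (2 ^ r)%N.
Local Notation M := (2 ^ r).-1.

Let N2 : (2 <= N)%N.
Proof. by rewrite -{1}(expn1 2) leq_exp2l. Qed.

Let M0 : (0 < M)%N. Proof. by have := N2; lia. Qed.

Let n (b : nat) := (N ^ b.+1)%N.

(* [grid q] is the left end of step [q %% M] of the block [[N^b, N^(b+1)]] with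
   [b = q %/ M], cut into [M] intervals of length [N^b]; the increments over
   distinct blocks are independent. *)
Let grid (q : nat) : R := (N ^ (q %/ M) * (q %% M).+1)%:R.

Let gridE b a : (a <= M)%N -> grid (b * M + a) = (n b)%:R * dyadic R r a.+1.
Proof.
move=> aM; rewrite /grid /n /dyadic expnSr.
have -> : (N ^ b * N)%:R * (a.+1%:R / 2 ^+ r) = (N ^ b * a.+1)%:R :> R.
  rewrite !natrM [N%:R]natrX; have : 2 ^+ r != 0 :> R by rewrite expf_neq0.
  by move: (2 ^+ r) => x x0; field.
congr (_%:R).
(* For [a = M] the right end of block [b] is encoded as the left end of block [b + 1]. *)
move: aM; rewrite leq_eqVlt => /predU1P[->|aM].
  rewrite -mulSnr mulnK// modnMl expnS muln1 mulnC.
  by congr (_ * _)%N; have := N2; lia.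
by rewrite divnMDl// divn_small// addn0 modnMDl modn_small.
Qed.

Let grid_lt q : grid q < grid q.+1.
Proof.
have qM := divn_eq q M; have aM : (q %% M < M)%N by rewrite ltn_mod.
have : grid (q %/ M * M + q %% M) < grid (q %/ M * M + q %% M).+1.
  rewrite -addnS gridE ?(ltnW aM)// gridE// ltr_pM2l.
    by rewrite ltNge dyadic_le -ltnNge.
  by rewrite /n ltr0n expn_gt0 expn_gt0.
by rewrite -qM.
Qed.

Let itv b a c : set R :=
  `[d a.+1 c * @ell R (n b) - eta * @ell R (n b), d a.+1 c * @ell R (n b) + eta * @ell R (n b)]%classic.

Let A b : set T := [set w | forall a, (a < M)%N -> forall c,
  itv b a c ((B (grid (b * M + a).+1) w - B (grid (b * M + a)) w) ord0 c)].

Let p b : R := \prod_(a < M) \prod_(c < m)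
  fine (normal_prob 0 (Num.sqrt (grid (b * M + a).+1 - grid (b * M + a))) (itv b a c)).

Let mA b : measurable (A b).
Proof.
rewrite /A (_ : [set w | _] = [set w | forall x : 'I_M * 'I_m,
    itv b x.1 x.2 ((B (grid (b * M + x.1).+1) w - B (grid (b * M + x.1)) w) ord0 x.2)]).
  apply: (@measurable_forall_fin _ _ _ (fun x : 'I_M * 'I_m =>
    [set w | itv b x.1 x.2 ((B (grid (b * M + x.1).+1) w -
       B (grid (b * M + x.1)) w) ord0 x.2)])) => x.
  by apply: (measurable_incr_in BM); exact: measurable_itv.
apply/seteqP; split => w /= H; first by move=> [a c]; exact: H.
by move=> a aM c; exact: (H (Ordinal aM, c)).
Qed.

(** All blocks up to the largest index in [t] are laid on one grid, and the increments in blocks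
    outside [t] are left unconstrained by taking [setT]. *)
Let A_indep (t : seq nat) : uniq t ->
  P [set w | forall b, b \in t -> A b w] = (\prod_(b <- t) p b)%:E.
Proof.
move=> ut; pose K := (\max_(b <- t) b).+1.
have tK b : b \in t -> (b < K)%N by move=> bt; rewrite ltnS; exact: leq_bigmax_seq.
pose AA q c : set R := if (q %/ M)%N \in t then itv (q %/ M) (q %% M) c else setT.
have mAA q c : measurable (AA q c).
  by rewrite /AA; case: ifP => // _; exact: measurable_itv.
have := @prob_incr_rect _ _ _ P _ _ BM (K * M) grid AA (ler0n _ _) (fun i _ => grid_lt i) mAA.
rewrite (_ : [set w | _] = [set w | forall b, b \in t -> A b w]); last first.
  apply/seteqP; split => w /= H.
    move=> b bt a aM c; have := H (b * M + a)%N _ c.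
    rewrite /AA divnMDl// divn_small// addn0 bt modnMDl modn_small//; apply.
    have := tK _ bt; rewrite -[X in (X <= _)%N]addn0 => bK.
    apply: (@leq_trans (b.+1 * M)); last by rewrite leq_mul2r; apply/orP; right; rewrite addn0 in bK.
    by rewrite mulSnr ltn_add2l.
  move=> q qK c; rewrite /AA; case: ifPn => // qt.
  by have := H _ qt (q %% M)%N; rewrite -divn_eq ltn_mod; exact.
move=> ->; congr (_%:E).
rewrite (prod_blocks (fun q => \prod_(c < m) fine (normal_prob 0
  (Num.sqrt (grid q.+1 - grid q)) (AA q c)))) -(prod_mem p ut tK).
apply: eq_bigr => b _; case: ifPn => bt.
  apply: eq_bigr => a _; apply: eq_bigr => c _.
  by rewrite /AA divnMDl// divn_small// addn0 bt modnMDl modn_small.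
apply: big1 => a _; apply: big1 => c _.
by rewrite /AA divnMDl// divn_small// addn0 (negbTE bt) probability_setT.
Qed.

(** By [d_energy] the Gaussian exponents add up to at most [loglog]. The prefactor of each
    coordinate is at least [eta]: the window has width [2 eta ell], and [2 ell] times the peak of
    the density is at least 1 because [ell^2] exceeds the variance. *)
Let p_ge b : 1 <= loglog R (n b) ->
  (\prod_(a < M) \prod_(c < m) eta) * expR (- loglog R (n b)) <= p b.
Proof.
move=> L1; have L0 : 0 < loglog R (n b) by exact: lt_le_trans L1.
have e0 := ell_gt0 L0.
apply: (@le_trans _ _ (\prod_(a < M) \prod_(c < m)
   (eta * expR (- ((`|d a.+1 c| + eta) ^+ 2 * 2 ^+ r * loglog R (n b)))))).
  under [leRHS]eq_bigr do rewrite big_split/= -expR_sum.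
  rewrite [leRHS]big_split/= -expR_sum ler_wpM2l//.
    by apply: prodr_ge0 => a _; apply: prodr_ge0 => c _; exact: ltW.
  rewrite ler_expR; under eq_bigr do rewrite sumrN -mulr_suml.
  rewrite sumrN -mulr_suml lerN2 -[leRHS]mul1r ler_pM2r//.
apply: ler_prod => a _; apply/andP; split.
  by apply: prodr_ge0 => c _; rewrite mulr_ge0 ?expR_ge0// ltW.
apply: ler_prod => c _; apply/andP; split; first by rewrite mulr_ge0 ?expR_ge0// ltW.
have aM : (a < M)%N by [].
set s := Num.sqrt _.
have s2 : s ^+ 2 = (N ^ b)%:R.
  rewrite /s sqr_sqrtr; last by rewrite subr_ge0 ltW.
  rewrite -addnS !gridE// ?(ltnW aM)// grid_step /n expnSr natrM [N%:R]natrX.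
  by rewrite mulfK// expf_neq0.
have s0 : 0 < s by rewrite /s sqrtr_gt0 subr_gt0.
rewrite -lee_fin fineK; last by apply: fin_num_measure; exact: measurable_itv.
have ee0 : 0 <= eta * @ell R (n b) by rewrite mulr_ge0// ltW.
apply: le_trans (normal_prob_itv_ge (d a.+1 c * @ell R (n b)) s0 ee0).
rewrite lee_fin.
have N0 : 0 < (N ^ b)%:R :> R by rewrite ltr0n expn_gt0 expn_gt0.
have -> : (`|d a.+1 c * @ell R (n b)| + eta * @ell R (n b)) ^+ 2 / (s ^+ 2 *+ 2) =
    (`|d a.+1 c| + eta) ^+ 2 * 2 ^+ r * loglog R (n b).
  rewrite normrM (gtr0_norm e0) -mulrDl exprMn sqr_ell// s2 /n expnSr natrM [N%:R]natrX.
  rewrite -[(_%:R) *+ 2]mulr_natl; move: N0; move: ((N ^ b)%:R) => x x0.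
  by field; rewrite gt_eqF.
rewrite [leRHS]mulrAC ler_pM2r ?expR_gt0//.
rewrite (_ : normal_peak s * ((eta * @ell R (n b)) *+ 2) =
  eta * (normal_peak s * (2 * @ell R (n b)))); last by ring.
rewrite ler_peMr ?(ltW eta0)//.
rewrite /normal_peak.
have pi0 := @pi_gt0 R.
have sp0 : 0 < s ^+ 2 * pi *+ 2 by rewrite pmulrn_lgt0// mulr_gt0// exprn_gt0.
rewrite ler_pdivlMl ?sqrtr_gt0// mulr1.
have -> : 2 * @ell R (n b) = Num.sqrt (4 * (2 * (n b)%:R * loglog R (n b))).
  rewrite -sqr_ell// sqrtrM// sqrtr_sqr (gtr0_norm e0).
  by rewrite (_ : 4 = 2 ^+ 2 :> R); [rewrite sqrtr_sqr ger0_norm|ring].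
rewrite ler_sqrt; last by rewrite !mulr_ge0// ltW.
move: L1; move: (loglog R (n b)) => l l1.
rewrite s2 /n expnSr natrM -[_ *+ 2]mulr_natl.
have pi4 : pi <= 4 :> R by have := @pihalf_lt2 R; lra.
have N1 : 1 <= N%:R :> R by rewrite ler1n; lia.
move: N0 N1; move: ((N ^ b)%:R) => x; move: (N%:R) => y x0 y1.
have yl : 1 <= y * l by nra.
have h1 : x * pi <= x * 4 by rewrite ler_pM2l.
have h2 : x * 1 <= x * (y * l) by rewrite ler_pM2l.
lra.
Qed.

(** Since [exp (- loglog n) = 1 / ln n] and [ln (2^(r (b+1))) = r (b+1) ln 2], the block
    probabilities are at least of harmonic order. *)
Lemma ae_zinc_approx : {ae P, forall w, forall J : nat, exists2 j, (J <= j)%N &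
  forall i c, (0 < i)%N -> (i < 2 ^ r)%N ->
    `|zinc (path w) (2 ^ (r * j)) r i c - d i c| <= eta}.
Proof.
have nE b : n b = (2 ^ (r * b.+1))%N by rewrite /n -expnM.
have [j0 Hj0] := @loglog_pow2_ge R 1.
pose E : R := \prod_(a < M) \prod_(c < m) eta.
have E0 : 0 < E by apply: prodr_gt0 => a _; apply: prodr_gt0.
(* Blocks are counted from [j0] on, where [loglog >= 1]; the factor [1 / (j0 + 1)] absorbs the
   shift, as [j0 + b + 1 <= (j0 + 1) (b + 1)]. *)
pose c0 : R := E / (r%:R * ln 2) / j0.+1%:R.
have rl0 : 0 < r%:R * ln 2 :> R by rewrite mulr_gt0 ?ltr0n ?ln2_gt0.
have c00 : 0 < c0 by rewrite !divr_gt0.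
have pc b : c0 / b.+1%:R <= p (j0 + b)%N.
  have [|_ L1] := Hj0 (r * (j0 + b).+1)%N; first by nia.
  rewrite -nE in L1; apply: le_trans (p_ge L1).
  rewrite /loglog expRN lnK; last first.
    rewrite posrE ln_gt0// ltr1n nE.
    by apply: (@leq_trans (2 ^ 1)) => //; rewrite leq_exp2l//; nia.
  rewrite nE ln_pow2 natrM -/E /c0 -!mulrA ler_pM2l// -!invfM.
  rewrite lef_pV2 ?posrE; last 2 first.
  - by rewrite !mulr_gt0 ?ltr0n ?ln2_gt0.
  - by rewrite !mulr_gt0 ?ltr0n ?ln2_gt0.
  have h : (j0 + b).+1%:R <= j0.+1%:R * b.+1%:R :> R.
    by rewrite -natrM ler_nat; nia.
  have := ler_wpM2l (ltW rl0) h.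
  move: ((j0 + b).+1%:R) (j0.+1%:R) (b.+1%:R) (ln 2) (r%:R) => x1 x2 x3 x4 x5.
  by lra.
have indA (t : seq nat) : uniq t ->
    P [set w | forall b, b \in t -> A (j0 + b)%N w] = (\prod_(b <- t) p (j0 + b)%N)%:E.
  move=> ut; have := A_indep (t := [seq (j0 + b)%N | b <- t]).
  rewrite map_inj_uniq// => [/(_ ut)|]; last exact: addnI.
  rewrite big_map => <-; congr (P _); apply/seteqP; split => w /= H b.
    by move=> /mapP[b' b't ->]; exact: H.
  by move=> bt; apply: H; exact: map_f.
have := borel_cantelli2 (fun b => mA (j0 + b)) indA c00 pc.
apply: filterS => w H J; have [b Jb Aw] := H J.
exists (j0 + b).+1; first by lia.
move=> [//|a] c _ aN; have aM : (a < M)%N by lia.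
have [_ L1] : (0 < r * (j0 + b).+1)%N /\ 1 <= loglog R (2 ^ (r * (j0 + b).+1)).
  by apply: Hj0; nia.
have L0 : 0 < loglog R (2 ^ (r * (j0 + b).+1)) by exact: lt_le_trans L1.
have e0 := ell_gt0 L0.
have := Aw a aM c; rewrite -addnS !gridE// ?(ltnW aM)// /itv nE /= in_itv/=.
rewrite -mulrBl -mulrDl zincE => /andP[h1 h2].
by rewrite ler_norml lerBlDl lerBrDl ler_pdivlMr// ler_pdivrMr// h1 h2.
Qed.

End lower_bound.

(** * Chaining and compactness *)

Section chaining.
Variable R : realType.

Lemma dyadic_floor_double r (x : R) : 0 <= x ->
  (dyadic_floor r.+1 x = 2 * dyadic_floor r x \/ dyadic_floor r.+1 x = (2 * dyadic_floor r x).+1)%N.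
Proof.
move=> x0; have y0 : 0 <= x * 2 ^+ r by rewrite mulr_ge0// exprn_ge0.
have /truncn_itv/andP[] := y0; rewrite -/(dyadic_floor r x).
have z0 : 0 <= x * 2 ^+ r.+1 by rewrite mulr_ge0// exprn_ge0.
have /truncn_itv/andP[] := z0; rewrite -/(dyadic_floor r.+1 x).
rewrite exprS mulrCA; move: (x * 2 ^+ r) => y h1 h2 h3 h4.
have : (dyadic_floor r.+1 x < (2 * dyadic_floor r x).+2)%N.
  rewrite -(ltr_nat R) -2!natr1 natrM; apply: le_lt_trans h1 _.
  by move: h4; rewrite -natr1; lra.
have : (2 * dyadic_floor r x <= dyadic_floor r.+1 x)%N.
  rewrite -ltnS -(ltr_nat R) natrM; apply: le_lt_trans h2.
  by rewrite ler_pM2l.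
lia.
Qed.

Lemma dyadic_double r i : dyadic R r.+1 (2 * i) = dyadic R r i.
Proof.
rewrite /dyadic exprS natrM; have : 2 ^+ r != 0 :> R by rewrite expf_neq0.
by move: (2 ^+ r) => p p0; field.
Qed.

Lemma dyadic_floor_le r (x : R) : 0 <= x -> x <= 1 -> (dyadic_floor r x <= 2 ^ r)%N.
Proof.
move=> x0 x1; rewrite -(dyadic_le1 R); apply: le_trans x1.
by have /andP[] := dyadic_floorP r x0.
Qed.

Lemma dyadic_floor_cvg (x : R) : 0 <= x -> dyadic R r (dyadic_floor r x) @[r --> \oo] --> x.
Proof.
move=> x0; apply/cvgrPdist_lt => e e0; have [r0 Hr0] := pow2_inv_small e0.
exists r0 => // r /= rr; have := Hr0 r rr; rewrite -(dyadicS R r (dyadic_floor r x)).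
have /andP[h1 h2] := dyadic_floorP r x0.
by rewrite ger0_norm ?subr_ge0//; apply: le_lt_trans; rewrite lerB// ltW.
Qed.

Variables (g : R -> R) (A : R).
Hypothesis cg : continuous g.
Hypothesis gA : forall r i, (i < 2 ^ r)%N ->
  `|g (dyadic R r i.+1) - g (dyadic R r i)| <= A * (9 / 10) ^+ r.

Let chain_step r (t : R) : 0 <= t -> t <= 1 ->
  `|g (dyadic R r.+1 (dyadic_floor r.+1 t)) - g (dyadic R r (dyadic_floor r t))| <= A * (9 / 10) ^+ r.+1.
Proof.
move=> t0 t1; have h := dyadic_floor_le r.+1 t0 t1.
rewrite -(dyadic_double r).
have A0 : 0 <= A.
  have := @gA 0 0 erefl; rewrite expr0 mulr1; exact: le_trans.
case: (dyadic_floor_double r t0) => E; rewrite E; last first.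
  by apply: gA; rewrite -E.
by rewrite subrr normr0 mulr_ge0// exprn_ge0//; lra.
Qed.

(** The constant 9 is the sum of [(9/10)^q] over [q >= 1]. *)
Let chain_bound r q (t : R) : 0 <= t -> t <= 1 ->
  `|g (dyadic R (r + q) (dyadic_floor (r + q) t)) - g (dyadic R r (dyadic_floor r t))| <=
  9 * A * ((9 / 10) ^+ r - (9 / 10) ^+ (r + q)).
Proof.
move=> t0 t1; elim: q => [|q ih]; first by rewrite addn0 !subrr normr0 mulr0.
rewrite addnS; have := chain_step (r + q) t0 t1.
have := ler_distD (g (dyadic R (r + q) (dyadic_floor (r + q) t)))
  (g (dyadic R (r + q).+1 (dyadic_floor (r + q).+1 t))) (g (dyadic R r (dyadic_floor r t))).
rewrite [(9 / 10) ^+ (r + q).+1]exprS; move: ih.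
move: ((9 / 10) ^+ (r + q)) ((9 / 10) ^+ r) => a b.
lra.
Qed.

Let chain_limit r (t : R) : 0 <= t -> t <= 1 ->
  `|g t - g (dyadic R r (dyadic_floor r t))| <= 9 * A * (9 / 10) ^+ r.
Proof.
move=> t0 t1.
have A0 : 0 <= A.
  have := @gA 0 0 erefl; rewrite expr0 mulr1; exact: le_trans.
have cvg_g : g (dyadic R q (dyadic_floor q t)) @[q --> \oo] --> g t.
  by apply: continuous_cvg; [exact: cg|exact: dyadic_floor_cvg].
apply/ler_addgt0Pr => e e0.
move/cvgrPdist_le : cvg_g => /(_ _ e0)[q0 _ Hq].
have := Hq (r + q0)%N; rewrite /= leq_addl => /(_ erefl).
have := chain_bound r q0 t0 t1.
have := ler_distD (g (dyadic R (r + q0) (dyadic_floor (r + q0) t))) (g t) (g (dyadic R r (dyadic_floor r t))).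
have : 0 <= A * (9 / 10) ^+ (r + q0) by rewrite mulr_ge0// exprn_ge0//; lra.
rewrite mulrBr -mulrA; lra.
Qed.

(** [19 = 9 + 9 + 1]: a chain from each point to its grid point of level [r], and one increment
    between grid points, which are equal or adjacent. *)
Lemma dyadic_chaining r s t : 0 <= s <= 1 -> 0 <= t <= 1 ->
  `|s - t| <= (2 ^+ r)^-1 -> `|g s - g t| <= 19 * A * (9 / 10) ^+ r.
Proof.
wlog st : s t / s <= t.
  move=> H s01 t01; have [st|/ltW ts] := leP s t; first exact: H.
  by rewrite distrC (distrC (g s)); exact: H.
move=> /andP[s0 s1] /andP[t0 t1]; rewrite distrC ger0_norm ?subr_ge0// => d.
have h1 := chain_limit r s0 s1; have h2 := chain_limit r t0 t1.
have h3 : `|g (dyadic R r (dyadic_floor r t)) - g (dyadic R r (dyadic_floor r s))| <= A * (9 / 10) ^+ r.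
  have p0 : 0 < 2 ^+ r :> R by rewrite exprn_gt0.
  have /truncn_itv/andP[] : 0 <= t * 2 ^+ r by rewrite mulr_ge0// ltW.
  rewrite -/(dyadic_floor r t) => a1 a2.
  have /truncn_itv/andP[] : 0 <= s * 2 ^+ r by rewrite mulr_ge0// ltW.
  rewrite -/(dyadic_floor r s) => b1 b2.
  have ab : t * 2 ^+ r <= s * 2 ^+ r + 1.
    rewrite -lerBlDl -mulrBl -[leRHS](mulVf (lt0r_neq0 p0)).
    by rewrite ler_pM2r.
  have st2 : s * 2 ^+ r <= t * 2 ^+ r by rewrite ler_pM2r.
  have i1 : (dyadic_floor r s <= dyadic_floor r t)%N by exact: le_truncn.
  have i2 : (dyadic_floor r t <= (dyadic_floor r s).+1)%N.
    rewrite -ltnS -(ltr_nat R); apply: le_lt_trans a1 _.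
    by rewrite -natr1; lra.
  have A0 : 0 <= A.
    have := @gA 0 0 erefl; rewrite expr0 mulr1; exact: le_trans.
  have [->|ne] := eqVneq (dyadic_floor r t) (dyadic_floor r s).
    by rewrite subrr normr0 mulr_ge0// exprn_ge0//; lra.
  have E : dyadic_floor r t = (dyadic_floor r s).+1.
    by apply/eqP; rewrite eqn_leq i2 ltn_neqAle eq_sym ne i1.
  by rewrite E; apply: gA; rewrite -E; exact: dyadic_floor_le.
have := ler_distD (g (dyadic R r (dyadic_floor r s))) (g s) (g t).
have := ler_distD (g (dyadic R r (dyadic_floor r t))) (g (dyadic R r (dyadic_floor r s))) (g t).
move: h1 h2 h3; rewrite (distrC (g t)) (distrC (g (dyadic R r (dyadic_floor r t))) (g (dyadic R r (dyadic_floor r s)))).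
rewrite -!mulrA; lra.
Qed.

End chaining.

(** * Subsequences, uniform convergence and equicontinuity *)

Section subsequences.

Lemma strict_incr_homo phi : strict_incr phi ->
  forall i j, (i < j)%N -> (phi i < phi j)%N.
Proof.
move=> H i j; elim: j => // j ih; rewrite ltnS leq_eqVlt => /predU1P[->//|ij].
exact: ltn_trans (ih ij) (H j).
Qed.

Lemma strict_incr_ge phi : strict_incr phi -> forall n, (n <= phi n)%N.
Proof. by move=> H; elim=> // n ih; exact: leq_ltn_trans ih (H n). Qed.

Lemma strict_incr_comp phi psi' : strict_incr phi -> strict_incr psi' ->
  strict_incr (fun n => phi (psi' n)).
Proof. by move=> H1 H2 n; apply: strict_incr_homo => //; exact: H2. Qed.

Lemma subsequence_extraction (Q : nat -> nat -> Prop) :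
  (forall k N, exists2 n, (N <= n)%N & Q k n) ->
  exists2 phi, strict_incr phi & forall k, Q k (phi k).
Proof.
move=> H.
have [h Hh] : {h : nat * nat -> nat & forall x, (x.2 <= h x)%N /\ Q x.1 (h x)}.
  apply: (@choice _ _ (fun x n => (x.2 <= n)%N /\ Q x.1 n)) => -[k N].
  by have [n Nn Qn] := H k N; exists n.
pose phi := fix phi n := if n is k.+1 then h (k.+1, (phi k).+1) else h (0, 0)%N.
exists phi; first by move=> n; have [] := Hh (n.+1, (phi n).+1).
by case=> [|k] /=; [have [] := Hh (0, 0)%N|have [] := Hh (k.+1, (phi k).+1)].
Qed.

End subsequences.

Section uniform_convergence.
Context (R : realType) (m : nat).
Implicit Types (F : nat -> R -> 'rV[R]_m) (g h : R -> 'rV[R]_m).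

Lemma coord_le_eucl (v : 'rV[R]_m) c : `|v ord0 c| <= eucl v.
Proof.
rewrite /eucl -sqrtr_sqr ler_wsqrtr// (bigD1 c)//= lerDl.
by apply: sumr_ge0 => *; exact: sqr_ge0.
Qed.

(** The crude factor [m.+1] is nonzero in every dimension, so it can be divided by. *)
Lemma eucl_le (v : 'rV[R]_m) e : 0 <= e -> (forall c, `|v ord0 c| <= e) ->
  eucl v <= m.+1%:R * e.
Proof.
move=> e0 H; have me0 : 0 <= m.+1%:R * e by rewrite mulr_ge0.
rewrite -[leRHS]ger0_norm// -sqrtr_sqr ler_wsqrtr//.
apply: (@le_trans _ _ (\sum_(i < m) e ^+ 2)).
  apply: ler_sum => c _; rewrite -(real_normK (num_real _)).
  by rewrite ler_sqr ?nnegrE.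
rewrite sumr_const card_ord -[_ *+ _]mulr_natl exprMn ler_wpM2r ?sqr_ge0//.
by rewrite -natrX ler_nat; nia.
Qed.

Lemma ucvg01P F g : ucvg01 F g <->
  forall e, 0 < e -> exists N : nat, forall n, (N <= n)%N ->
    forall t, unit_interval t -> forall c, `|F n t ord0 c - g t ord0 c| < e.
Proof.
split=> H e e0.
  have [N HN] := H e e0; exists N => n Nn t t01 c.
  apply: le_lt_trans (HN n Nn t t01).
  by have := coord_le_eucl (F n t - g t) c; rewrite !mxE.
have e0' : 0 < e / (m.+1%:R * 2) by rewrite divr_gt0// mulr_gt0.
have [N HN] := H _ e0'; exists N => n Nn t t01.
apply: (@le_lt_trans _ _ (m.+1%:R * (e / (m.+1%:R * 2)))).
  apply: eucl_le; first exact: ltW.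
  by move=> c; rewrite !mxE; exact/ltW/HN.
have : m.+1%:R != 0 :> R by rewrite pnatr_eq0.
by move: (m.+1%:R) => x x0; rewrite (_ : x * _ = e / 2); [lra|field].
Qed.

Lemma ucvg01_subseq F g phi : strict_incr phi -> ucvg01 F g ->
  ucvg01 (fun n => F (phi n)) g.
Proof.
move=> sphi H e e0; have [N HN] := H e e0; exists N => n Nn t t01.
by apply: HN => //; exact: leq_trans Nn (strict_incr_ge sphi n).
Qed.

Lemma ucvg01_extraction F g :
  (forall e (N : nat), 0 < e -> exists2 n, (N <= n)%N &
    forall t, unit_interval t -> forall c, `|F n t ord0 c - g t ord0 c| < e) ->
  exists phi, strict_incr phi /\ ucvg01 (fun n => F (phi n)) g.
Proof.
move=> H.
have [|phi sphi Hphi] := @subsequence_extraction (fun k n =>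
    forall t, unit_interval t -> forall c, `|F n t ord0 c - g t ord0 c| < k.+1%:R^-1).
  by move=> k N; apply: H; rewrite invr_gt0.
exists phi; split => //; apply/ucvg01P => e e0.
exists (Num.trunc e^-1) => n en t t01 c.
apply: lt_le_trans (Hphi n t t01 c) _.
rewrite invf_ple ?posrE//; apply/ltW/(lt_le_trans (truncnS_gt _)).
by rewrite ler_nat.
Qed.

(* Hoelder continuity with exponent [log2 (10/9)], read on dyadic scales. *)
Definition dyadic_holder (K : R) g := forall r s t c, unit_interval s -> unit_interval t ->
  `|s - t| <= (2 ^+ r)^-1 -> `|g s ord0 c - g t ord0 c| <= K * (9 / 10) ^+ r.

Lemma geometric_small (K e : R) : 0 < e -> exists r : nat, K * (9 / 10) ^+ r < e.
Proof.
move=> e0; have [K0|K0] := leP K 0.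
  by exists 0; rewrite expr0 mulr1 (le_lt_trans K0).
have : ((9 / 10 : R) ^+ n) @[n --> \oo] --> (0 : R).
  by apply: cvg_expr; rewrite ger0_norm; lra.
move/cvgrPdist_lt => /(_ (e / K)); rewrite divr_gt0// => /(_ erefl)[N _ HN].
exists N; have := HN N (leqnn _); rewrite /= sub0r normrN ger0_norm; last first.
  by rewrite exprn_ge0//; lra.
by rewrite ltr_pdivlMr// mulrC.
Qed.

Lemma continuous_row h : (forall c, continuous (fun t => h t ord0 c)) -> continuous h.
Proof.
move=> H x A [Q nQ QA].
have HQ (c : 'I_m) : \forall y \near x, Q ord0 c (h y ord0 c).
  exact: (H c x _ (nQ ord0 c)).
have : \forall y \near x, forall c, Q ord0 c (h y ord0 c).
  exact: (filter_forall _ HQ).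
apply: filterS => y Hy; apply: QA => i c.
by rewrite (ord1 i); exact: Hy.
Qed.

Lemma dyadic_holder_inC0 K g : g 0 = 0 -> dyadic_holder K g -> inC0 g.
Proof.
move=> g0 gK; split => //.
pose h t := g (clamp01 t).
have c01 (t : R) : unit_interval (clamp01 t).
  by rewrite /unit_interval /= clamp01_ge0 clamp01_le1.
have ch : continuous h.
  apply: continuous_row => c t; apply/cvgrPdist_lt => e e0.
  have [r Hr] := geometric_small K e0.
  have d0 : 0 < (2 ^+ r)^-1 :> R by rewrite invr_gt0 exprn_gt0.
  near=> y; apply: le_lt_trans Hr; apply: gK => //.
  have : `|t - y| < (2 ^+ r)^-1 by near: y; exact: cvgr_dist_lt.
  move=> /ltW; apply: le_trans.
  have [ty|/ltW yt] := leP t y.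
    rewrite distrC (distrC t) !ger0_norm ?subr_ge0 ?clamp01_homo//.
    exact: clamp01_lip.
  by rewrite !ger0_norm ?subr_ge0 ?clamp01_homo//; exact: clamp01_lip.
apply: subspace_eq_continuous (continuous_subspaceT ch).
by move=> t /set_mem t01; rewrite -[in RHS](clamp01_id t01).
Unshelve. all: by end_near. Qed.

(* The pointwise limit comes from Tychonoff's theorem; equicontinuity makes
   closeness on a finite grid uniform. *)
Lemma equicontinuous_cluster F K (N0 : nat) :
  (forall n, (N0 <= n)%N -> F n 0 = 0 /\ dyadic_holder K (F n)) ->
  exists g, [/\ g 0 = 0, dyadic_holder K g &
   forall e (N : nat), 0 < e -> exists2 n, (N <= n)%N &
    forall t, unit_interval t -> forall c, `|F n t ord0 c - g t ord0 c| < e].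
Proof.
move=> HF.
pose I : eqType := (R * 'I_m)%type.
pose u n : I -> R := fun x => F n (clamp01 x.1) ord0 x.2.
have c01 (t : R) : unit_interval (clamp01 t).
  by rewrite /unit_interval /= clamp01_ge0 clamp01_le1.
have u01 : unit_interval (0 : R) by rewrite /unit_interval /= lexx ler01.
pose C (x : I) : set R := `[- K, K]%classic.
have Cc x : compact (C x) by exact: segment_compact.
pose UF : set_system (prod_topology (fun _ : I => R)) := [set A | exists N, forall n, (N <= n)%N -> A (u n)].
have FUF : ProperFilter UF.
  split; first by move=> [N /(_ N (leqnn _))].
  split.
  - by exists 0.
  - move=> A1 A2 [N1 H1] [N2 H2]; exists (maxn N1 N2) => n.
    by rewrite geq_max => /andP[n1 n2]; split; [exact: H1|exact: H2].
  - by move=> A1 A2 A12 [N1 H1]; exists N1 => n /H1; exact: A12.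
have UFC : UF [set f | forall x, C x (f x)].
  exists N0 => n nN x; have [F0 Fd] := HF n nN.
  have := Fd 0 (clamp01 x.1) 0 x.2 (c01 _) u01.
  rewrite F0 !mxE !subr0 expr0 invr1 mulr1 ger0_norm ?clamp01_ge0// => /(_ (clamp01_le1 _)).
  by rewrite /C /= in_itv/= ler_norml.
have [f [Cf clf]] := tychonoff Cc FUF UFC.
pose g t : 'rV[R]_m := \row_c f (t, c).
(* A neighbourhood in the product topology constrains finitely many pairs of a time and a
   coordinate, and every tail of the sequence meets it. *)
have key (s : seq I) e (N : nat) : 0 < e -> exists2 n, (N <= n)%N &
    forall x, x \in s -> `|u n x - f x| < e.
  move=> e0.
  have UFA : UF [set h | exists2 n, (N <= n)%N & h = u n].
    by exists N => n Nn; exists n.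
  pose NF : set_system (prod_topology (fun _ : I => R)) := nbhs f.
  have FN : ProperFilter NF by exact: nbhs_pfilter.
  have nB : NF [set h | forall x, x \in s -> `|h x - f x| < e].
    elim: s => [|x s ih].
      by rewrite (_ : mkset _ = setT); [exact: (@filterT _ NF FN)|apply/seteqP; split].
    have nx : NF [set h | `|h x - f x| < e].
      have px : proj x @ NF --> f x by exact: (@proj_continuous I (fun _ => R) x f).
      move/cvgrPdist_lt : px => /(_ e e0).
      by apply: (@filterS _ NF FN) => h; rewrite /proj /= distrC.
    apply: (@filterS _ NF FN) (@filterI _ NF FN _ _ nx ih) => h [h1 h2] y.
    by rewrite inE => /predU1P[->//|]; exact: h2.
  have [_ [[n Nn ->] H]] := clf _ _ UFA nB.
  by exists n.
have gd : dyadic_holder K g.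
  move=> r s t c s01 t01 st; apply/ler_addgt0Pr => e e0.
  have e20 : 0 < e / 2 by lra.
  have [n Nn Hn] := key [:: (s, c); (t, c)] _ N0 e20.
  have h1 := Hn (s, c) (mem_head _ _).
  have h2 : `|u n (t, c) - f (t, c)| < e / 2 by apply: Hn; rewrite !inE eqxx orbT.
  have [_ Fd] := HF n Nn; have := Fd r s t c s01 t01 st.
  move: h1 h2; rewrite /u /= !clamp01_id// => h1 h2 h3.
  rewrite /g !mxE; move: (K * _) h3 => k h3.
  move: h1 h2 h3; rewrite !ltr_norml !ler_norml => /andP[? ?] /andP[? ?] /andP[? ?].
  by apply/andP; split; lra.
exists g; split => //.
  apply/rowP => c; rewrite /g !mxE; apply/eqP; rewrite -normr_le0.
  apply/ler_addgt0Pr => e e0; have [n Nn Hn] := key [:: (0, c)] _ N0 e0.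
  have := Hn _ (mem_head _ _); rewrite /u /= clamp01_id ?lexx ?ler01//.
  have [-> _] := HF n Nn; rewrite mxE sub0r normrN add0r; exact: ltW.
move=> e N e0; have e40 : 0 < e / 4 by lra.
have [r Hr] := geometric_small K e40.
pose s : seq I := [seq (dyadic R r i, c) | i <- iota 0 (2 ^ r).+1, c <- enum 'I_m].
have [n Nn Hn] := key s _ (maxn N N0) e40.
move: Nn; rewrite geq_max => /andP[nN nN0].
exists n => // t /andP[t0 t1] c.
pose t' := dyadic R r (dyadic_floor r t).
have /andP[a1 a2] := dyadic_floorP r t0.
have t'01 : unit_interval t'.
  by rewrite /unit_interval /= dyadic_ge0 (le_trans a1).
have tt' : `|t - t'| <= (2 ^+ r)^-1.
  by rewrite ger0_norm ?subr_ge0// -(dyadicS R r (dyadic_floor r t)) lerB// ltW.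
have ts : (t', c) \in s.
  have ti : dyadic_floor r t \in iota 0 (2 ^ r).+1.
    by rewrite mem_iota add0n ltnS -(dyadic_le1 R) (le_trans a1).
  by apply/allpairsP; exists (dyadic_floor r t, c); split => //; exact: mem_enum.
have := Hn _ ts; rewrite /u /= clamp01_id//.
have [_ Fd] := HF n nN0.
have t01 : unit_interval t by rewrite /unit_interval /= t0 t1.
have := Fd r t t' c t01 t'01 tt'; have := gd r t t' c t01 t'01 tt'.
rewrite /g !mxE; move: Hr; move: (K * _) => k Hr.
rewrite !ltr_norml !ler_norml => /andP[? ?] /andP[? ?] /andP[? ?].
by apply/andP; split; lra.
Qed.

Lemma arzela_ascoli F K (N0 : nat) :
  (forall n, (N0 <= n)%N -> F n 0 = 0 /\ dyadic_holder K (F n)) ->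
  exists phi g, [/\ strict_incr phi, g 0 = 0, dyadic_holder K g &
    ucvg01 (fun n => F (phi n)) g].
Proof.
move=> HF; have [g [g0 gK H]] := equicontinuous_cluster HF.
by have [phi [sphi cphi]] := ucvg01_extraction H; exists phi, g.
Qed.

End uniform_convergence.

(** * From powers of two to all indices *)

Section scaling.
Variables (R : realType) (m : nat).
Implicit Types b : R -> 'rV[R]_m.

Lemma Zn0 b n : b 0 = 0 -> Zn b n 0 = 0.
Proof. by move=> b0; rewrite /Zn mulr0 b0 scaler0. Qed.

Lemma continuous_Zn b n c : continuous b -> continuous (fun t => Zn b n t ord0 c).
Proof.
move=> cb t; rewrite /Zn.
have -> : (fun t => ((@ell R n)^-1 *: b (n%:R * t)) ord0 c) =
    (fun t => (@ell R n)^-1 * (b (n%:R * t) ord0 c)) by apply/funext => u; rewrite mxE.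
apply: cvgM; first exact: cvg_cst.
have H1 : n%:R * u @[u --> t] --> n%:R * t.
  by apply: cvgM; [exact: cvg_cst|exact: cvg_id].
have H2 : b (n%:R * u) @[u --> t] --> b (n%:R * t) by apply: continuous_cvg => //; exact: cb.
exact: (cvg_comp _ _ H2 (@coord_continuous R 1 m ord0 c _)).
Qed.

Definition decay b := exists J : nat, forall j, (J <= j)%N ->
  forall r i c, (i < 2 ^ r)%N -> `|zinc b (2 ^ j) r i c| < 2 * (9 / 10) ^+ r.

Lemma dyadic_holder_Zn_pow2 b : continuous b -> decay b ->
  exists J : nat, forall j, (J <= j)%N -> dyadic_holder 38 (Zn b (2 ^ j)).
Proof.
move=> cb [J HJ]; exists J => j Jj r s t c s01 t01 st.
(* The chaining constant 19 times the factor 2 of [decay]. *)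
rewrite (_ : 38 = 19 * 2); last by ring.
apply: (@dyadic_chaining R (fun t => Zn b (2 ^ j) t ord0 c) 2) => //.
  exact: continuous_Zn.
by move=> r' i ir; have := HJ j Jj r' i c ir; rewrite /zinc !mxE => /ltW.
Qed.

(** For [n > 0], [2 ^ up n] is the power of two strictly above [n] and at most [2 n]. Below, [rho n]
    is the time factor and [kappa n] the space factor that take the path at index [2 ^ up n] to the
    path at index [n]. *)
Definition up (n : nat) : nat := (trunc_log 2 n).+1.

Definition rho (n : nat) : R := n%:R / 2 ^+ up n.

Definition kappa (n : nat) : R := @ell R (2 ^ up n) / @ell R n.

Lemma upP n : (0 < n)%N -> (2 ^ (up n).-1 <= n < 2 ^ up n)%N.
Proof. by move=> n0; exact: trunc_log_bounds. Qed.

Lemma rho_bounds n : (0 < n)%N -> 1 / 2 <= rho n <= 1.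
Proof.
move=> /upP; rewrite /rho /up /= => /andP[h1 h2].
have p0 : 0 < 2 ^+ trunc_log 2 n :> R by rewrite exprn_gt0.
apply/andP; split.
  rewrite ler_pdivlMr ?exprn_gt0// exprS (_ : 1 / 2 * (2 * 2 ^+ _) = 2 ^+ trunc_log 2 n).
    by rewrite -natrX ler_nat.
  by field.
rewrite ler_pdivrMr ?exprn_gt0// mul1r -natrX ler_nat; exact: ltnW.
Qed.

Lemma Zn_rescale b n t : (0 < n)%N -> @ell R (2 ^ up n) != 0 ->
  Zn b n t = kappa n *: Zn b (2 ^ up n) (rho n * t).
Proof.
move=> n0 e0; rewrite /Zn /kappa /rho scalerA mulrAC mulfV// mul1r.
congr (_ *: b _); rewrite natrX mulrA mulrCA mulfV ?mulr1// expf_neq0.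
Qed.

Lemma loglog_homo n n' : 0 < loglog R n -> (n <= n')%N -> loglog R n <= loglog R n'.
Proof.
move=> L0 nn'; have n3 := loglog_gt0_ge3 L0.
have l0 : 0 < ln n%:R :> R by rewrite ln_gt0// ltr1n; lia.
rewrite /loglog ler_ln ?posrE// ?ler_ln ?posrE ?ltr0n ?ler_nat//; try lia.
by apply: lt_le_trans l0 _; rewrite ler_ln ?posrE ?ltr0n ?ler_nat//; lia.
Qed.

Lemma up_large (j0 : nat) : exists N : nat, forall n, (N <= n)%N ->
  (0 < n)%N /\ (j0 < (up n))%N.
Proof.
exists (2 ^ j0)%N => n h; have n0 : (0 < n)%N by apply: leq_trans h; rewrite expn_gt0.
split=> //; have /andP[_ h2] := upP n0.
by rewrite -(ltn_exp2l _ _ (isT : (1 < 2)%N)); exact: leq_ltn_trans h2.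
Qed.

(* [kappa n ^ 2 = (loglog (2 ^ up n) / loglog n) / rho n], where the first factor tends
   to 1 because [loglog (2 ^ (j + 1)) - loglog (2 ^ j) <= 1 / j]. *)
Lemma kappa_bounds : exists N : nat, forall n, (N <= n)%N ->
  [/\ (0 < n)%N, @ell R (2 ^ up n) != 0, 0 < kappa n &
     1 <= kappa n ^+ 2 * rho n <= 1 + (up n).-1%:R^-1].
Proof.
have [j0 Hj0] := @loglog_pow2_ge R 1.
have [N HN] := up_large (maxn j0 1); exists N => n /HN[n0 jn].
have /andP[h1 h2] := upP n0.
move: jn; rewrite gtn_max => /andP[jn1 jn2].
set j := (up n).-1 in h1 *.
have upE : up n = j.+1 by rewrite /j prednK// /up.
have [j_gt0 Lj1] : (0 < j)%N /\ 1 <= loglog R (2 ^ j) by apply: Hj0; lia.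
have Lj0 : 0 < loglog R (2 ^ j) by exact: lt_le_trans Lj1.
have Ln1 : loglog R (2 ^ j) <= loglog R n by exact: loglog_homo.
have Ln0 : 0 < loglog R n by exact: lt_le_trans Ln1.
have Lu1 : loglog R n <= loglog R (2 ^ up n) by apply: loglog_homo => //; exact: ltnW.
have Lu0 : 0 < loglog R (2 ^ up n) by exact: lt_le_trans Lu1.
have en := ell_gt0 Ln0; have eu := ell_gt0 Lu0.
split => //; [by rewrite gt_eqF|by rewrite divr_gt0|].
have nR : 0 < n%:R :> R by rewrite ltr0n.
have -> : kappa n ^+ 2 * rho n = loglog R (2 ^ up n) / loglog R n.
  rewrite /kappa /rho expr_div_n !sqr_ell// natrX.
  have : 2 ^+ up n != 0 :> R by rewrite expf_neq0.
  move: (2 ^+ up n) nR Ln0 => p; move: (loglog R n) (n%:R) => l x x0 l0 p0.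
  by field; rewrite p0 !gt_eqF.
rewrite ler_pdivlMr// ler_pdivrMr// mul1r Lu1/=.
have Lstep : loglog R (2 ^ up n) <= loglog R (2 ^ j) + j%:R^-1.
  rewrite upE !loglog_pow2// addrAC lerD2r -lerBlDl.
  rewrite -ln_div ?posrE ?ltr0n// -natr1 mulrDl divff ?pnatr_eq0; last by lia.
  by rewrite mul1r; apply: le_ln1Dx; rewrite (lt_le_trans (ltrN10 R))// invr_ge0.
apply: le_trans Lstep _; rewrite mulrDl mul1r; apply: lerD => //.
by rewrite ler_peMr ?invr_ge0//; lra.
Qed.

Lemma dyadic_holder_Zn b : continuous b -> decay b ->
  exists N : nat, forall n, (N <= n)%N -> dyadic_holder 76 (Zn b n).
Proof.
move=> cb db; have [J HJ] := dyadic_holder_Zn_pow2 cb db.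
have [N1 H1] := kappa_bounds; have [N2 H2] := up_large (maxn J 1).
exists (maxn N1 N2) => n; rewrite geq_max => /andP[n1 n2].
have [n0 e0 k0 /andP[_ k1]] := H1 n n1; have [_ jn] := H2 n n2.
move: jn; rewrite gtn_max => /andP[Jn n1'].
move=> r s t c s01 t01 st; rewrite !(Zn_rescale _ _ n0 e0) !mxE -mulrBr normrM.
rewrite (ger0_norm (ltW k0)).
have /andP[r1 r2] := rho_bounds n0.
have sc u : unit_interval u -> unit_interval (rho n * u).
  by rewrite /unit_interval /= => /andP[u0 u1]; apply/andP; split; nra.
(* [kappa^2 rho <= 2] and [rho >= 1/2] give [kappa^2 <= 4]; hence the constant [76 = 2 * 38]. *)
have k2 : kappa n <= 2.
  have : (up n).-1%:R^-1 <= 1 :> R.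
    by rewrite invf_le1 ?ltr0n ?ler1n; lia.
  move=> h; have : kappa n ^+ 2 <= 2 ^+ 2 by nra.
  by rewrite ler_sqr ?nnegrE// ltW.
have st' : `|rho n * s - rho n * t| <= (2 ^+ r)^-1.
  rewrite -mulrBr normrM ger0_norm; last by lra.
  by apply: le_trans st; rewrite ler_piMl.
have := HJ _ (ltnW Jn) r _ _ c (sc s s01) (sc t t01) st'.
move=> h; apply: (@le_trans _ _ (2 * (38 * (9 / 10) ^+ r))).
  by apply: ler_pM => //; [exact: ltW|move: h; rewrite /Zn !mxE].
by move: (_ ^+ r) => x; rewrite mulrA; lra.
Qed.

End scaling.

(** * Limit points *)

Section dyadic_energy.
Variables (R : realType) (m : nat).
Implicit Types (g h : R -> 'rV[R]_m).

Definition dyadic_energy h r : R := \sum_(i < 2 ^ r) \sum_(c < m)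
  (h (dyadic R r i.+1) ord0 c - h (dyadic R r i) ord0 c) ^+ 2 * 2 ^+ r.

(** Cauchy-Schwarz for a telescoping sum; it says that refining a regular grid does not decrease the
    energy. *)
Lemma sqr_telescope_le (x : nat -> R) (a k : nat) :
  (x (a + k)%N - x a) ^+ 2 <= k%:R * \sum_(i < k) (x (a + i).+1 - x (a + i)%N) ^+ 2.
Proof.
elim: k => [|k ih]; first by rewrite addn0 subrr expr0n mul0r.
rewrite big_ord_recr/= addnS -natr1.
rewrite (_ : x (a + k).+1 - x a = (x (a + k)%N - x a) + (x (a + k).+1 - x (a + k)%N)); last by ring.
move: ih; set D := (x (a + k).+1 - x (a + k)%N); set X := x (a + k)%N - x a.
set S := \sum_(i < k) _.
case: (posnP k) => [->|k0] ih.
  have -> : X = 0 by apply/eqP; rewrite -sqrf_eq0 eq_le sqr_ge0 andbT; move: ih; rewrite mul0r.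
  have S0 : 0 <= S by apply: sumr_ge0 => *; exact: sqr_ge0.
  by rewrite !add0r mul1r lerDr.
have kR : 0 < k%:R :> R by rewrite ltr0n.
have := sqr_ge0 (k%:R * D - X); move: ih kR; move: (k%:R) => y ih y0 h.
suff : 2 * X * D <= S + y * D ^+ 2 by nra.
by rewrite -(ler_pM2l y0); nra.
Qed.

Lemma cvg_sum_seq (I : Type) (s : seq I) (u : I -> nat -> R) (l : I -> R) :
  (forall i, u i n @[n --> \oo] --> l i) ->
  (\sum_(i <- s) u i n) @[n --> \oo] --> \sum_(i <- s) l i.
Proof.
move=> H; elim: s => [|i s ih].
  rewrite big_nil; under eq_fun do rewrite big_nil; exact: cvg_cst.
rewrite big_cons; under eq_fun do rewrite big_cons; exact: cvgD.
Qed.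

Lemma dyadic_holder_cvg K h (u : nat -> R) t c : dyadic_holder K h -> unit_interval t ->
  (\forall n \near \oo, unit_interval (u n)) -> u n @[n --> \oo] --> t ->
  h (u n) ord0 c @[n --> \oo] --> h t ord0 c.
Proof.
move=> hK t01 u01 ut; apply/cvgrPdist_lt => e e0.
have [r Hr] := geometric_small K e0.
have d0 : 0 < (2 ^+ r)^-1 :> R by rewrite invr_gt0 exprn_gt0.
have H : \forall n \near \oo, `|t - u n| < (2 ^+ r)^-1.
  by move/cvgrPdist_lt : ut; exact.
near=> n; apply: le_lt_trans Hr; apply: hK => //; first by near: n.
by apply/ltW; near: n.
Unshelve. all: by end_near. Qed.

(** Move the endpoints of the chain down to the grid of level [r]. By Cauchy-Schwarz each term is
    then at most the dyadic energy between its endpoints, so the sum is at most [dyadic_energy h r].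
    Continuity of [h] lets [r] tend to infinity. *)
Lemma dyadic_energy_le K h : dyadic_holder K h -> (forall r, dyadic_energy h r <= 1) ->
  energy_le h 1.
Proof.
move=> hK hE s cs.
pose e r (k : nat) : R := \sum_(i < k) \sum_(c < m)
  (h (dyadic R r i.+1) ord0 c - h (dyadic R r i) ord0 c) ^+ 2 * 2 ^+ r.
have e_ge0 r i : 0 <= \sum_(c < m)
  (h (dyadic R r i.+1) ord0 c - h (dyadic R r i) ord0 c) ^+ 2 * 2 ^+ r.
  by apply: sumr_ge0 => c _; rewrite mulr_ge0 ?sqr_ge0 ?exprn_ge0.
pose q r (x : R) := dyadic R r (dyadic_floor r x).
pose term r (p : R * R) := \sum_(c < m)
  (h (q r p.2) ord0 c - h (q r p.1) ord0 c) ^+ 2 / (q r p.2 - q r p.1).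
have eB r a k : e r (a + k)%N - e r a = \sum_(i < k) \sum_(c < m)
  (h (dyadic R r (a + i).+1) ord0 c - h (dyadic R r (a + i)) ord0 c) ^+ 2 * 2 ^+ r.
  by rewrite /e big_split_ord/= addrAC subrr add0r.
have term_le r p : 0 <= p.1 -> p.1 <= p.2 ->
    term r p <= e r (dyadic_floor r p.2) - e r (dyadic_floor r p.1).
  move=> p0 p12; rewrite /term /q.
  have : (dyadic_floor r p.1 <= dyadic_floor r p.2)%N by apply: le_truncn; rewrite ler_pM2r// exprn_gt0.
  move: (dyadic_floor r p.1) (dyadic_floor r p.2) => a b ab.
  rewrite -(subnKC ab); move: (b - a)%N => k {b ab}.
  rewrite eB exchange_big/=; apply: ler_sum => c _.
  have [->|k0] := posnP k.
    by rewrite addn0 !subrr expr0n mul0r big_ord0.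
  have kR : 0 < k%:R :> R by rewrite ltr0n.
  have pr : 0 < 2 ^+ r :> R by rewrite exprn_gt0.
  have -> : dyadic R r (a + k) - dyadic R r a = k%:R / 2 ^+ r.
    by rewrite /dyadic natrD mulrDl addrAC subrr add0r.
  rewrite ler_pdivrMr ?divr_gt0// -mulr_suml.
  rewrite [leRHS](_ : _ = k%:R * \sum_(i < k)
    (h (dyadic R r (a + i).+1) ord0 c - h (dyadic R r (a + i)) ord0 c) ^+ 2).
    exact: (sqr_telescope_le (fun i => h (dyadic R r i) ord0 c)).
  by move: (\sum_(i < k) _) pr => x; move: (2 ^+ r) => z z0; field; rewrite gt_eqF.
have bound r : \sum_(p <- s) term r p <= 1.
  apply: (@le_trans _ _ (\sum_(p <- s) (e r (dyadic_floor r p.2) - e r (dyadic_floor r p.1)))).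
    rewrite big_seq [leRHS]big_seq; apply: ler_sum => p ps.
    have /andP[/allP/(_ _ ps)/and3P[p0 p12 p1] _] := cs.
    exact: term_le.
  apply: le_trans (@chain_telescope R (fun x => e r (dyadic_floor r x)) s _ cs) _ => [x y x0 xy y1|].
    have : (dyadic_floor r x <= dyadic_floor r y)%N by apply: le_truncn; rewrite ler_pM2r// exprn_gt0.
    move=> /subnKC <-; rewrite -subr_ge0 eB; apply: sumr_ge0 => i _; exact: e_ge0.
  have -> : dyadic_floor r (1 : R) = (2 ^ r)%N by rewrite /dyadic_floor mul1r -natrX natrK.
  have -> : dyadic_floor r (0 : R) = 0%N by rewrite /dyadic_floor mul0r truncn0.
  by rewrite {2}/e big_ord0 subr0; exact: hE.
(* Only nondegenerate intervals have denominators with a nonzero limit; the others contribute 0. *)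
pose s' := [seq p <- s | p.1 < p.2].
have cvg_term p : p \in s' -> term r p @[r --> \oo] -->
    \sum_(c < m) (h p.2 ord0 c - h p.1 ord0 c) ^+ 2 / (p.2 - p.1).
  rewrite mem_filter => /andP[lt12 ps].
  have /andP[/allP/(_ _ ps)/and3P[p0 p12 p1] _] := cs.
  have q01 x r : 0 <= x -> x <= 1 -> unit_interval (q r x).
    move=> x0 x1; have /andP[a1 _] := dyadic_floorP r x0.
    by rewrite /unit_interval /= dyadic_ge0 (le_trans a1).
  have qc x : 0 <= x -> q r x @[r --> \oo] --> x by exact: dyadic_floor_cvg.
  have hc x c : 0 <= x -> x <= 1 -> h (q r x) ord0 c @[r --> \oo] --> h x ord0 c.
    move=> x0 x1; apply: dyadic_holder_cvg => //; first exact: hK.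
    - by rewrite /unit_interval /= x0 x1.
    - by apply: nearW => r; exact: q01.
    - exact: qc.
  have p20 : 0 <= p.2 by exact: le_trans p12.
  have p11 : p.1 <= 1 by exact: le_trans p1.
  rewrite /term; apply: (@cvg_sum_seq _ _ (fun c r => (h (q r p.2) ord0 c -
    h (q r p.1) ord0 c) ^+ 2 / (q r p.2 - q r p.1))) => c.
  apply: cvgM.
    have hd : h (q r p.2) ord0 c - h (q r p.1) ord0 c @[r --> \oo] -->
        h p.2 ord0 c - h p.1 ord0 c by apply: cvgB; exact: hc.
    rewrite expr2; have -> : (fun r => (h (q r p.2) ord0 c - h (q r p.1) ord0 c) ^+ 2) =
       (fun r => (h (q r p.2) ord0 c - h (q r p.1) ord0 c) *
         (h (q r p.2) ord0 c - h (q r p.1) ord0 c)).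
      by apply/funext => r; rewrite expr2.
    exact: cvgM.
  apply: cvgV; first by rewrite gt_eqF// subr_gt0.
  by apply: cvgB; exact: qc.
have -> : \sum_(p <- s) \sum_(c < m) (h p.2 ord0 c - h p.1 ord0 c) ^+ 2 / (p.2 - p.1) =
    \sum_(p <- s') \sum_(c < m) (h p.2 ord0 c - h p.1 ord0 c) ^+ 2 / (p.2 - p.1).
  rewrite /s' big_filter [RHS]big_mkcond/= big_seq [RHS]big_seq.
  apply: eq_bigr => p ps; case: ltP => // p21.
  have /andP[/allP/(_ _ ps)/and3P[p0 p12 p1] _] := cs.
  have -> : p.2 = p.1 by apply/le_anti; rewrite p21 p12.
  by apply: big1 => c _; rewrite !subrr expr0n mul0r.
apply/ler_addgt0Pr => ee ee0.
(* The terms are set to 0 outside [s'] because [cvg_sum_seq] asks for convergence at every index. *)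
have [v Hv] : exists v : R * R -> nat -> R, (forall p, v p n @[n --> \oo] -->
     (if p \in s' then \sum_(c < m) (h p.2 ord0 c - h p.1 ord0 c) ^+ 2 / (p.2 - p.1) else 0)) /\
     forall n, \sum_(p <- s') v p n <= 1.
  exists (fun p n => if p \in s' then term n p else 0); split.
    by move=> p; case: ifPn => [/cvg_term//|_]; exact: cvg_cst.
  move=> n; rewrite big_seq; under eq_bigr => p ps do rewrite ps.
  rewrite -big_seq; apply: le_trans (bound n).
  rewrite /s' big_filter big_mkcond/= big_seq [leRHS]big_seq.
  apply: ler_sum => p ps; case: ifP => // _.
  have /andP[/allP/(_ _ ps)/and3P[p0 p12 p1] _] := cs.
  apply: sumr_ge0 => c _; rewrite divr_ge0 ?sqr_ge0// subr_ge0 /q dyadic_le.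
  by apply: le_truncn; rewrite ler_pM2r// exprn_gt0.
have [/(@cvg_sum_seq _ s' v _)/cvgrPdist_le/(_ _ ee0)[N _ HN] bv] := Hv.
have := HN N (leqnn _); have := bv N => /=.
rewrite [X in `|X - _|]big_seq; under [X in `|X - _|]eq_bigr => p ps do rewrite ps.
rewrite -big_seq ler_norml => h1 /andP[_]; lra.
Qed.

End dyadic_energy.

Section limit_energy.
Variables (R : realType) (m : nat).
Implicit Types (b g h : R -> 'rV[R]_m).

(** The slack runs through [q.+1^-1], so that countably many almost sure statements suffice. *)
Definition energy_limit b := forall (r q : nat), exists J : nat, forall j, (J <= j)%N ->
  \sum_(i < 2 ^ r) \sum_(c < m) zinc b (2 ^ j) r i c ^+ 2 * 2 ^+ r <= 1 + q.+1%:R^-1.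

Lemma ucvg01_cvg (F : nat -> R -> 'rV[R]_m) g t c : ucvg01 F g -> unit_interval t ->
  F n t ord0 c @[n --> \oo] --> g t ord0 c.
Proof.
move=> /ucvg01P H t01; apply/cvgrPdist_lt => e e0.
have [N HN] := H e e0; exists N => // n /= Nn.
by rewrite distrC; exact: HN.
Qed.

Lemma cvgn_eventually (u v : nat -> R) (l : R) :
  (exists M : nat, forall n, (M <= n)%N -> u n = v n) ->
  u n @[n --> \oo] --> l -> v n @[n --> \oo] --> l.
Proof.
move=> [M HM] /cvgrPdist_lt H; apply/cvgrPdist_lt => e e0.
have [N _ HN] := H e e0; exists (maxn M N) => // n /=.
rewrite geq_max => /andP[Mn Nn].
by rewrite -HM//; exact: HN.
Qed.

Lemma cvgn_sqr (u : nat -> R) (l : R) : u n @[n --> \oo] --> l ->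
  u n ^+ 2 @[n --> \oo] --> l ^+ 2.
Proof.
move=> ul; rewrite expr2; have -> : (fun n => u n ^+ 2) = (fun n => u n * u n).
  by apply/funext => n; rewrite expr2.
exact: cvgM.
Qed.

(** [phi] is only asked to tend to infinity, since it will be [up] along a subsequence, which may
    repeat values. *)
Lemma energy_limit_ucvg b h (phi : nat -> nat) : energy_limit b ->
  (forall N : nat, exists M : nat, forall n, (M <= n)%N -> (N <= phi n)%N) ->
  ucvg01 (fun n => Zn b (2 ^ phi n)) h -> forall r, dyadic_energy h r <= 1.
Proof.
move=> eb phioo bh r; apply/ler_addgt0Pr => e e0.
pose q := Num.trunc e^-1.
have qe : q.+1%:R^-1 <= e by rewrite invf_ple ?posrE// ltW// truncnS_gt.
apply: (@le_trans _ _ (1 + q.+1%:R^-1)); last by rewrite lerD2l.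
have dy01 i : (i <= 2 ^ r)%N -> unit_interval (dyadic R r i).
  by move=> ir; rewrite /unit_interval /= dyadic_ge0 dyadic_le1.
have cv : dyadic_energy (Zn b (2 ^ phi n)) r @[n --> \oo] --> dyadic_energy h r.
  rewrite /dyadic_energy.
  apply: (@cvg_sum_seq _ _ _ (fun (i : 'I_(2 ^ r)) n => \sum_(c < m) (Zn b (2 ^ phi n) (dyadic R r i.+1) ord0 c -
    Zn b (2 ^ phi n) (dyadic R r i) ord0 c) ^+ 2 * 2 ^+ r)) => i.
  apply: (@cvg_sum_seq _ _ _ (fun c n => (Zn b (2 ^ phi n) (dyadic R r i.+1) ord0 c -
    Zn b (2 ^ phi n) (dyadic R r i) ord0 c) ^+ 2 * 2 ^+ r)) => c.
  apply: cvgM; last exact: cvg_cst.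
  have hd : Zn b (2 ^ phi n) (dyadic R r i.+1) ord0 c - Zn b (2 ^ phi n) (dyadic R r i) ord0 c
      @[n --> \oo] --> h (dyadic R r i.+1) ord0 c - h (dyadic R r i) ord0 c.
    have hdy k : (k <= 2 ^ r)%N ->
        Zn b (2 ^ phi n) (dyadic R r k) ord0 c @[n --> \oo] --> h (dyadic R r k) ord0 c.
      by move=> kr; have := @ucvg01_cvg _ _ _ c bh (dy01 k kr); exact.
    by apply: cvgB; apply: hdy => //; exact: ltnW.
  exact: (@cvgn_sqr (fun n => Zn b (2 ^ phi n) (dyadic R r i.+1) ord0 c - Zn b (2 ^ phi n) (dyadic R r i) ord0 c)).
rewrite -(cvg_lim _ cv)//; apply: limr_le; first by apply/cvg_ex; exists (dyadic_energy h r).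
have [J HJ] := eb r q; have [M HM] := phioo J.
exists M => // n /= Mn; apply: le_trans (HJ _ (HM n Mn)).
rewrite le_eqVlt; apply/orP; left; apply/eqP.
by apply: eq_bigr => i _; apply: eq_bigr => c _; rewrite /zinc !mxE.
Qed.

(* A limit point [g] of the whole sequence is [rho^(-1/2) h (rho t)] for a limit
   point [h] along the powers of two and some [rho] in [1/2, 1]; the energy is
   invariant under this rescaling. *)
Lemma limit_point_energy b g phi : b 0 = 0 -> continuous b -> decay b ->
  energy_limit b -> strict_incr phi -> ucvg01 (fun n => Zn b (phi n)) g ->
  energy_le g 1.
Proof.
move=> b0 cb db eb sphi bg.
have [J HJ] := dyadic_holder_Zn_pow2 cb db.
have [N1 H1] := kappa_bounds R; have [N2 H2] := up_large J.
(* Two successive extractions: [p1] makes the paths at the reference powers of two converge, [p2]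
   makes the ratios [rho] converge. *)
have [p1 [h [sp1 h0 hK hh]]] : exists p1 h, [/\ strict_incr p1, h 0 = 0, dyadic_holder 38 h &
    ucvg01 (fun n => Zn b (2 ^ up (phi (p1 n)))) h].
  apply: (@arzela_ascoli R m (fun n => Zn b (2 ^ up (phi n))) 38 N2) => n n2.
  have [_ Jn] := H2 _ (leq_trans n2 (strict_incr_ge sphi n)).
  by split; [exact: Zn0|exact/HJ/ltnW].
pose a n := phi (p1 n).
have sa : strict_incr a by exact: strict_incr_comp.
have rho_le1 n : `|rho R n| <= 1.
  have [->|n0] := posnP n; first by rewrite /rho mul0r normr0 ler01.
  by have /andP[r1 r2] := rho_bounds R n0; rewrite ger0_norm; lra.
have [p2 sp2 rl] : exists2 p2, strict_incr p2 & cvgn (fun n => rho R (a (p2 n))).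
  have bnd : bounded_fun (fun n => rho R (a n)).
    by exists 1; split => // x x1 n _; apply: le_trans (ltW x1); exact: rho_le1.
  have [p2 ip2 cp2] := bolzano_weierstrass bnd.
  exists p2 => // n.
  have : (p2 n <= p2 n.+1)%N by have := ip2 n n.+1; rewrite !leEnat leqnSn => ->.
  rewrite leq_eqVlt => /predU1P[E|//].
  by have := ip2 n.+1 n; rewrite E !leEnat leqnn ltnn.
pose aa n := a (p2 n).
have saa : strict_incr aa by exact: strict_incr_comp.
set rr := lim _ in rl.
have aa_large (N : nat) : exists M : nat, forall n, (M <= n)%N -> (N <= aa n)%N.
  by exists N => n nN; exact: leq_trans nN (strict_incr_ge saa n).
have rr_bounds : 1 / 2 <= rr <= 1.
  have [M HM] := aa_large 1%N.
  apply/andP; split.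
    apply: limr_ge; first by apply/cvg_ex; exists rr.
    by exists M => // n /= /HM a0; have /andP[] := rho_bounds R a0.
  apply: limr_le; first by apply/cvg_ex; exists rr.
  by exists M => // n /= /HM a0; have /andP[] := rho_bounds R a0.
have rr0 : 0 < rr by lra.
have kr1 : kappa R (aa n) ^+ 2 * rho R (aa n) @[n --> \oo] --> (1 : R).
  apply/cvgrPdist_le => e e0.
  have [N3 H3] := up_large (Num.trunc e^-1).+2.
  have [M HM] := aa_large (maxn N1 N3); exists M => // n /= /HM.
  rewrite geq_max => /andP[n1 n3]; have [_ _ _ /andP[k1 k2]] := H1 _ n1.
  have [_ u3] := H3 _ n3.
  have [u4 u5] : (0 < (up (aa n)).-1)%N /\ ((Num.trunc e^-1).+1 <= (up (aa n)).-1)%N.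
    by move: u3; move: (up (aa n)) (Num.trunc e^-1) => x y; lia.
  rewrite distrC ger0_norm ?subr_ge0// lerBlDl; apply: le_trans k2 _.
  rewrite lerD2l invf_ple ?posrE ?ltr0n//.
  by apply/ltW/(lt_le_trans (truncnS_gt _)); rewrite ler_nat.
have k2l : kappa R (aa n) ^+ 2 @[n --> \oo] --> rr^-1.
  have rV : (rho R (aa n))^-1 @[n --> \oo] --> rr^-1 by apply: cvgV; [rewrite gt_eqF|].
  have L : kappa R (aa n) ^+ 2 * rho R (aa n) * (rho R (aa n))^-1
      @[n --> \oo] --> 1 * rr^-1 by exact: cvgM.
  rewrite mul1r in L; apply: (cvgn_eventually _ L); have [M HM] := aa_large 1%N.
  exists M => n /HM n0; have /andP[r1 _] := rho_bounds R n0.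
  by rewrite /= mulfK// gt_eqF//; lra.
have scal t : unit_interval t -> unit_interval (rr * t).
  rewrite /unit_interval /= => /andP[t0 t1]; move: rr_bounds => /andP[? ?].
  by apply/andP; split; nra.
have hlim t c : unit_interval t ->
    Zn b (2 ^ up (aa n)) (rho R (aa n) * t) ord0 c @[n --> \oo] --> h (rr * t) ord0 c.
  move=> t01.
  have sc : \forall n \near \oo, unit_interval (rho R (aa n) * t).
    have [M HM] := aa_large 1%N; exists M => // n /= /HM n0.
    have /andP[r1 r2] := rho_bounds R n0.
    move: t01; rewrite /unit_interval /= => /andP[t0 t1].
    by apply/andP; split; nra.
  have rt : rho R (aa n) * t @[n --> \oo] --> rr * t by apply: cvgM => //; exact: cvg_cst.
  have c1 := @dyadic_holder_cvg R m _ _ _ _ c hK (scal t t01) sc rt.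
  have hh2 := ucvg01_subseq sp2 hh.
  apply/cvgrPdist_lt => e e0; have e20 : 0 < e / 2 by lra.
  move/cvgrPdist_lt : c1 => /(_ _ e20) c1.
  move/ucvg01P : hh2 => /(_ _ e20)[N HN].
  near=> n.
  have n1 : unit_interval (rho R (aa n) * t) by near: n.
  have n2 : `|h (rr * t) ord0 c - h (rho R (aa n) * t) ord0 c| < e / 2 by near: n.
  have n3 : (N <= n)%N by near: n; exists N.
  have := HN n n3 _ n1 c; rewrite /aa /a in n2 *; move: n2.
  rewrite !ltr_norml => /andP[? ?] /andP[? ?]; apply/andP; split; lra.
have glim t c : unit_interval t -> Zn b (aa n) t ord0 c @[n --> \oo] --> g t ord0 c.
  move=> t01; have := @ucvg01_cvg _ _ _ c (ucvg01_subseq (strict_incr_comp sp1 sp2) bg) t01.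
  exact.
(* Stated for squares because only [kappa^2] is shown to converge, which also avoids a square root
   of [rr]. The factor [rr^-1] is absorbed by the lengths when a chain is scaled by [rr]. *)
have gh t u c : unit_interval t -> unit_interval u ->
    (g t ord0 c - g u ord0 c) ^+ 2 = rr^-1 * (h (rr * t) ord0 c - h (rr * u) ord0 c) ^+ 2.
  move=> t01 u01.
  have L1 : (Zn b (aa n) t ord0 c - Zn b (aa n) u ord0 c) *
      (Zn b (aa n) t ord0 c - Zn b (aa n) u ord0 c) @[n --> \oo] -->
      (g t ord0 c - g u ord0 c) ^+ 2.
    by rewrite expr2; apply: cvgM; apply: cvgB; exact: glim.
  have L2 : kappa R (aa n) ^+ 2 *
      ((Zn b (2 ^ up (aa n)) (rho R (aa n) * t) ord0 c - Zn b (2 ^ up (aa n)) (rho R (aa n) * u) ord0 c) *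
       (Zn b (2 ^ up (aa n)) (rho R (aa n) * t) ord0 c - Zn b (2 ^ up (aa n)) (rho R (aa n) * u) ord0 c))
      @[n --> \oo] --> rr^-1 * (h (rr * t) ord0 c - h (rr * u) ord0 c) ^+ 2.
    by apply: cvgM => //; rewrite expr2; apply: cvgM; apply: cvgB; exact: hlim.
  apply: (cvg_unique _ L1); first exact: Rhausdorff.
  apply: (cvgn_eventually _ L2).
  have [M HM] := aa_large (maxn N1 1); exists M => n /HM.
  rewrite geq_max => /andP[n1 n0]; have [_ e0 _ _] := H1 _ n1.
  by rewrite !(Zn_rescale _ _ n0 e0) !mxE; ring.
have hE : energy_le h 1.
  apply: (dyadic_energy_le hK); apply: (@energy_limit_ucvg b h (fun n => up (a n))) => //.
  move=> N; have [M HM] := up_large N; exists M => n Mn.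
  by have [_ /ltnW] := HM _ (leq_trans Mn (strict_incr_ge sa n)).
move=> s cs.
pose s' := [seq (rr * p.1, rr * p.2) | p <- s].
move: (rr_bounds) => /andP[r1 r2].
have cs' : chain s'.
  move: cs; rewrite /chain /s' all_map pairwise_map => /andP[s01 pws].
  apply/andP; split.
    apply: sub_all s01 => p /and3P[q0 q12 q1]; rewrite /in01 /=.
    by apply/and3P; split; nra.
  by apply: sub_pairwise pws => p q /=; rewrite /before /= ler_pM2l.
have := hE _ cs'; rewrite /s' big_map; apply: le_trans.
rewrite le_eqVlt; apply/orP; left; apply/eqP.
rewrite big_seq [RHS]big_seq; apply: eq_bigr => p ps; apply: eq_bigr => c _ /=.
have /andP[/allP/(_ _ ps)/and3P[p0 p12 p1'] _] := cs.
rewrite gh; last 2 first.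
- by rewrite /unit_interval /= (le_trans p0).
- by rewrite /unit_interval /= p0 (le_trans p12).
by rewrite -mulrBr invfM; ring.
Unshelve. all: by end_near. Qed.

Lemma relatively_compact_Zn b phi : b 0 = 0 -> continuous b -> decay b -> strict_incr phi ->
  exists p h, [/\ strict_incr p, h 0 = 0, dyadic_holder 76 h & ucvg01 (fun n => Zn b (phi (p n))) h].
Proof.
move=> b0 cb db sphi; have [N HN] := dyadic_holder_Zn cb db.
apply: (@arzela_ascoli R m (fun n => Zn b (phi n)) 76 N) => n Nn.
split; first exact: Zn0.
by apply: HN; exact: leq_trans Nn (strict_incr_ge sphi n).
Qed.

End limit_energy.

Section approximation.
Variables (R : realType) (m : nat).
Implicit Types (b f : R -> 'rV[R]_m).

(* Restricting the targets to lattices leaves countably many events, so that a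
   single null set serves all functions [f]. *)
Definition lattice_target (r q : nat) (k : {ffun 'I_(2 ^ r) * 'I_m -> int})
    (i : nat) (c : 'I_m) : R :=
  if insub i is Some i' then (k (i', c))%:~R / q.+1%:R else 0.

Definition dense_hits b := forall (r q : nat) (k : {ffun 'I_(2 ^ r) * 'I_m -> int}),
  (0 < r)%N ->
  \sum_(a < (2 ^ r).-1) \sum_(c < m)
    (`|lattice_target q k a.+1 c| + q.+1%:R^-1) ^+ 2 * 2 ^+ r <= 1 ->
  forall J : nat, exists2 j, (J <= j)%N &
    forall i c, (0 < i)%N -> (i < 2 ^ r)%N ->
      `|zinc b (2 ^ (r * j)) r i c - lattice_target q k i c| <= q.+1%:R^-1.

(** The chain with one interval gives [(f t - f s)^2 <= t - s], and [1/2 <= (9/10)^2]. *)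
Lemma energy_le_dyadic_holder f : energy_le f 1 -> dyadic_holder 1 f.
Proof.
move=> Ef r s t c; wlog st : s t / s <= t.
  move=> H s01 t01; have [st|/ltW ts] := leP s t; first exact: H.
  by rewrite distrC (distrC (f s ord0 c)); exact: H.
move=> /andP[s0 s1] /andP[t0 t1]; rewrite distrC ger0_norm ?subr_ge0// => d.
rewrite mul1r distrC.
have [->|ts] := eqVneq t s; first by rewrite subrr normr0 exprn_ge0//; lra.
have lt_st : 0 < t - s by rewrite subr_gt0 lt_neqAle eq_sym ts.
have := Ef [:: (s, t)]; rewrite /chain /in01 /= s0 st t1 big_seq1 => /(_ erefl) /= H.
have Hc : (f t ord0 c - f s ord0 c) ^+ 2 / (t - s) <= 1.
  apply: le_trans H; rewrite (bigD1 c)//= lerDl; apply: sumr_ge0 => i _.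
  by rewrite divr_ge0 ?sqr_ge0// ltW.
rewrite ler_pdivrMr// mul1r in Hc.
have x0 : 0 <= (9 / 10 : R) ^+ r by rewrite exprn_ge0//; lra.
rewrite -ler_sqr ?nnegrE// real_normK ?num_real//.
apply: le_trans Hc _; apply: le_trans d _; rewrite -exprVn -exprM mulnC exprM.
by apply: lerXn2r; rewrite ?nnegrE; lra.
Qed.

Lemma sum_zinc b n r k c : zinc b n r 0 c + \sum_(i < k) zinc b n r i.+1 c =
  (Zn b n (dyadic R r k.+1) - Zn b n (dyadic R r 0)) ord0 c.
Proof.
elim: k => [|k ih]; first by rewrite big_ord0 addr0.
by rewrite big_ord_recr/= addrA ih /zinc !mxE; ring.
Qed.

(** The increments aimed at are those of [(1 - e') f]: shrinking leaves room in the energy for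
    rounding to a lattice and for the tolerance of [dense_hits]. On the grid the path is recovered
    by adding its increments, and between grid points by the Hoelder bounds. *)
Lemma approximation b f : b 0 = 0 -> continuous b -> decay b -> dense_hits b ->
  f 0 = 0 -> energy_le f 1 ->
  exists phi, strict_incr phi /\ ucvg01 (fun n => Zn b (phi n)) f.
Proof.
move=> b0 cb db hb f0 Ef; apply: ucvg01_extraction => e N e0.
have [J HJ] := dyadic_holder_Zn_pow2 cb db.
have fd := energy_le_dyadic_holder Ef.
have u0 : unit_interval (0 : R) by rewrite /unit_interval /= lexx ler01.
(* The final error is at most [6 e']: [3 e'] on the grid, [e'] for the shrinking and [e'] for the
   modulus of each path. *)
pose e' := Num.min (e / 10) (1 / 2).
have e'0 : 0 < e' by rewrite lt_min; apply/andP; split; lra.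
have [e'e e'1] : e' <= e / 10 /\ e' <= 1 / 2 by rewrite /e' !ge_min !lexx orbT.
have [r [r0 Hr]] : exists r, (0 < r)%N /\ 38 * (9 / 10) ^+ r < e'.
  have [r Hr] := geometric_small 38 e'0; exists r; split => //.
  by rewrite lt0n; apply/eqP => E; move: Hr; rewrite E expr0; lra.
have x0 : 0 <= (9 / 10 : R) ^+ r by rewrite exprn_ge0//; lra.
have xr : (9 / 10 : R) ^+ r < e' by lra.
pose d (i : nat) (c : 'I_m) : R :=
  (1 - e') * (f (dyadic R r i.+1) ord0 c - f (dyadic R r i) ord0 c).
have p0 : 0 < 2 ^+ r :> R by rewrite exprn_gt0.
(* Rounding and tolerance cost at most [8 eta 2^r] of energy per interval and coordinate, hence at
   most [V eta <= e'] in all, and [(1 - e')^2 + e' <= 1]. *)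
pose V : R := 8 * (2 ^+ r * 2 ^+ r * m.+1%:R).
have V0 : 0 < V by rewrite !mulr_gt0.
pose q := Num.trunc (V / e').
pose eta : R := q.+1%:R^-1.
have q0 : 0 < q.+1%:R :> R by rewrite ltr0n.
have eta0 : 0 < eta by rewrite invr_gt0.
have eta1 : eta <= 1 by rewrite invf_le1// ler1n.
have Veta : V * eta <= e'.
  rewrite ler_pdivrMr// mulrC -ler_pdivrMr//; apply/ltW; exact: truncnS_gt.
have dyu i : (i <= 2 ^ r)%N -> unit_interval (dyadic R r i).
  by move=> ir; rewrite /unit_interval /= dyadic_ge0 dyadic_le1.
have d1 i c : (i < 2 ^ r)%N -> `|d i c| <= 1.
  move=> ir; rewrite /d normrM ger0_norm; last by lra.
  have := fd r (dyadic R r i.+1) (dyadic R r i) c (dyu _ ir) (dyu _ (ltnW ir)).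
  rewrite dyadicS [X in X <= _ -> _]gtr0_norm ?invr_gt0//.
  move=> /(_ (lexx _)); rewrite mul1r.
  move: (`|_|) (normr_ge0 (f (dyadic R r i.+1) ord0 c - f (dyadic R r i) ord0 c)) => y y0 y1.
  nra.
pose k : {ffun 'I_(2 ^ r) * 'I_m -> int} := [ffun x : 'I_(2 ^ r) * 'I_m => Num.floor (d x.1 x.2 * q.+1%:R)].
have ltE i c (ir : (i < 2 ^ r)%N) :
    lattice_target q k i c = (Num.floor (d i c * q.+1%:R))%:~R / q.+1%:R.
  by rewrite /lattice_target insubT /= ffunE.
have ltd i c : (i < 2 ^ r)%N -> `|lattice_target q k i c - d i c| <= eta.
  move=> ir; rewrite ltE//.
  have := floor_le (d i c * q.+1%:R); have := floorD1_gt (d i c * q.+1%:R).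
  rewrite intrD; move: ((Num.floor (d i c * q.+1%:R))%:~R) => z h1 h2.
  rewrite -[X in `|_ - X|](mulfK (lt0r_neq0 q0)) -mulrBl normrM normfV (gtr0_norm q0).
  rewrite ler_piMl ?invr_ge0 ?(ltW q0)//.
  by rewrite ler_norml; apply/andP; split; lra.
have fdy i : (i <= 2 ^ r)%N -> forall c, `|f (dyadic R r i) ord0 c| <= 1.
  move=> ir c; have := fd 0%N (dyadic R r i) 0 c (dyu _ ir) u0.
  rewrite f0 mxE !subr0 expr0 invr1 mulr1 ger0_norm ?dyadic_ge0// dyadic_le1; exact.
have M1 : ((2 ^ r).-1 < 2 ^ r)%N by rewrite prednK// expn_gt0.
have Ed : \sum_(i < 2 ^ r) \sum_(c < m) d i c ^+ 2 * 2 ^+ r <= (1 - e') ^+ 2.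
  have := Ef _ (chain_dyadic R r); rewrite sum_dyadic => H.
  have h2 : 0 <= (1 - e') ^+ 2 by rewrite sqr_ge0.
  apply: le_trans (_ : (1 - e') ^+ 2 * 1 <= _); last by rewrite mulr1.
  apply: le_trans (ler_wpM2l h2 H); rewrite le_eqVlt; apply/orP; left; apply/eqP.
  rewrite mulr_sumr; apply: eq_bigr => i _; rewrite mulr_sumr; apply: eq_bigr => c _.
  by rewrite /= dyadicS ?invrK /d exprMn -?mulrA.
have hit : \sum_(a < (2 ^ r).-1) \sum_(c < m)
    (`|lattice_target q k a.+1 c| + q.+1%:R^-1) ^+ 2 * 2 ^+ r <= 1.
  have step (a : 'I_((2 ^ r).-1)) c : (`|lattice_target q k a.+1 c| + q.+1%:R^-1) ^+ 2 * 2 ^+ r <=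
      d a.+1 c ^+ 2 * 2 ^+ r + 8 * eta * 2 ^+ r.
    rewrite -mulrDl ler_pM2r//.
    have aM : (a.+1 < 2 ^ r)%N by rewrite -ltn_predRL.
    have h1 := ltd a.+1 c aM; have h2 := d1 a.+1 c aM.
    have h3 : `|lattice_target q k a.+1 c| <= `|d a.+1 c| + eta.
      by have := ler_distD 0 (lattice_target q k a.+1 c) (d a.+1 c);
        have := lerB_dist (lattice_target q k a.+1 c) (d a.+1 c); lra.
    rewrite -[d a.+1 c ^+ 2]real_normK ?num_real// -/eta.
    have := normr_ge0 (lattice_target q k a.+1 c); have := normr_ge0 (d a.+1 c).
    move: h2 h3; move: (`|lattice_target q k a.+1 c|) (`|d a.+1 c|) => x y h2 h3 y0 x0'.
    have h4 : (x + eta) ^+ 2 <= (y + 2 * eta) ^+ 2.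
      by rewrite ler_sqr ?nnegrE//; lra.
    have h5 : y * eta <= eta by rewrite ler_piMl// ltW.
    have h6 : eta * eta <= eta by rewrite ler_piMl// ltW.
    apply: le_trans h4 _; rewrite sqrrD; lra.
  apply: le_trans (ler_sum _ (fun a _ => ler_sum _ (fun c _ => step a c))) _.
  under eq_bigr do rewrite big_split/=.
  rewrite big_split/=.
  have S1 : \sum_(i < (2 ^ r).-1) \sum_(c < m) d i.+1 c ^+ 2 * 2 ^+ r <= (1 - e') ^+ 2.
    apply: le_trans Ed; rewrite -(prednK (_ : 0 < 2 ^ r)%N) ?expn_gt0//.
    rewrite [leRHS]big_ord_recl/=; apply: ler_wpDl => //.
    by apply: sumr_ge0 => c _; rewrite mulr_ge0 ?sqr_ge0// ltW.
  have S2 : \sum_(i < (2 ^ r).-1) \sum_(c < m) 8 * eta * 2 ^+ r <= V * eta.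
    rewrite !sumr_const !card_ord -mulrnA -[_ *+ _]mulr_natr natrM.
    have h1 : (m%:R * (2 ^ r).-1%:R : R) <= m.+1%:R * 2 ^+ r.
      by rewrite -natrX; apply: ler_pM => //; rewrite ler_nat// ltnW.
    have h2 : 0 <= 8 * eta * 2 ^+ r by rewrite !mulr_ge0// ltW.
    apply: le_trans (ler_wpM2l h2 h1) _; rewrite /V le_eqVlt; apply/orP; left; apply/eqP.
    by ring.
  apply: le_trans (lerD S1 S2) _; nra.
have [j jJ Hj] := hb r q k r0 hit (maxn N J).
have jr : (j <= r * j)%N by rewrite leq_pmull.
exists (2 ^ (r * j))%N.
  apply: leq_trans (ltnW (ltn_expl (r * j) (isT : (1 < 2)%N))).
  apply: leq_trans jr; apply: leq_trans jJ; exact: leq_maxl.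
set n := (2 ^ (r * j))%N.
have Zd : dyadic_holder 38 (Zn b n).
  by apply: HJ; apply: leq_trans jr; apply: leq_trans jJ; exact: leq_maxr.
have Z0 : Zn b n 0 = 0 by exact: Zn0.
(* The increment over the first interval is not prescribed; both paths start at 0, and their moduli
   keep them below [e'] there. *)
have first i : (i <= 1)%N -> forall c, `|Zn b n (dyadic R r i) ord0 c| <= e' /\
    `|f (dyadic R r i) ord0 c| <= e'.
  move=> i1 c; have ir : (i <= 2 ^ r)%N by apply: leq_trans i1 _; rewrite expn_gt0.
  have di : `|dyadic R r i - 0| <= (2 ^+ r)^-1.
    rewrite subr0 ger0_norm ?dyadic_ge0// /dyadic ler_piMl ?invr_ge0 ?(ltW p0)//.
    by rewrite lern1.
  have := Zd r _ _ c (dyu _ ir) u0 di; have := fd r _ _ c (dyu _ ir) u0 di.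
  by rewrite Z0 f0 !mxE !subr0 => h1 h2; split; lra.
(* One [e'] for the accumulated increment errors, of at most [2 eta] each, and two for the values at
   the end of the first interval. *)
have grid i c : (i <= 2 ^ r)%N ->
    `|Zn b n (dyadic R r i) ord0 c - (1 - e') * f (dyadic R r i) ord0 c| <= 3 * e'.
  case: i => [|i] ir.
    have [h1 h2] := first 0%N isT c.
    have := ler_normB (Zn b n (dyadic R r 0) ord0 c) ((1 - e') * f (dyadic R r 0) ord0 c).
    rewrite normrM ger0_norm; last by lra.
    have : (1 - e') * `|f (dyadic R r 0) ord0 c| <= e'.
      by apply: le_trans h2; rewrite ler_piMl//; lra.
    lra.
  have [h1 h2] := first 1%N isT c.
  have E : Zn b n (dyadic R r i.+1) ord0 c - (1 - e') * f (dyadic R r i.+1) ord0 c =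
      \sum_(a < i) (zinc b n r a.+1 c - d a.+1 c) +
      (Zn b n (dyadic R r 1) ord0 c - (1 - e') * f (dyadic R r 1) ord0 c).
    rewrite sumrB.
    have := sum_zinc b n r i c; rewrite /zinc !mxE => H.
    have H2 : \sum_(a < i) d a.+1 c = (1 - e') * (f (dyadic R r i.+1) ord0 c - f (dyadic R r 1) ord0 c).
      elim: (i) => [|l ih]; first by rewrite big_ord0 subrr mulr0.
      by rewrite big_ord_recr/= ih /d; ring.
    by move: H; rewrite H2 /zinc; move: (\sum_(a < i) _) => S; lra.
  rewrite E; apply: le_trans (ler_normD _ _) _.
  have s1 : `|\sum_(a < i) (zinc b n r a.+1 c - d a.+1 c)| <= e'.
    apply: le_trans (ler_norm_sum _ _ _) _.
    apply: (@le_trans _ _ (\sum_(a < i) (2 * eta))).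
      apply: ler_sum => a _; have ar : (a.+1 < 2 ^ r)%N by apply: leq_trans ir; rewrite !ltnS.
      have := Hj a.+1 c isT ar; have := ltd a.+1 c ar; rewrite -/eta -/n.
      have := ler_distD (lattice_target q k a.+1 c) (zinc b n r a.+1 c) (d a.+1 c).
      lra.
    rewrite sumr_const card_ord -[_ *+ _]mulr_natr.
    apply: le_trans Veta; rewrite mulrAC ler_pM2r// /V.
    have i1 : i%:R <= 2 ^+ r :> R by rewrite -natrX ler_nat ltnW.
    have p1 : 1 <= 2 ^+ r :> R by rewrite exprn_ege1// ler1n.
    have m1 : 1 <= m.+1%:R :> R by rewrite ler1n.
    have pm : 1 <= 2 ^+ r * m.+1%:R :> R by exact: mulr_ege1.
    have := ler_wpM2l (ltW p0) pm; move: p0; move: (2 ^+ r) (m.+1%:R) (i%:R) i1 => x y z i1 x1 h.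
    lra.
  have s2 := ler_normB (Zn b n (dyadic R r 1) ord0 c) ((1 - e') * f (dyadic R r 1) ord0 c).
  have s3 : `|(1 - e') * f (dyadic R r 1) ord0 c| <= e'.
    rewrite normrM ger0_norm; last by lra.
    move: h2 (normr_ge0 (f (dyadic R r 1) ord0 c)); move: (`|f _ _ _|) => y y1 y0.
    by apply: le_trans y1; rewrite ler_piMl//; lra.
  lra.
move=> t t01 c; have /andP[t0 t1] := t01.
have /andP[a1 a2] := dyadic_floorP r t0.
have ir : (dyadic_floor r t <= 2 ^ r)%N by exact: dyadic_floor_le.
have td : `|t - dyadic R r (dyadic_floor r t)| <= (2 ^+ r)^-1.
  by rewrite ger0_norm ?subr_ge0// -(dyadicS R r (dyadic_floor r t)) lerB// ltW.
have h1 := Zd r t _ c t01 (dyu _ ir) td.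
have h2 := fd r t _ c t01 (dyu _ ir) td.
have h3 := grid _ c ir; have h4 := fdy _ ir c.
have h5 : `|e' * f (dyadic R r (dyadic_floor r t)) ord0 c| <= e'.
  by rewrite normrM (gtr0_norm e'0) ler_piMr// ltW.
move: h1 h2 h3 h5; move: (dyadic R r (dyadic_floor r t)) => u.
rewrite ltr_norml !ler_norml => /andP[? ?] /andP[? ?] /andP[? ?] /andP[? ?].
by apply/andP; split; lra.
Qed.

End approximation.

Section good_paths.
Context (R : realType) (dT : measure_display) (T : measurableType dT)
  (P : probability T R) (m : nat) (B : R -> T -> 'rV[R]_m).
Hypothesis BM : std_BM P B.

Lemma ae_good_path : {ae P, forall w, let b := fun t => B t w in
  [/\ b 0 = 0, continuous b, decay b, energy_limit b & dense_hits b]}.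
Proof.
have Fae := ae_filter_ringOfSetsType P.
have [_ [c0 _]] := BM.
have dec := ae_zinc_decay BM.
have en : {ae P, forall w, energy_limit (fun t => B t w)}.
  apply: ae_forall_countable => r; apply: ae_forall_countable => q.
  by apply: (ae_zinc_energy BM); rewrite ?invr_gt0 ?invf_le1// ler1n.
have hits : {ae P, forall w, dense_hits (fun t => B t w)}.
  apply: ae_forall_countable => r; apply: ae_forall_countable => q.
  apply: ae_forall_countable => k.
  have [r0|nr] := pselect (0 < r)%N; last by apply: (@filterE _ _ Fae) => w.
  have [s1|ns] := pselect (\sum_(a < (2 ^ r).-1) \sum_(c < m)
    (`|lattice_target R q k a.+1 c| + q.+1%:R^-1) ^+ 2 * 2 ^+ r <= 1); last first.
    by apply: (@filterE _ _ Fae) => w.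
  have eta0 : 0 < q.+1%:R^-1 :> R by rewrite invr_gt0.
  have H := ae_zinc_approx BM r0 eta0 s1.
  by apply: (@filterS _ _ Fae _ _ _ H) => w Hw _ _ J; exact: Hw.
apply: (@filterS2 _ _ Fae _ _ _ _ c0 (@filterI _ _ Fae _ _ dec (@filterI _ _ Fae _ _ en hits))).
by move=> w [b0 cb] [d [e h]]; split.
Qed.

End good_paths.

(** * Coordinates adapted to the drift *)

Section gram_factorization.
Variable R : realType.

Lemma tr_mulmx_eq0 (n p : nat) (N : 'M[R]_(n, p)) : N^T *m N = 0 -> N = 0.
Proof.
move=> H; apply/matrixP => i j; rewrite mxE; apply/eqP; rewrite -sqrf_eq0.
have : (N^T *m N) j j == 0 by rewrite H mxE.
rewrite mxE (eq_bigr (fun i => N i j ^+ 2)) => [|a _]; last by rewrite mxE expr2.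
rewrite psumr_eq0 => [/allP/(_ i)|a _]; last exact: sqr_ge0.
by rewrite mem_index_enum => /(_ isT).
Qed.

Lemma sum_sqr_mulmx (n : nat) (v : 'rV[R]_n) :
  \sum_c v ord0 c ^+ 2 = (v *m v^T) ord0 ord0.
Proof. by rewrite mxE; apply: eq_bigr => c _; rewrite mxE expr2. Qed.

(* [Q = A G C^T] for a generalized inverse [G] of [C^T C]; then [Q Q^T] is an
   orthogonal projection. *)
Lemma gram_factor (n p k : nat) (A : 'M[R]_(n, k)) (C : 'M[R]_(p, k)) :
  A^T *m A = C^T *m C ->
  exists Q : 'M[R]_(n, p), Q *m C = A /\
    forall v : 'rV[R]_n, \sum_c (v *m Q) ord0 c ^+ 2 <= \sum_c v ord0 c ^+ 2.
Proof.
move=> AC; have [M ME] : exists M, C^T *m C = M by exists (C^T *m C).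
have MT : M^T = M by rewrite -ME trmx_mul trmxK.
rewrite ME in AC; have [G GE] : exists G, pinvmx M = G by exists (pinvmx M).
have MGM : M *m G *m M = M by rewrite -GE mulmxKpV.
(* With [N = A (G M - 1)] and [A^T A = M], the product [N^T N] contains the factor [M (G M - 1)],
   which is 0. *)
have AGM : A *m G *m M = A.
  apply/eqP; rewrite -subr_eq0; apply/eqP/tr_mulmx_eq0.
  have -> : A *m G *m M - A = A *m (G *m M - 1%:M) by rewrite mulmxBr mulmx1 mulmxA.
  rewrite trmx_mul -mulmxA (mulmxA A^T) AC mulmxBr mulmx1 mulmxA MGM subrr.
  by rewrite mulmx0.
pose Q := A *m G *m C^T; exists Q; split; first by rewrite /Q -mulmxA ME.
move=> v; rewrite !sum_sqr_mulmx; have [Pi PiD] : exists Pi, Q *m Q^T = Pi by exists (Q *m Q^T).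
have PiE : Pi = A *m G^T *m A^T.
  by rewrite -PiD /Q !trmx_mul trmxK !mulmxA -(mulmxA (A *m G)) ME AGM.
have PiT : Pi^T = Pi by rewrite -PiD trmx_mul trmxK.
have Pi2 : Pi *m Pi = Pi.
  have MGA : M *m G^T *m A^T = A^T.
    by rewrite -{2}AGM !trmx_mul MT mulmxA.
  have -> : Pi *m Pi = A *m G^T *m ((A^T *m A) *m G^T *m A^T) by rewrite PiE !mulmxA.
  by rewrite AC MGA PiE.
have E1 : v *m Q *m (v *m Q)^T = v *m Pi *m v^T by rewrite -PiD trmx_mul !mulmxA.
(* Pythagoras: [|v|^2 - |v Q|^2 = |v - v Pi|^2]. *)
have E2 : (v - v *m Pi) *m (v - v *m Pi)^T = v *m v^T - v *m Pi *m v^T.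
  rewrite linearB/= trmx_mul PiT mulmxBr !mulmxBl !mulmxA -(mulmxA v Pi Pi) Pi2.
  by rewrite subrr subr0.
have : 0 <= ((v - v *m Pi) *m (v - v *m Pi)^T) ord0 ord0.
  by rewrite -sum_sqr_mulmx; apply: sumr_ge0 => c _; exact: sqr_ge0.
by rewrite E2 E1 !mxE subr_ge0.
Qed.

Lemma energy_le_mulmx (n p : nat) (Q : 'M[R]_(n, p)) (f : R -> 'rV[R]_n) (E : R) :
  (forall v : 'rV[R]_n, \sum_c (v *m Q) ord0 c ^+ 2 <= \sum_c v ord0 c ^+ 2) ->
  energy_le f E -> energy_le (fun t => f t *m Q) E.
Proof.
move=> HQ Hf s cs; apply: le_trans (Hf s cs); rewrite big_seq [leRHS]big_seq.
apply: ler_sum => x xs; rewrite -!mulr_suml; apply: ler_wpM2r.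
  rewrite invr_ge0 subr_ge0; case/andP: cs => /allP/(_ x xs)/and3P[_ + _] _; exact.
have := HQ (f x.2 - f x.1); rewrite mulmxBl => H.
have mB l (a b : 'rV[R]_l) c : (a - b) ord0 c = a ord0 c - b ord0 c by rewrite !mxE.
under eq_bigr do rewrite -mB.
by apply: le_trans H _; apply: ler_sum => c _; rewrite mB.
Qed.

End gram_factorization.

Section normalization.
Variable R : realType.

(** Using [ln x < x] twice, [loglog n < ln n < 2 sqrt n], hence [ell n ^ 2 < 4 n^(3/2)]; this is
    below [e^2 n^2] once [sqrt n > 4 / e^2]. *)
Lemma ell_sublinear (e : R) : 0 < e -> exists N : nat, forall n, (N <= n)%N ->
  [/\ 0 < n%:R :> R, 0 < @ell R n & @ell R n < e * n%:R].
Proof.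
move=> e0; have [j0 Hj0] := @loglog_pow2_ge R 1.
exists (maxn (2 ^ j0) (Num.trunc ((4 / e ^+ 2) ^+ 2)).+1) => n.
rewrite geq_max => /andP[n1 n2].
have L0 : 0 < loglog R n.
  have [_ H] := Hj0 j0 (leqnn _); have H0 : 0 < loglog R (2 ^ j0) by exact: lt_le_trans H.
  by apply: (lt_le_trans H0); exact: loglog_homo.
have n3 := loglog_gt0_ge3 L0; have n0 : 0 < n%:R :> R by rewrite ltr0n; apply: leq_trans n3.
have l0 : 0 < ln n%:R :> R by rewrite ln_gt0// ltr1n; apply: leq_trans n3.
split=> //; first exact: ell_gt0.
have e0' : 0 <= e * n%:R by rewrite mulr_ge0// ltW.
rewrite -ltr_sqr ?nnegrE// ?(ltW (ell_gt0 L0))// sqr_ell//.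
have LLl : loglog R n < ln n%:R by exact: ln_sublinear.
have [s0 sE] : 0 < Num.sqrt (n%:R : R) /\ n%:R = Num.sqrt (n%:R : R) ^+ 2.
  by rewrite sqrtr_gt0 sqr_sqrtr// ltW.
have ns : 4 / e ^+ 2 < Num.sqrt (n%:R : R).
  rewrite -ltr_sqr ?nnegrE ?(ltW s0)// ?divr_ge0 ?sqr_ge0// -sE.
  by apply: lt_le_trans (truncnS_gt _) _; rewrite ler_nat.
rewrite ltr_pdivrMr ?exprn_gt0// in ns.
move: (Num.sqrt _) sE LLl ns s0 => s ->  LLl ns s0.
have ls : ln (s ^+ 2) < 2 * s.
  by rewrite lnXn// -[ln s *+ 2]mulr_natl ltr_pM2l// ln_sublinear.
have Ls : loglog R n < 2 * s by exact: lt_trans LLl ls.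
have s2 : 0 < s ^+ 2 by rewrite exprn_gt0.
have s3 : 0 < s ^+ 3 by rewrite exprn_gt0.
apply: (@lt_le_trans _ _ (2 * s ^+ 2 * (2 * s))); first by rewrite ltr_pM2l// mulr_gt0.
rewrite (_ : 2 * s ^+ 2 * (2 * s) = 4 * s ^+ 3); last by ring.
rewrite (_ : (e * s ^+ 2) ^+ 2 = s * e ^+ 2 * s ^+ 3); last by ring.
by rewrite ler_pM2r// ltW.
Qed.

Lemma norm_mulmx_le n p (v : 'rV[R]_n) (A : 'M[R]_(n, p)) x j :
  0 <= x -> (forall a, `|v ord0 a| <= x) ->
  `|(v *m A) ord0 j| <= x * \sum_a \sum_i `|A a i|.
Proof.
move=> x0 vx; rewrite mxE; apply: le_trans (ler_norm_sum _ _ _) _.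
rewrite mulr_sumr; apply: ler_sum => a _; rewrite normrM; apply: ler_pM => //.
by rewrite (bigD1 j)//= lerDl; apply: sumr_ge0.
Qed.

End normalization.

Section drift_coordinates.
Variables (R : realType) (k : nat) (mu : 'rV[R]_k.+1) (Sigma S E : 'M[R]_k.+1).
Variable Sp : 'M[R]_k.
Implicit Types (b h g : R -> 'rV[R]_k.+1) (f : R -> 'rV[R]_k).
Hypotheses (mu0 : mu != 0) (HS : psd_sqrt S Sigma) (HE : adapted_onb E mu)
  (HSp : psd_sqrt Sp (Sigma_perp E Sigma)).

Local Notation A := (S *m E^T).

Definition perp_part : 'M[R]_(k.+1, k) := \matrix_(a, j) A a (lift ord0 j).

Local Notation L := perp_part.

Lemma mulmx_perp (v : 'rV[R]_k.+1) j : (v *m L) ord0 j = (v *m A) ord0 (lift ord0 j).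
Proof. by rewrite !mxE; apply: eq_bigr => a _; rewrite mxE. Qed.

Lemma gram_perp : L^T *m L = Sp^T *m Sp.
Proof.
have [[ST _] SS] := HS; have [[SpT _] SpSp] := HSp.
rewrite SpT SpSp; apply/matrixP => i j; rewrite [RHS]mxE.
transitivity ((A^T *m A) (lift ord0 i) (lift ord0 j)).
  by rewrite !mxE; apply: eq_bigr => a _; rewrite !mxE.
by rewrite trmx_mul trmxK ST -SS !mulmxA.
Qed.

Lemma coords_drift : coords E mu = \row_i (if i == ord0 then eucl mu else 0).
Proof.
have [EE E0] := HE.
have e0 : eucl mu != 0.
  apply/negP => /eqP e0; move/negP: mu0; apply; apply/eqP/rowP => i; rewrite mxE.
  by apply/eqP; rewrite -normr_le0 -e0; exact: coord_le_eucl.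
have -> : coords E mu = coords E (eucl mu *: row ord0 E) by rewrite E0 scalerA divff// scale1r.
rewrite /coords -scalemxAl -row_mul EE; apply/rowP => i; rewrite !mxE eq_sym.
by case: (i == ord0); rewrite ?mulr1 ?mulr0.
Qed.

(* The image of a limit path [h] of [Zn b] in the coordinates of [E]. *)
Definition profile (h : R -> 'rV[R]_k.+1) (t : R) : 'rV[R]_k.+1 :=
  \row_i (if unlift ord0 i is Some j then (h t *m L) ord0 j else eucl mu * t).

Lemma profileE h f t : h t *m L = f t *m Sp -> profile h t = Wfun mu Sp f t.
Proof. by move=> hf; apply/rowP => i; rewrite !mxE; case: unlift => // j; rewrite hf. Qed.

Lemma profile0 h : h 0 = 0 -> profile h 0 = 0.
Proof.
move=> h0; apply/rowP => i; rewrite !mxE; case: unlift => [j|]; last by rewrite mulr0.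
by rewrite h0 mul0mx mxE.
Qed.

Lemma dyadic_holder_profile K h : 0 <= K -> dyadic_holder K h -> exists K', dyadic_holder K' (profile h).
Proof.
move=> K0 dh; exists (K * (\sum_a \sum_i `|L a i|) + eucl mu).
have m0 : 0 <= eucl mu by exact: sqrtr_ge0.
have L0 : 0 <= \sum_a \sum_i `|L a i| by apply: sumr_ge0 => a _; apply: sumr_ge0.
move=> r s t c s01 t01 st; have r0 : 0 <= (9 / 10 : R) ^+ r by rewrite exprn_ge0//; lra.
rewrite mulrDl !mxE; case: unlift => [j|].
  apply: ler_wpDr; first by rewrite mulr_ge0.
  have -> : (h s *m L) ord0 j - (h t *m L) ord0 j = ((h s - h t) *m L) ord0 j.
    by rewrite mulmxBl !mxE.
  rewrite mulrAC; apply: norm_mulmx_le; first by rewrite mulr_ge0.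
  by move=> a; have := dh r s t a s01 t01 st; rewrite !mxE.
rewrite -mulrBr normrM ger0_norm//; apply: ler_wpDl; first by rewrite !mulr_ge0.
apply: ler_wpM2l => //; apply: le_trans st _; rewrite -exprVn.
by apply: lerXn2r; rewrite ?nnegrE; lra.
Qed.

Definition rescaled (b : R -> 'rV[R]_k.+1) (n : nat) (t : R) : 'rV[R]_k.+1 :=
  psi n (coords E ((n%:R * t) *: mu + b (n%:R * t) *m S)).

Lemma coords_rescaled b (x : R) i : coords E (x *: mu + b x *m S) ord0 i =
  x * (if i == ord0 then eucl mu else 0) + (b x *m A) ord0 i.
Proof.
rewrite /coords mulmxDl -scalemxAl -/(coords E mu) coords_drift -mulmxA.
by rewrite [LHS]mxE; congr (_ + _); rewrite !mxE.
Qed.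

Lemma rescaled_perp b n t j :
  rescaled b n t ord0 (lift ord0 j) = (Zn b n t *m L) ord0 j.
Proof.
rewrite /rescaled [LHS]mxE coords_rescaled eq_sym (negbTE (neq_lift _ _)).
by rewrite mulr0 add0r mulmx_perp /Zn -scalemxAl [RHS]mxE mulrC.
Qed.

Lemma rescaled_drift b n t : 0 < n%:R :> R -> @ell R n != 0 ->
  rescaled b n t ord0 ord0 =
    eucl mu * t + @ell R n / n%:R * (Zn b n t *m A) ord0 ord0.
Proof.
move=> n0 e0; rewrite /rescaled [LHS]mxE coords_rescaled eqxx /Zn -scalemxAl.
rewrite [in RHS]mxE.
by move: ((b _ *m _) _ _) => x; field; rewrite e0 gt_eqF.
Qed.

(** The perpendicular coordinates are a fixed linear image of [Zn b]. In the drift coordinate the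
    noise is [ell n / n] times a linear image of [Zn b], which is bounded by its modulus from time
    0. *)
Lemma ucvg01_rescaled b phi h : b 0 = 0 -> continuous b -> decay b -> strict_incr phi ->
  ucvg01 (fun n => Zn b (phi n)) h -> ucvg01 (fun n => rescaled b (phi n)) (profile h).
Proof.
move=> b0 cb db sphi /ucvg01P bh; apply/ucvg01P => e e0.
have [N1 H1] := dyadic_holder_Zn cb db.
pose KL : R := \sum_a \sum_i `|L a i|; pose KA : R := \sum_a \sum_i `|A a i|.
have KL0 : 0 <= KL by apply: sumr_ge0 => a _; apply: sumr_ge0.
have KA0 : 0 <= KA by apply: sumr_ge0 => a _; apply: sumr_ge0.
have eL : 0 < e / (KL + 1) by rewrite divr_gt0//; lra.
(* 76 bounds the coordinates of [Zn b] on [[0, 1]]; the added 1 keeps the denominator positive and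
   the final inequality strict. *)
have eA : 0 < e / (76 * KA + 1) by rewrite divr_gt0//; lra.
have [N2 H2] := bh _ eL; have [N3 H3] := ell_sublinear eA.
exists (maxn N2 (maxn N1 N3)) => n; rewrite !geq_max => /and3P[n2 n1 n3] t t01 i.
have pn := strict_incr_ge sphi n.
have dZ := H1 _ (leq_trans n1 pn); have [n0 l0 le] := H3 _ (leq_trans n3 pn).
have u0 : unit_interval (0 : R) by rewrite /unit_interval /= lexx ler01.
case: (unliftP ord0 i) => [j|] ->.
  rewrite rescaled_perp [profile h t _ _]mxE liftK.
  have -> : (Zn b (phi n) t *m L) ord0 j - (h t *m L) ord0 j =
    ((Zn b (phi n) t - h t) *m L) ord0 j by rewrite mulmxBl !mxE.
  apply: (@le_lt_trans _ _ (e / (KL + 1) * KL)).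
    apply: norm_mulmx_le; first exact: ltW.
    by move=> a; have := H2 n n2 t t01 a; rewrite !mxE => /ltW.
  by rewrite mulrAC ltr_pdivrMr ?ltr_pM2l//; lra.
rewrite rescaled_drift ?gt_eqF// [profile h t _ _]mxE unlift_none.
rewrite addrAC subrr add0r normrM gtr0_norm ?divr_gt0//.
apply: (@le_lt_trans _ _ (e / (76 * KA + 1) * (76 * KA))).
  apply: ler_pM => //; first by rewrite ltW// divr_gt0.
    by rewrite ler_pdivrMr// ltW.
  apply: norm_mulmx_le => // a; have : `|t - 0| <= (2 ^+ 0)^-1 :> R.
    by case/andP: t01 => t0 t1; rewrite subr0 expr0 invr1 ger0_norm.
  move=> /(dZ 0%N t 0 a t01 u0); rewrite (Zn0 _ b0) expr0 mulr1.
  by rewrite (_ : (0 : 'rV[R]_k.+1) ord0 a = 0) ?subr0// mxE.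
by rewrite mulrAC ltr_pdivrMr ?ltr_pM2l//; lra.
Qed.

(** Convergence of the rescaled paths need not give convergence of [Zn b], because [L] may have a
    kernel. A further subsequence along which [Zn b] converges is extracted, and [g] is identified
    through uniqueness of limits. *)
Lemma limit_points_rescaled b : b 0 = 0 -> continuous b -> decay b -> energy_limit b ->
  dense_hits b ->
  rel_compact_seq (rescaled b) /\
  (forall g, seq_limit_point (rescaled b) g <->
     exists f : R -> 'rV[R]_k,
       inU f /\ forall t, unit_interval t -> g t = Wfun mu Sp f t).
Proof.
move=> b0 cb db eb hb; split=> [phi sphi|g].
  have [p [h [sp h0 dh ch]]] := relatively_compact_Zn b0 cb db sphi.
  exists p; split=> //; exists (profile h); split.
    have [|K dK] := @dyadic_holder_profile 76 h _ dh; first by [].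
    by apply: dyadic_holder_inC0 dK; exact: profile0.
  exact: (@ucvg01_rescaled b (fun n => phi (p n)) h b0 cb db (strict_incr_comp sphi sp) ch).
split=> [[_ [phi [sphi cg]]]|[f [/inUP[f0 Ef] gf]]].
  have [p [h [sp h0 dh ch]]] := relatively_compact_Zn b0 cb db sphi.
  have sc := strict_incr_comp sphi sp.
  have Eh := limit_point_energy b0 cb db eb sc ch.
  (* [Q *m Sp = L], so [h *m Q] is a path in [U] with the same image under [Sp] as [h] under [L]. *)
  have [Q [QSp HQ]] := gram_factor gram_perp.
  exists (fun t => h t *m Q); split.
    by apply/inUP; split; [rewrite h0 mul0mx|exact: energy_le_mulmx].
  move=> t t01; rewrite -(@profileE h); last by rewrite -mulmxA QSp.
  have cp := ucvg01_rescaled b0 cb db sc ch; have cg' := ucvg01_subseq sp cg.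
  apply/rowP => c; have := ucvg01_cvg (c := c) cp t01.
  have := ucvg01_cvg (c := c) cg' t01; exact: cvg_unique.
(* The opposite factorization [Q *m L = Sp] lifts [f] to a path in dimension [k.+1] without raising
   its energy. *)
have [Q [QL HQ]] := gram_factor (esym gram_perp).
pose h t := f t *m Q.
have h0 : h 0 = 0 by rewrite /h f0 mul0mx.
have Eh : energy_le h 1 by exact: energy_le_mulmx.
have hf t : profile h t = Wfun mu Sp f t by apply: profileE; rewrite /h -mulmxA QL.
have [phi [sphi ch]] := approximation b0 cb db hb h0 Eh.
split; last first.
  exists phi; split=> // e e0.
  have [N HN] := ucvg01_rescaled b0 cb db sphi ch e0; exists N => n Nn t t01.
  by rewrite gf// -hf; exact: HN.
have [|K dK] := @dyadic_holder_profile 1 h _ (energy_le_dyadic_holder Eh); first by [].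
apply: (@dyadic_holder_inC0 _ _ K).
  have u0 : unit_interval (0 : R) by rewrite /unit_interval /= lexx ler01.
  by rewrite gf// -hf profile0.
by move=> r s t c s01 t01 st; rewrite !gf// -!hf; exact: dK.
Qed.

End drift_coordinates.

(* dimension d = k.+1 (d >= 1 is forced by mu <> 0) *)
Theorem theorem3p1 (R : realType) (dT : measure_display) (T : measurableType dT)
  (P : probability T R) (k : nat) (mu : 'rV[R]_k.+1) (Sigma S E : 'M[R]_k.+1)
  (Sp : 'M[R]_k) (B : R -> T -> 'rV[R]_k.+1) :
  mu != 0 ->
  psd Sigma ->
  psd_sqrt S Sigma ->
  adapted_onb E mu ->
  psd_sqrt Sp (Sigma_perp E Sigma) ->
  std_BM P B ->
  {ae P, forall w : T,
     rel_compact_seq (Fseq mu S E B w) /\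
     (forall g : R -> 'rV[R]_k.+1,
        seq_limit_point (Fseq mu S E B w) g <->
        exists f : R -> 'rV[R]_k,
          inU f /\ forall t, unit_interval t -> g t = Wfun mu Sp f t)}.
Proof.
move=> mu0 _ HS HE HSp BM.
have Fae := ae_filter_ringOfSetsType P.
apply: (@filterS _ _ Fae _ _ _ (ae_good_path BM)) => w [b0 cb db eb hb].
exact: (limit_points_rescaled mu0 HS HE HSp b0 cb db eb hb).
Qed.
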